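(* Each item below is a statement about the class of all cubic 3-connected graphs. These twenty-two statements are pairwise equivalent: either all of them are true or all of them are false. (z1) For every cubic 3-connected graph $G$ with $v(G)\equiv 0 \pmod 6$, $G$ has a $\Lambda$-factor. (z2) For every cubic 3-connected $G$ with $v(G)\equiv 0\pmod 6$ and every $e\in E(G)$, $G-e$ has a $\Lambda$-factor. (z3) For every cubic 3-connected $G$ with $v(G)\equiv 0\pmod 6$ and every $e\in E(G)$, there is a $\Lambda$-factor of $G$ containing $e$. (z4) For every cubic 3-connected $G$ with $v(G)\equiv 0\pmod 6$ and every $x\in V(G)$, there is at least one 3-vertex path $L$ in $G$ with center $x$ such that $G-L$ has a $\Lambda$-factor. (z5) For every cubic 3-connected $G$ with $v(G)\equiv 0\pmod 6$ and every $x\in V(G)$, there are at least two distinct 3-vertex paths $L$ in $G$ with center $x$ such that $G-L$ has a $\Lambda$-factor. (z6) For every cubic 3-connected $G$ with $v(G)\equiv 0\pmod 6$ and every edge $xy\in E(G)$, there exist edges $xx', yy'\in E(G)$ with $x'\neq y$, $y'\neq x$ such that both $G-\{x,y,y'\}$ and $G-\{x',x,y\}$ have $\Lambda$-factors. (z7) For every cubic 3-connected $G$ with $v(G)\equiv 0\pmod 6$ and every $X\subseteq E(G)$ with $|X|=2$, $G-X$ has a $\Lambda$-factor. (z8) For every cubic 3-connected $G$ with $v(G)\equiv 0\pmod 6$ and every 3-vertex path $L$ in $G$, $G-L$ has a $\Lambda$-factor. (z9) For every cubic 3-connected $G$ with $v(G)\equiv 0\pmod 6$, every edge cut $K=D(X,G)$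 with $|K|=3$ ($\emptyset\ne X\subsetneq V(G)$) and every $S\subset K$ with $|S|=2$, there is a $\Lambda$-factor $P$ of $G$ with $E(P)\cap K=S$. (t1) For every cubic 3-connected $G$ with $v(G)\equiv 2\pmod 6$ and every $x\in V(G)$, there is an edge $xy\in E(G)$ such that $G-\{x,y\}$ has a $\Lambda$-factor. (t2) For every cubic 3-connected $G$ with $v(G)\equiv 2\pmod 6$ and every edge $xy\in E(G)$, $G-\{x,y\}$ has a $\Lambda$-factor. (t3) For every cubic 3-connected $G$ with $v(G)\equiv 2\pmod 6$ and every $x\in V(G)$, there is a 5-vertex path $W$ in $G$ whose center (third) vertex is $x$ such that $G-W$ has a $\Lambda$-factor. (t4) For every cubic 3-connected $G$ with $v(G)\equiv 2\pmod 6$, every $x\in V(G)$ and every edge $xy\in E(G)$, there is a 5-vertex path $W$ whose center vertex is $x$, with $xy\notin E(W)$, such that $G-W$ has a $\Lambda$-factor. (f1) For every cubic 3-connected $G$ with $v(G)\equiv 4\pmod 6$ and every $x\in V(G)$, $G-x$ has a $\Lambda$-factor. (f2) For every cubic 3-connected $G$ with $v(G)\equiv 4\pmod 6$, every $x\in V(G)$ and every $e\in E(G)$, the graph obtained from $G$ by deleting the vertex $x$ and the edge $e$ has a $\Lambda$-factor. (f3) For every cubic 3-connected $G$ with $v(G)\equiv 4\pmod 6$ and every $x\in V(G)$, there is a 4-vertex path $Z$ having $x$ as an inner vertex such that $G-Z$ has a $\Lambda$-factor. (f4) For every cubic 3-connected $G$ with $v(G)\equiv 4\pmod 6$ and every $x\in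 V(G)$, there exist an edge $xy\in E(G)$ and a 4-vertex path $Z$ having $x$ as an inner vertex with $xy\notin E(Z)$ such that $G-Z$ has a $\Lambda$-factor. (f5) For every cubic 3-connected $G$ with $v(G)\equiv 4\pmod 6$ and every edge $xy\in E(G)$, there is a 4-vertex path $Z$ whose middle edge is $xy$ such that $G-Z$ has a $\Lambda$-factor. (f6) For every cubic 3-connected $G$ with $v(G)\equiv 4\pmod 6$ and every 3-vertex path $xyz$ in $G$, there is a 4-vertex path $Z$ containing the path $xyz$ and having $z$ as an end-vertex such that $G-Z$ has a $\Lambda$-factor.
   Context: All graphs are finite, undirected, without loops or parallel edges. $v(G)=|V(G)|$. A $\Lambda$ denotes a 3-vertex path; the center of a 3-vertex path $abc$ is $b$; the center vertex of a 5-vertex path is its third vertex; the inner vertices of a 4-vertex path are its two non-end vertices and its middle edge is the edge joining them. A $\Lambda$-packing of $G$ is a subgraph of $G$ all of whose components are 3-vertex paths; a $\Lambda$-factor is a $\Lambda$-packing $P$ with $V(P)=V(G)$. For a subgraph $H$ (e.g. a path) of $G$, $G-H$ denotes the graph obtained by deleting the vertices of $H$; for a vertex set $Y$, $G-Y$ deletes those vertices; for an edge $e$ or edge set $X$, $G-e$, $G-X$ delete those edges only. For $X\subseteq V(G)$, $D(X,G)$ is the set of edges with exactly one end in $X$. *)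

(* Defs.v *)
(* Simple graphs are symmetric irreflexive relations on a finType. *)
From mathcomp Require Import all_boot.
Set Implicit Arguments. Unset Strict Implicit. Unset Printing Implicit Defensive.

Section Graphs.
Variable T : finType.

Definition edge_set (F : rel T) : {set {set T}} :=
  [set A : {set T} | [exists x, exists y, F x y && (A == [set x; y])]].

Definition cubic (e : rel T) : Prop := forall x : T, #|[set y | e x y]| = 3.

Definition connected_on (V : {set T}) (E : rel T) : Prop :=
  forall u v, u \in V -> v \in V ->
    connect [rel a b | [&& a \in V, b \in V & E a b]] u v.

Definition three_connected (e : rel T) : Prop :=
  3 < #|T| /\ forall S : {set T}, #|S| < 3 -> connected_on (~: S) e.

Definition cubic_3conn (e : rel T) : Prop :=
  [/\ symmetric e, irreflexive e, cubic e & three_connected e].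

Definition del_edges (e : rel T) (X : {set {set T}}) : rel T :=
  fun x y => e x y && ([set x; y] \notin X).

(* F is the edge set of a Lambda-factor of the graph (V, E): the spanning
   subgraph (V, F) of (V, E) has every component a 3-vertex path. *)
Definition is_lfactor (V : {set T}) (E : rel T) (F : rel T) : Prop :=
  [/\ symmetric F,
      (forall u v, F u v -> [&& u \in V, v \in V & E u v]) &
      (forall x, x \in V -> exists a b c,
         [/\ uniq [:: a; b; c], x \in [:: a; b; c], F a b, F b c &
             forall u v, u \in [:: a; b; c] -> F u v ->
               [set u; v] \in [set [set a; b]; [set b; c]]])].

Definition has_lfactor (V : {set T}) (E : rel T) : Prop :=
  exists F : rel T, is_lfactor V E F.

Definition gpath (E : rel T) (s : seq T) : bool :=
  if s is x :: p then uniq s && path E x p else false.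

Definition path_edges (s : seq T) : {set {set T}} :=
  [set A : {set T} | [exists p : T * T,
     (p \in zip s (behead s)) && (A == [set p.1; p.2])]].

Definition cut (e : rel T) (X : {set T}) : {set {set T}} :=
  [set A in edge_set e | #|A :&: X| == 1].

End Graphs.

Definition stmt_z1 : Prop := forall (T : finType) (e : rel T),
  cubic_3conn e -> #|T| %% 6 = 0 -> has_lfactor setT e.

Definition stmt_z2 : Prop := forall (T : finType) (e : rel T),
  cubic_3conn e -> #|T| %% 6 = 0 ->
  forall A, A \in edge_set e -> has_lfactor setT (del_edges e [set A]).

Definition stmt_z3 : Prop := forall (T : finType) (e : rel T),
  cubic_3conn e -> #|T| %% 6 = 0 ->
  forall A, A \in edge_set e ->
    exists F, is_lfactor setT e F /\ A \in edge_set F.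

Definition stmt_z4 : Prop := forall (T : finType) (e : rel T),
  cubic_3conn e -> #|T| %% 6 = 0 ->
  forall x : T, exists L : seq T,
    [/\ gpath e L, size L = 3, nth x L 1 = x & has_lfactor (~: [set y in L]) e].

Definition stmt_z5 : Prop := forall (T : finType) (e : rel T),
  cubic_3conn e -> #|T| %% 6 = 0 ->
  forall x : T, exists L1 L2 : seq T,
    [/\ path_edges L1 != path_edges L2,
        [/\ gpath e L1, size L1 = 3, nth x L1 1 = x &
            has_lfactor (~: [set y in L1]) e] &
        [/\ gpath e L2, size L2 = 3, nth x L2 1 = x &
            has_lfactor (~: [set y in L2]) e]].

Definition stmt_z6 : Prop := forall (T : finType) (e : rel T),
  cubic_3conn e -> #|T| %% 6 = 0 ->
  forall x y : T, e x y -> exists x' y' : T,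
    [/\ e x x' /\ e y y', x' != y, y' != x,
        has_lfactor (~: [set x; y; y']) e & has_lfactor (~: [set x'; x; y]) e].

Definition stmt_z7 : Prop := forall (T : finType) (e : rel T),
  cubic_3conn e -> #|T| %% 6 = 0 ->
  forall X : {set {set T}}, X \subset edge_set e -> #|X| = 2 ->
    has_lfactor setT (del_edges e X).

Definition stmt_z8 : Prop := forall (T : finType) (e : rel T),
  cubic_3conn e -> #|T| %% 6 = 0 ->
  forall L : seq T, gpath e L -> size L = 3 -> has_lfactor (~: [set y in L]) e.

Definition stmt_z9 : Prop := forall (T : finType) (e : rel T),
  cubic_3conn e -> #|T| %% 6 = 0 ->
  forall X : {set T}, X != set0 -> X != setT -> #|cut e X| = 3 ->
  forall S : {set {set T}}, S \subset cut e X -> #|S| = 2 ->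
    exists F, is_lfactor setT e F /\
      forall A, A \in cut e X -> (A \in edge_set F) = (A \in S).

Definition stmt_t1 : Prop := forall (T : finType) (e : rel T),
  cubic_3conn e -> #|T| %% 6 = 2 ->
  forall x : T, exists y : T, e x y /\ has_lfactor (~: [set x; y]) e.

Definition stmt_t2 : Prop := forall (T : finType) (e : rel T),
  cubic_3conn e -> #|T| %% 6 = 2 ->
  forall x y : T, e x y -> has_lfactor (~: [set x; y]) e.

Definition stmt_t3 : Prop := forall (T : finType) (e : rel T),
  cubic_3conn e -> #|T| %% 6 = 2 ->
  forall x : T, exists W : seq T,
    [/\ gpath e W, size W = 5, nth x W 2 = x & has_lfactor (~: [set y in W]) e].

Definition stmt_t4 : Prop := forall (T : finType) (e : rel T),
  cubic_3conn e -> #|T| %% 6 = 2 ->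
  forall x y : T, e x y -> exists W : seq T,
    [/\ gpath e W, size W = 5, nth x W 2 = x, [set x; y] \notin path_edges W &
        has_lfactor (~: [set z in W]) e].

Definition stmt_f1 : Prop := forall (T : finType) (e : rel T),
  cubic_3conn e -> #|T| %% 6 = 4 ->
  forall x : T, has_lfactor (~: [set x]) e.

Definition stmt_f2 : Prop := forall (T : finType) (e : rel T),
  cubic_3conn e -> #|T| %% 6 = 4 ->
  forall (x : T) (A : {set T}), A \in edge_set e ->
    has_lfactor (~: [set x]) (del_edges e [set A]).

Definition stmt_f3 : Prop := forall (T : finType) (e : rel T),
  cubic_3conn e -> #|T| %% 6 = 4 ->
  forall x : T, exists Z : seq T,
    [/\ gpath e Z, size Z = 4, nth x Z 1 = x \/ nth x Z 2 = x &
        has_lfactor (~: [set y in Z]) e].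

Definition stmt_f4 : Prop := forall (T : finType) (e : rel T),
  cubic_3conn e -> #|T| %% 6 = 4 ->
  forall x : T, exists (y : T) (Z : seq T),
    [/\ e x y /\ gpath e Z, size Z = 4, nth x Z 1 = x \/ nth x Z 2 = x,
        [set x; y] \notin path_edges Z & has_lfactor (~: [set z in Z]) e].

Definition stmt_f5 : Prop := forall (T : finType) (e : rel T),
  cubic_3conn e -> #|T| %% 6 = 4 ->
  forall x y : T, e x y -> exists Z : seq T,
    [/\ gpath e Z, size Z = 4, [set nth x Z 1; nth x Z 2] = [set x; y] &
        has_lfactor (~: [set z in Z]) e].

Definition stmt_f6 : Prop := forall (T : finType) (e : rel T),
  cubic_3conn e -> #|T| %% 6 = 4 ->
  forall x y z : T, gpath e [:: x; y; z] -> exists Z : seq T,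
    [/\ gpath e Z, size Z = 4,
        [set x; y] \in path_edges Z /\ [set y; z] \in path_edges Z,
        head x Z = z \/ last x Z = z &
        has_lfactor (~: [set w in Z]) e].

(* Main.v *)
(* A Lambda-factor is encoded by the map sending each vertex to the centre of its 3-vertex path.

   Subdividing two edges and joining the two new vertices preserves "cubic 3-connected" and adds
   two vertices.  Deleting a suitable path of the new graph leaves the old graph with the wanted
   vertices or edges deleted, up to pendant vertices, which force the path through them: this
   gives z8 => t2, f2, f6, then f2 => t4 and t2 => z7.

   The other implications use a frame (K4 or K33) in which some vertices are replaced by copies
   of A - a.  Across the three edges at a copy, let [ins] and [outs] count the used edges at
   which the path is centred inside, respectively outside, the copy; then
   |A - a| + ins = outs (mod 3), whereas a vertex of K33 that was not replaced supplies
   outs + 2 ins = 2 to the opposite side.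
   - z1 => f1: K33 with one side replaced; the three copies share a total of 6 and each share is
     a multiple of 3, so some copy is not entered at all.
   - f1 => z8 and f3 => z1: K4 with three vertices replaced.
   - t1 => z1 and t3 => z1: K33 with two vertices of one side replaced; each share is at least 2
     and their total is at most 4.

   For z9 each side of the 3-edge cut is contracted to a vertex, which again gives cubic
   3-connected graphs, and the factors supplied by z8, t4 and f6 are glued. *)
Require Import Defs.
From mathcomp Require Import all_boot zify.
Set Implicit Arguments. Unset Strict Implicit. Unset Printing Implicit Defensive.

(** * Factors as maps to centres *)

(** The congruence at a copy comes from counting the vertices whose centre lies in it: they come in
    threes, and they are the vertices of the copy, minus one for each out-crossing, plus one for
    each in-crossing. So the residue of outs - ins is known. The share outs + 2 ins replaces -1 by
    2: the residue is unchanged, but the share is nonnegative, so a residue becomes a lower bound.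
    Seen from the other end of the edges, the same weights give an unreplaced vertex the value 2
    whether it ends its path (one edge of weight 2) or is its centre (two edges of weight 1). The
    total is therefore known without knowing the factor, and it leaves no slack above the lower
    bounds. The frames are fitted to the residues mod 6: for |A| = 4, K33 with three copies has 3 +
    3(|A| - 1) = 0 vertices; for |A| = 0, K33 with two copies has 4 + 2(|A| - 1) = 2, and K4 with
    three copies has 1 + 3(|A| - 1) = 4. The obstacle is that z1 gives no control over where the
    paths lie. The frame turns bare existence in a larger graph into forced behaviour at one vertex
    of A, and the step from z1 over f1 to z8 gains all the local control that the other statements
    require. *)

Section StarFun.
Variable T : finType.
Implicit Types (V W : {set T}) (E F : rel T) (c : T -> T).

(** Three vertices with one centre, the other two adjacent to it, form a 3-vertex path, so a fibre
    size replaces a list of components. Being the identity off [V] lets such maps be composed and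
    counted on all of [T]. *)
Definition star_fun V E c : Prop :=
  (forall v, v \notin V -> c v = v) /\
  (forall v, v \in V -> [/\ c v \in V, c (c v) = c v, v != c v -> E v (c v) &
     #|[set u | c u == c v]| = 3]).

Definition star_rel V c : rel T :=
  [rel u v | [&& u \in V, v \in V, u != v & (c u == v) || (c v == u)]].

Lemma card3E (S : {set T}) r : #|S| = 3 -> r \in S ->
  exists a b, [/\ a != r, b != r, a != b & S = [set a; r; b]].
Proof.
move=> S3 rS; have : #|S :\ r| = 2 by move: (cardsD1 r S); rewrite rS S3 => -[].
move/eqP/cards2P => [a [b [ab Sr]]]; exists a, b.
have aS : a \in S :\ r by rewrite Sr !inE eqxx.
have bS : b \in S :\ r by rewrite Sr !inE eqxx orbT.
move: aS bS; rewrite !inE => /andP[ar aS] /andP[br bS].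
by split=> //; rewrite -(setD1K rS) Sr [r |: _]setUCA setUA.
Qed.

Lemma star_fun_in V E c v : star_fun V E c -> (c v \in V) = (v \in V).
Proof.
by case=> c0 cP; case: (boolP (v \in V)) => vV; [case: (cP v vV)|rewrite c0 // (negPf vV)].
Qed.

Lemma star_fun_idem V E c v : star_fun V E c -> c (c v) = c v.
Proof.
by case=> c0 cP; case: (boolP (v \in V)) => vV; [case: (cP v vV)|rewrite !c0].
Qed.

Lemma star_fibre V E c x : star_fun V E c -> x \in V ->
  exists a b, [/\ a != c x, b != c x, a != b &
    forall u, (c u == c x) = (u \in [:: a; c x; b])].
Proof.
move=> sc xV; case: (sc.2 x xV) => rV rr _ f3.
have [|a [b [ar br ab fE]]] := card3E f3 (r := c x); first by rewrite inE rr.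
exists a, b; split=> // u.
by move/setP: fE => /(_ u); rewrite !inE orbA.
Qed.

Lemma star_lfactor V E c : symmetric E -> star_fun V E c ->
  is_lfactor V E (star_rel V c).
Proof.
move=> symE sc; split.
- by move=> u v; rewrite /star_rel /= andbCA [u == v]eq_sym [(c u == v) || _]orbC.
- move=> u v; rewrite /star_rel /= => /and4P[uV vV uv] /orP[]/eqP cE; rewrite uV vV /=.
    by case: (sc.2 u uV) => _ _; rewrite cE => /(_ uv).
  by case: (sc.2 v vV) => _ _; rewrite cE eq_sym symE => /(_ uv).
move=> x xV; have [a [b [ar br ab fP]]] := star_fibre sc xV.
have cr : c (c x) = c x := star_fun_idem x sc.
have rV : c x \in V by rewrite (star_fun_in _ sc).
have ca : c a = c x by apply/eqP; rewrite fP !inE eqxx.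
have cb : c b = c x by apply/eqP; rewrite fP !inE eqxx !orbT.
have aV : a \in V by rewrite -(star_fun_in _ sc) ca.
have bV : b \in V by rewrite -(star_fun_in _ sc) cb.
exists a, (c x), b; split.
- by rewrite /= !inE negb_or ar ab eq_sym br.
- by rewrite -fP.
- by rewrite /star_rel /= aV rV ar ca eqxx.
- by rewrite /star_rel /= bV rV eq_sym br cb eqxx orbT.
move=> u v; rewrite -fP => /eqP cu; rewrite /star_rel /= cu => /and4P[uV vV uv] /orP[]/eqP vE.
  have : u \in [:: a; c x; b] by rewrite -fP cu.
  rewrite -vE !inE -[u == c x](negbK) vE uv /= => /orP[]/eqP->.
    by rewrite eqxx.
  by rewrite [[set b; v]]setUC eqxx orbT.
have ur : u = c x by rewrite -cu -vE (star_fun_idem _ sc).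
have : v \in [:: a; c x; b] by rewrite -fP vE ur.
rewrite ur !inE [v == c x]eq_sym -ur (negPf uv) /= => /orP[]/eqP->.
  by rewrite [[set u; a]]setUC eqxx.
by rewrite eqxx orbT.
Qed.

Lemma lfactor_star V E F : is_lfactor V E F -> exists c, star_fun V E c.
Proof.
move=> [symF FE comp].
have nbr x : x \in V -> exists a b d, [/\ uniq [:: a; b; d], x \in [:: a; b; d] &
   [/\ forall v, F a v = (v == b), forall v, F d v = (v == b) &
   forall v, F b v = (v == a) || (v == d)]].
  case/comp=> a [b [d [/= abd xabd ab bd cl]]]; exists a, b, d; split=> //.
  move: abd; rewrite !inE negb_or !andbT => /andP[/andP[neab nead] nebd].
  have key u v : u \in [:: a; b; d] -> F u v ->
     ((u == a) && (v == b)) || ((u == b) && (v == a)) || ((u == b) && (v == d))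
     || ((u == d) && (v == b)).
    move=> uu Fuv; move: (cl u v uu Fuv); rewrite !inE => /orP[] /eqP/setP uv.
      move: (uv a) (uv b) (uv u) (uv v) uu; rewrite !inE !eqxx ?orbT /=.
      by do ![case: eqVneq => //= ?; subst; rewrite ?eqxx ?orbT //=].
    move: (uv d) (uv b) (uv u) (uv v) uu; rewrite !inE !eqxx ?orbT /=.
    by do ![case: eqVneq => //= ?; subst; rewrite ?eqxx ?orbT //=].
  split=> v; apply/idP/idP.
  - by move/key; rewrite !inE eqxx (negPf neab) (negPf nead) /= !orbF; apply.
  - by move/eqP->.
  - by move/key; rewrite !inE eqxx eq_sym (negPf nead) eq_sym (negPf nebd) !orbT /=; apply.
  - by move/eqP->; rewrite symF.
  - move/key; rewrite !inE eqxx eq_sym (negPf neab) (negPf nebd) !orbF /=; exact.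
  - by move=> /orP[]/eqP-> //; rewrite symF.
(* The centre of a path is recognised by its degree 2 in [F], the ends having degree 1; so the
   choice made by [pick] is forced. *)
pose isc x b := [&& b \in V, (x == b) || F x b & #|[set v | F b v]| == 2].
pose c x := if x \in V then odflt x [pick b | isc x b] else x.
have nbr' x : x \in V -> exists a b d, [/\ uniq [:: a; b; d], x \in [:: a; b; d],
   [/\ forall v, F a v = (v == b), forall v, F d v = (v == b) &
   forall v, F b v = (v == a) || (v == d)], b \in V & forall u, u \in V -> (c u == b) = (u \in [:: a; b; d])].
  move=> xV; have [a [b [d [u3 xabd [Fa Fd Fb]]]]] := nbr x xV.
  have bV : b \in V by have := Fa b; rewrite eqxx => /FE /and3P[].
  exists a, b, d; split=> // u uV.
  move: u3; rewrite /= !inE negb_or !andbT => /andP[/andP[neab nead] nebd].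
  have b2 : #|[set v | F b v]| == 2.
    by rewrite (_ : [set v | F b v] = [set a; d]) ?cards2 ?nead //; apply/setP=> v; rewrite !inE Fb.
  rewrite /c uV; case: pickP => [b' /and3P[b'V ub' b'2]|none] /=.
    apply/eqP/idP.
      move=> bE; move: ub'; rewrite bE symF Fb.
      by do 3![case: (u == _) => //=].
    move=> uabd; have : b' \in [:: a; b; d].
      move: ub' => /orP[/eqP ub'|]; first by rewrite !inE -ub'.
      move: uabd; rewrite !inE => /or3P[]/eqP->; rewrite ?Fa ?Fb ?Fd => Fb'; rewrite ?Fb' ?orbT //.
      by case/orP: Fb' => ->; rewrite ?orbT.
    have one z : (forall v, F z v = (v == b)) -> #|[set v | F z v]| == 2 -> False.
      by move=> Fz; rewrite (_ : [set v | F z v] = [set b]) ?cards1 //; apply/setP=> v; rewrite !inE Fz.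
    rewrite !inE => /or3P[]/eqP bE //; rewrite bE in b'2; first by case: (one a Fa b'2).
    by case: (one d Fd b'2).
  apply/eqP/idP => [->|uabd]; first by rewrite eqxx orbT.
  have := none b; rewrite /isc bV b2 andbT /=.
  by case/or3P: uabd => /eqP->; rewrite ?Fa ?Fd eqxx ?orbT.
exists c; split=> [v /negPf vV|x xV]; first by rewrite /c vV.
have [a [b [d [u3 xabd [Fa Fd Fb] bV cP]]]] := nbr' x xV.
have cx : c x = b by apply/eqP; rewrite cP.
have cb : c b = b by apply/eqP; rewrite cP // !inE eqxx orbT.
have inV u : u \in [:: a; b; d] -> u \in V.
  have aV : a \in V by have := Fa b; rewrite eqxx => /FE /and3P[].
  have dV : d \in V by have := Fd b; rewrite eqxx => /FE /and3P[].
  by rewrite !inE => /or3P[]/eqP->.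
rewrite cx cb; split=> //.
  move: xabd; rewrite !inE => /or3P[]/eqP->; rewrite ?eqxx // => _.
    by have := Fa b; rewrite eqxx => /FE /and3P[].
  by have := Fd b; rewrite eqxx => /FE /and3P[].
rewrite (_ : [set u | c u == b] = [set u in [:: a; b; d]]).
  by rewrite cardsE; move/card_uniqP: u3 => ->.
apply/setP=> u; rewrite !inE; case: (boolP (u \in V)) => uV; first by rewrite cP // !inE.
have := contra (inV u) uV; rewrite !inE => /negPf->.
by rewrite /c (negPf uV); apply: contraNF uV => /eqP->.
Qed.

Lemma has_starP V E : symmetric E -> has_lfactor V E <-> exists c, star_fun V E c.
Proof.
move=> symE; split=> [[F /lfactor_star]//|[c cP]].
by exists (star_rel V c); apply: star_lfactor.
Qed.
End StarFun.

Section StarOps.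
Variable T : finType.
Implicit Types (V W : {set T}) (E F : rel T) (c : T -> T).

Lemma lfactor_mono V E E' :
  (forall u v, u \in V -> v \in V -> E u v -> E' u v) ->
  has_lfactor V E -> has_lfactor V E'.
Proof.
move=> EE' [F [symF FE comp]]; exists F; split=> // u v /FE /and3P[uV vV uv].
by rewrite uV vV EE'.
Qed.

Lemma lfactor_eq V V' E : V = V' -> has_lfactor V E -> has_lfactor V' E.
Proof. by move=> ->. Qed.

(** Each map is the identity off its own set and preserves that set, so composing the two acts as
    the right one on either side. *)
Lemma star_union V1 V2 E c1 c2 : [disjoint V1 & V2] ->
  star_fun V1 E c1 -> star_fun V2 E c2 -> star_fun (V1 :|: V2) E (c1 \o c2).
Proof.
move=> dis s1 s2; split=> [v|v]; rewrite !inE ?negb_or /=.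
  by case/andP=> v1 v2; rewrite s2.1 // s1.1.
have off1 u : u \in V2 -> u \notin V1 by move=> uV2; rewrite (disjointFl dis).
have off2 u : u \in V1 -> u \notin V2 by move=> uV1; rewrite (disjointFr dis).
case/orP=> vV.
  have c2v : c2 v = v by rewrite s2.1 // off2.
  have cV : c1 v \in V1 by rewrite (star_fun_in _ s1).
  rewrite c2v cV /=; case: (s1.2 v vV) => _ i1 e1 f1; split=> //.
    by rewrite (s2.1 (c1 v)) ?off2.
  rewrite -f1; congr #|pred_of_set _|; apply/setP=> u; rewrite !inE.
  case: (boolP (u \in V2)) => uV2; last by rewrite s2.1.
  have c2V : c2 u \in V2 by rewrite (star_fun_in _ s2).
  rewrite (s1.1 (c2 u)) ?off1 // (s1.1 u) ?off1 //.
  by apply/eqP/eqP => uE; move: cV; rewrite -uE => /off2; rewrite ?c2V ?uV2.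
have cV : c2 v \in V2 by rewrite (star_fun_in _ s2).
have c1v : c1 (c2 v) = c2 v by rewrite s1.1 // off1.
rewrite c1v cV orbT; case: (s2.2 v vV) => _ i1 e1 f1; split=> //; first by rewrite i1.
rewrite -f1; congr #|pred_of_set _|; apply/setP=> u; rewrite !inE.
case: (boolP (u \in V1)) => uV1.
  rewrite (s2.1 u) ?off2 //.
  have cV1 : c1 u \in V1 by rewrite (star_fun_in _ s1).
  by apply/eqP/eqP => uE; move: cV; rewrite -uE => /off1; rewrite ?cV1 ?uV1.
suff c2u : c2 u \notin V1 by rewrite (s1.1 (c2 u)).
case: (boolP (u \in V2)) => uV2; last by rewrite s2.1.
by apply: off1; rewrite (star_fun_in _ s2).
Qed.

Lemma star_triple E a b d : a != b -> d != b -> a != d -> E a b -> E d b ->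
  star_fun [set a; b; d] E (fun v => if v \in [set a; b; d] then b else v).
Proof.
move=> ab db ad Eab Edb; split=> v; first by move/negPf->.
move=> vV; rewrite vV !inE !eqxx orbT /=; split=> //.
  by move: vV; rewrite !inE => /orP[/orP[]|]/eqP->; rewrite ?eqxx.
rewrite (_ : [set u | _] = [set a; b; d]).
  by rewrite setUC cardsU1 cards2 !inE negb_or [d == a]eq_sym ad db ab.
apply/setP=> u; rewrite !inE; case: ifP => [_|/negbT]; first by rewrite eqxx.
by rewrite !negb_or => /andP[/andP[_ /negPf->]].
Qed.

(** Stated for a map that behaves like a factor on [W] only: it is applied to single pieces of a
    graph while [c] may carry artificial centres elsewhere. *)
Lemma star_closed W E c : (forall u, (c u \in W) = (u \in W)) ->
  (forall u, u \in W -> [/\ c (c u) = c u, u != c u -> E u (c u) &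
     #|[set w | c w == c u]| = 3]) ->
  star_fun W E (fun v => if v \in W then c v else v).
Proof.
move=> cW cP; split=> v; first by move/negPf->.
move=> vW; rewrite vW !cW vW; case: (cP v vW) => i e f; split=> //.
rewrite -f; congr #|pred_of_set _|; apply/setP=> u; rewrite !inE.
case: ifP => // uW; apply/eqP/eqP => uE; first by rewrite uE cW vW in uW.
by rewrite -cW uE cW vW in uW.
Qed.

Lemma star_sub V W E c : star_fun V E c -> W \subset V ->
  (forall v, v \in V -> (c v \in W) = (v \in W)) ->
  star_fun W E (fun v => if v \in W then c v else v).
Proof.
move=> sc /subsetP WV cW; apply: star_closed => u.
  by case: (boolP (u \in V)) => uV; [exact: cW|rewrite sc.1].
by move/WV => uV; case: (sc.2 u uV).
Qed.

Lemma has_triple E a b d : symmetric E -> a != b -> d != b -> a != d -> E a b -> E b d ->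
  has_lfactor [set a; b; d] E.
Proof.
move=> symE ab db ad Eab Ebd; apply/has_starP => //.
by eexists; apply: star_triple; rewrite // symE.
Qed.

Lemma has_union V1 V2 E : symmetric E -> [disjoint V1 & V2] ->
  has_lfactor V1 E -> has_lfactor V2 E -> has_lfactor (V1 :|: V2) E.
Proof.
move=> symE dis /has_starP[]// c1 s1 /has_starP[]// c2 s2.
by apply/has_starP => //; exists (c1 \o c2); apply: star_union.
Qed.

(* [s] cannot be a centre, so it is an end of a path centred at [x]. *)
Lemma has_pendant V E s x : symmetric E -> has_lfactor V E -> s \in V ->
  (forall v, v \in V -> E s v -> v = x) ->
  exists w, x \in V /\ [/\ w \in V, w != s, w != x, E x w &
    has_lfactor (V :\: [set s; x; w]) E].
Proof.
move=> symE /has_starP[]// c sc sV only.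
have [csV cs ecs fs] := sc.2 s sV.
have [a [b [ar br ab fP]]] := star_fibre sc sV.
have inV u : c u = c s -> u \in V by move=> cu; rewrite -(star_fun_in _ sc) cu.
have ca : c a = c s by apply/eqP; rewrite fP !inE eqxx.
have cb : c b = c s by apply/eqP; rewrite fP !inE eqxx !orbT.
have Ea u : c u = c s -> u != c s -> E u (c s).
  by move=> cu uc; case: (sc.2 u (inV u cu)) => _ _; rewrite cu => /(_ uc).
have cx : c s = x.
  case: (eqVneq s (c s)) => [sE|ne]; last by apply: only => //; apply: ecs.
  have ax : a = x by apply: only; [exact: inV|rewrite symE sE; apply: Ea].
  have bx : b = x by apply: only; [exact: inV|rewrite symE sE; apply: Ea].
  by rewrite ax bx eqxx in ab.
have sx : s != x.
  apply/eqP => sE; have : a = x by apply: only; [exact: inV|rewrite symE {1}sE -cx; apply: Ea].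
  by move=> aE; rewrite aE cx eqxx in ar.
have [w [wV ws wx Ew wP]] : exists w, [/\ w \in V, w != s, w != x, E x w &
    forall u, (c u == x) = (u \in [:: s; x; w])].
  move: (fP s); rewrite eqxx cx !inE (negPf sx) /= => /esym/orP[]/eqP sE.
    exists b; split; rewrite ?inV // ?[E x b]symE -?cx ?Ea //.
    - by rewrite sE eq_sym.
    - by move=> u; rewrite fP -sE.
  exists a; split; rewrite ?inV // ?[E x a]symE -?cx ?Ea //.
  - by rewrite sE.
  - by move=> u; rewrite fP sE !inE; do 3![case: (u == _)].
exists w; split; first by rewrite -cx.
split=> //; apply/has_starP => //; eexists.
apply: (star_sub sc); first by rewrite subsetDl.
have cxx : c x = x by rewrite -cx.
move=> v vV; rewrite !inE (star_fun_in _ sc) vV !andbT; congr (~~ _).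
have : (c v \in [:: s; x; w]) = (v \in [:: s; x; w]) by rewrite -!wP (star_fun_idem _ sc).
by rewrite !inE !orbA.
Qed.
End StarOps.

(** * Transport of factors along injections *)

Section StarTransport.
Variables (A B : finType) (f : A -> B) (E : rel A) (E' : rel B) (V : {set A}).
Hypothesis f_inj : injective f.

(** Adjacency is transported from the image back to [V] only, so the image may have fewer edges than
    [V]. *)
Lemma star_pull c : (forall u v, u \in V -> v \in V -> E' (f u) (f v) -> E u v) ->
  star_fun (f @: V) E' c ->
  exists c', star_fun V E c' /\ forall u, u \in V -> f (c' u) = c (f u).
Proof.
move=> EE sc; pose c' u := if [pick w | f w == c (f u)] is Some w then w else u.
have fc' u : u \in V -> f (c' u) = c (f u).
  move=> uV; rewrite /c'; case: pickP => [w /eqP//|none].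
  have : c (f u) \in f @: V by rewrite (star_fun_in _ sc) imset_f.
  by case/imsetP=> w _ wE; move: (none w); rewrite wE eqxx.
have c'V u : u \in V -> c' u \in V.
  by move=> uV; rewrite -(mem_imset _ _ f_inj) fc' // (star_fun_in _ sc) mem_imset.
have off u : u \notin V -> c' u = u.
  move=> uV; rewrite /c'; case: pickP => // w; rewrite sc.1 ?mem_imset //.
  by rewrite inj_eq // => /eqP.
exists c'; split=> //; split=> // u uV.
case: (sc.2 (f u) (imset_f f uV)) => _ i e f3; split; first exact: c'V.
- by apply: f_inj; rewrite fc' ?c'V // fc'.
- by move=> uc; apply: EE; rewrite ?c'V // fc' // e // -fc' // inj_eq.
rewrite -f3 -(card_imset _ f_inj); congr #|pred_of_set _|; apply/setP=> y; rewrite !inE.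
apply/imsetP/eqP => [[w] | yE].
  rewrite inE => /eqP wE ->; case: (boolP (w \in V)) => wV; first by rewrite -!fc' ?wE.
  by rewrite off // in wE; case/negP: wV; rewrite wE c'V.
have : y \in f @: V by rewrite -(star_fun_in _ sc) yE (star_fun_in _ sc) imset_f.
by case/imsetP=> w wV wE; exists w => //; rewrite inE -(inj_eq f_inj) !fc' // -wE yE.
Qed.

Lemma star_push c : (forall u v, u \in V -> v \in V -> E u v -> E' (f u) (f v)) ->
  star_fun V E c ->
  exists c', star_fun (f @: V) E' c' /\ forall u, c' (f u) = f (c u).
Proof.
move=> EE sc; pose c' y := if [pick w | f w == y] is Some w then f (c w) else y.
have c'f u : c' (f u) = f (c u).
  rewrite /c'; case: pickP => [w|/(_ u)]; last by rewrite eqxx.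
  by rewrite inj_eq // => /eqP->.
exists c'; split=> //; split=> [y yV|_ /imsetP[v vV ->]].
  rewrite /c'; case: pickP => // w /eqP wE; move: yV; rewrite -wE mem_imset // => wV.
  by rewrite sc.1.
case: (sc.2 v vV) => cV i e f3; rewrite !c'f i; split=> //.
- by rewrite mem_imset.
- by rewrite inj_eq // => vc; apply: EE; rewrite ?e.
rewrite -f3 -(card_imset _ f_inj); congr #|pred_of_set _|; apply/setP=> y; rewrite !inE.
apply/eqP/imsetP => [|[w]]; last first.
  by rewrite inE => /eqP wE ->; rewrite c'f wE.
rewrite /c'; case: pickP => [w /eqP <- cw|none yE].
  by exists w => //; rewrite inE -(inj_eq f_inj) cw.
by move: (none (c v)); rewrite yE eqxx.
Qed.

Lemma has_pull : symmetric E -> symmetric E' ->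
  (forall u v, u \in V -> v \in V -> E' (f u) (f v) -> E u v) ->
  has_lfactor (f @: V) E' -> has_lfactor V E.
Proof.
move=> s s' EE /has_starP[]// c /star_pull[]// c' [sc' _].
by apply/has_starP => //; exists c'.
Qed.
End StarTransport.

(** * Subdividing two edges and joining the new vertices *)

Lemma connect_homo (A B : finType) (r : rel A) (r' : rel B) (f : A -> B) :
  (forall x y, r x y -> connect r' (f x) (f y)) ->
  forall x y, connect r x y -> connect r' (f x) (f y).
Proof.
move=> h x y /connectP[p]; elim: p x => [x _ ->|z p IH x /= /andP[xz zp] yE].
  exact: connect0.
exact: connect_trans (h _ _ xz) (IH z zp yE).
Qed.

(** * Connectivity after the deletion of edges *)

Section Conn.
Variable T : finType.
Implicit Types (e : rel T) (S V : {set T}) (D : {set {set T}}).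

Definition on_rel V e : rel T := [rel a b | [&& a \in V, b \in V & e a b]].

Lemma on_rel_sym V e : symmetric e -> symmetric (on_rel V e).
Proof. by move=> s x y; rewrite /on_rel /= s andbCA. Qed.

Lemma on_rel_connect_sym V e : symmetric e -> connect_sym (on_rel V e).
Proof. by move=> s; apply/sym_connect_sym/on_rel_sym. Qed.

Definition kconn k e : Prop := forall S, #|S| < k -> connected_on (~: S) e.

Lemma kconnW k e : kconn k.+1 e -> kconn k e.
Proof. by move=> h S Sk; apply: h; apply: ltnW. Qed.

Lemma edge_setP e (R : {set T}) :
  reflect (exists x y, e x y /\ R = [set x; y]) (R \in edge_set e).
Proof.
rewrite inE; apply: (iffP existsP) => [[x /existsP[y /andP[exy /eqP->]]]|[x [y [exy ->]]]].
  by exists x, y.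
by exists x; apply/existsP; exists y; rewrite exy eqxx.
Qed.

Lemma edge_set2 e x y : symmetric e -> ([set x; y] \in edge_set e) = e x y.
Proof.
move=> symE; apply/edge_setP/idP => [[x' [y' [exy /setP xyE]]]|exy]; last by exists x, y.
move: (xyE x) (xyE y) (xyE x') (xyE y') exy; rewrite !inE !eqxx ?orbT /=.
by do ![case: eqVneq => //= ?; subst; rewrite ?eqxx ?orbT //=]; rewrite symE.
Qed.

Lemma set2_eq (x y a b : T) : ([set x; y] == [set a; b]) =
  ((x == a) && (y == b)) || ((x == b) && (y == a)).
Proof.
apply/eqP/orP => [/setP xyE|[]/andP[/eqP-> /eqP->]//]; last by rewrite setUC.
move: (xyE x) (xyE y) (xyE a) (xyE b); rewrite !inE !eqxx ?orbT /=.
by do ![case: eqVneq => //= ?; subst; rewrite ?eqxx ?orbT //=]; auto.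
Qed.

Lemma del_edges_sym e D : symmetric e -> symmetric (del_edges e D).
Proof. by move=> s x y; rewrite /del_edges s setUC. Qed.

(** Deleting one end of the edge removes the edge too. If [S] avoids both ends, the vertices other
    than [a] are joined after deleting [a] as well, and [a] is joined to a third vertex after
    deleting [b] as well. The bound on [#|T|] provides the third vertex. *)
Lemma kconn_del k e a b : symmetric e -> a != b -> k.+1 < #|T| -> kconn k.+1 e ->
  kconn k (del_edges e [set [set a; b]]).
Proof.
move=> symE ab kT conn S Sk.
set e' := del_edges _ _.
have symE' : symmetric e' by apply: del_edges_sym.
have mono (W : {set T}) : W \subset ~: S -> (a \notin W) || (b \notin W) -> connected_on W e ->
    forall u v, u \in W -> v \in W -> connect (on_rel (~: S) e') u v.
  move=> /subsetP WS abW cW u v uW vW; move: (cW u v uW vW); apply: (connect_homo (f := id)).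
  move=> x y /and3P[xW yW exy]; apply: connect1.
  rewrite /on_rel /= !WS //= /e' /del_edges exy inE set2_eq /=.
  by apply: contraL abW => /orP[]/andP[/eqP<- /eqP<-]; rewrite negb_or !negbK xW yW.
case: (boolP ((a \in S) || (b \in S))) => abS.
  move=> u v; apply: (mono (~: S)) => //; last by apply: kconnW Sk.
  by rewrite !inE !negbK.
move: abS; rewrite negb_or => /andP[aS bS].
have card1 x : #|x |: S| < k.+1 by move: Sk; rewrite cardsU1; case: (_ \notin _); lia.
have out u v : u \in ~: (a |: S) -> v \in ~: (a |: S) -> connect (on_rel (~: S) e') u v.
  apply: mono; first by rewrite setCS subsetUr.
    by rewrite !inE eqxx.
  exact: conn.
have [w wS aw] : exists2 w, w \in ~: (a |: S) & connect (on_rel (~: S) e') a w.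
  have /subsetPn[t _] : ~~ (setT \subset a |: (b |: S)).
    apply: contraL kT => /subset_leq_card; rewrite cardsT -leqNgt.
    by move: Sk; rewrite !cardsU1; do 2!case: (_ \notin _); lia.
  rewrite !inE !negb_or => /and3P[ta tb tS].
  exists t; first by rewrite !inE negb_or ta.
  apply: (mono (~: (b |: S))); first by rewrite setCS subsetUr.
  - by rewrite !inE eqxx orbT.
  - exact: conn.
  - by rewrite !inE negb_or ab.
  - by rewrite !inE negb_or tb.
have symc := on_rel_connect_sym (~: S) symE'.
have toa u : u \notin S -> connect (on_rel (~: S) e') a u.
  move=> uS; have [->|ua] := eqVneq u a; first exact: connect0.
  by apply: connect_trans aw _; apply: out => //; rewrite !inE negb_or ua.
move=> u v; rewrite !inE => uS vS; apply: connect_trans (toa v vS).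
by rewrite symc; apply: toa.
Qed.
End Conn.

Section Ext.
Variables (T : finType) (e : rel T) (R : bool -> {set T}).
Hypotheses (symE : symmetric e) (irrE : irreflexive e).
Hypotheses (Redge : forall s, R s \in edge_set e) (Rneq : R false != R true).

Definition ext : rel (T + bool) := fun x y =>
  match x, y with
  | inl x, inl y => del_edges e [set R false; R true] x y
  | inl x, inr s => x \in R s
  | inr s, inl x => x \in R s
  | inr s, inr t => s != t
  end.

Lemma ext_sym : symmetric ext.
Proof.
move=> [x|s] [y|t] //=; first by rewrite del_edges_sym.
by rewrite eq_sym.
Qed.

Lemma ext_irr : irreflexive ext.
Proof. by move=> [x|s] /=; [rewrite /del_edges irrE|rewrite eqxx]. Qed.

Lemma card_sum_set (A B : finType) (p : pred (A + B)) :
  #|[set z | p z]| = #|[set x | p (inl x)]| + #|[set y | p (inr y)]|.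
Proof. by rewrite -!sum1dep_card big_sumType. Qed.

(** The balance behind [ext_cubic]: an end of [R s] loses exactly one old edge and gains exactly the
    edge to [inr s]. *)
Lemma edge_neigh x s : #|[set y | e x y && ([set x; y] == R s)]| = (x \in R s).
Proof.
have /edge_setP[a [b [eab ->]]] := Redge s.
have ab : a != b by apply: contraTneq eab => ->; rewrite irrE.
rewrite !inE; have [->|xa] /= := eqVneq x a.
  rewrite (_ : [set y | _] = [set b]) ?cards1 //; apply/setP=> y; rewrite !inE set2_eq eqxx.
  by rewrite (negPf ab) /= orbF; case: eqVneq => [->|]; rewrite ?andbF // eab.
have [->|xb] /= := eqVneq x b.
  rewrite (_ : [set y | _] = [set a]) ?cards1 //; apply/setP=> y; rewrite !inE set2_eq eqxx.
  by rewrite eq_sym (negPf ab) /=; case: eqVneq => [->|]; rewrite ?andbF // symE eab.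
rewrite (_ : [set y | _] = set0) ?cards0 //; apply/setP=> y; rewrite !inE set2_eq.
by rewrite (negPf xa) (negPf xb) andbF.
Qed.

Lemma ext_cubic : cubic e -> cubic ext.
Proof.
move=> cub [x|s]; rewrite card_sum_set /=.
  have -> : #|[set s | x \in R s]| = (x \in R false) + (x \in R true).
    rewrite -sum1dep_card big_mkcond /= big_bool /= addnC.
    by do 2!case: (x \in _).
  rewrite -(cub x) -!edge_neigh.
  set N := [set y | e x y]; set A := [set y | _]; set B := [set y | _]; set C := [set y | _].
  have -> : N = A :|: (B :|: C).
    apply/setP=> y; rewrite !inE /del_edges !inE; case: (e x y) => //=.
    by do 2!case: (_ == _).
  have BC : [disjoint B & C].
    rewrite -setI_eq0; apply/eqP/setP=> y; rewrite !inE; apply/negP.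
    by case/andP=> /andP[_ /eqP xy1] /andP[_ /eqP xy2]; move: Rneq; rewrite -xy1 -xy2 eqxx.
  have ABC : [disjoint A & B :|: C].
    rewrite -setI_eq0; apply/eqP/setP=> y; rewrite !inE /del_edges !inE.
    by case: (e x y) => //=; do 2!case: (_ == _).
  by rewrite !cardsU !(disjoint_setI0 _) // !cards0 !subn0.
rewrite (_ : [set x | x \in R s] = R s); last by apply/setP=> x; rewrite inE.
have /edge_setP[a [b [eab ->]]] := Redge s.
have ab : a != b by apply: contraTneq eab => ->; rewrite irrE.
rewrite cards2 ab (_ : [set t | s != t] = [set ~~ s]) ?cards1 //.
by apply/setP=> t; rewrite !inE; case: s t => [] [].
Qed.

(** For the old vertices, deleting the new vertex [s] amounts to deleting the edge [R s], while a
    surviving [s] offers a detour along it. Each deleted edge costs one unit of connectivity. *)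
Lemma kconn_del_ext (D : {set bool}) : 3 < #|T| -> kconn 3 e ->
  kconn (3 - #|D|) (del_edges e [set R s | s in D]).
Proof.
move=> T3 conn.
have nloop s a b : R s = [set a; b] -> a != b.
  move=> Rs; have := Redge s; rewrite Rs edge_set2 //.
  by apply: contraTneq => ->; rewrite irrE.
have del1 s : kconn 2 (del_edges e [set R s]).
  have /edge_setP[a [b [eab Rs]]] := Redge s.
  by rewrite Rs; apply: kconn_del => //; apply: nloop Rs.
have delE (D1 D2 : {set {set T}}) k : D1 = D2 -> kconn k (del_edges e D1) -> kconn k (del_edges e D2).
  by move=> ->.
have del0 : kconn 3 (del_edges e set0).
  move=> S S3 u v uS vS; move: (conn S S3 u v uS vS); apply: (connect_homo (f := id)) => x y.
  by move=> /and3P[xS yS exy]; apply: connect1; rewrite /= xS yS /del_edges exy inE.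
have del2 : kconn 1 (del_edges e [set R false; R true]).
  have /edge_setP[a [b [eab Rs]]] := Redge true.
  move=> S S1 u v uS vS.
  have k1 := kconn_del (del_edges_sym [set R false] symE) (nloop _ _ _ Rs) (ltnW T3) (del1 false).
  move: (k1 S S1 u v uS vS); apply: (connect_homo (f := id)) => x y.
  move=> /and3P[xS yS /andP[/andP[exy n1] n2]]; apply: connect1.
  by rewrite /= xS yS /del_edges exy !inE negb_or Rs; rewrite !inE in n1 n2; rewrite n1 n2.
have imE : [set R s | s in D] = [set A | ((false \in D) && (A == R false)) || ((true \in D) && (A == R true))].
  apply/setP=> A; rewrite inE; apply/imsetP/orP => [[[] sD ->]|]; rewrite ?sD ?eqxx; auto.
  by case=> /andP[sD /eqP->]; eexists; eauto.
have cD : #|D| = (false \in D) + (true \in D).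
  by rewrite -sum1_card big_mkcond /= big_bool /= addnC; do 2!case: (_ \in D).
rewrite cD imE; case: (false \in D); case: (true \in D) => /=.
- by apply: delE del2; apply/setP=> A; rewrite !inE.
- by apply: delE (del1 false); apply/setP=> A; rewrite !inE orbF.
- by apply: delE (del1 true); apply/setP=> A; rewrite !inE.
- by apply: delE del0; apply/setP=> A; rewrite !inE.
Qed.

Lemma ext_3conn : three_connected e -> three_connected ext.
Proof.
move=> [T3 conn]; split; first by rewrite card_sum card_bool; lia.
move=> S S3.
pose S0 := [set x | inl x \in S]; pose D := [set s | inr s \in S].
have SE : #|S| = #|S0| + #|D|.
  by rewrite -card_sum_set; apply: eq_card => z; rewrite !inE.
have symc := on_rel_connect_sym (~: S) ext_sym.
have liv u v : u \notin S0 -> v \notin S0 -> connect (on_rel (~: S) ext) (inl u) (inl v).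
  move=> uS vS.
  have S0D : #|S0| < 3 - #|D| by lia.
  have : connect (on_rel (~: S0) (del_edges e [set R s | s in D])) u v.
    by apply: kconn_del_ext => //; rewrite inE.
  apply: (connect_homo (f := inl)) => x y; rewrite /on_rel /= !inE => /and3P[xS yS].
  rewrite /del_edges => /andP[exy nD].
  case: (boolP ([set x; y] \in [set R false; R true])) => xyR; last first.
    by apply: connect1; rewrite /on_rel /= !inE xS yS /del_edges exy.
  have [s xyE] : exists s, [set x; y] = R s.
    by move: xyR; rewrite !inE => /orP[]/eqP; [exists false|exists true].
  have sS : inr s \notin S.
    by apply: contra nD => sS; apply/imsetP; exists s; rewrite ?inE.
  apply: (connect_trans (y := inr s)); apply: connect1; rewrite /on_rel /= !inE ?xS ?yS ?sS /=.
    by rewrite -xyE !inE eqxx.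
  by rewrite -xyE !inE eqxx orbT.
have Rcard s : #|R s| = 2.
  have /edge_setP[a [b [eab ->]]] := Redge s.
  by rewrite cards2; case: eqVneq eab => // ->; rewrite irrE.
have hub0 s : ~~ (R s \subset S0) -> inr s \notin S ->
   exists2 x, x \notin S0 & connect (on_rel (~: S) ext) (inr s) (inl x).
  case/subsetPn=> x xR xS sS; exists x => //; apply: connect1.
  by rewrite inE in xS; rewrite /on_rel /= !inE sS xS.
have hub s : inr s \notin S ->
   exists2 x, x \notin S0 & connect (on_rel (~: S) ext) (inr s) (inl x).
  (* If both ends of [R s] are deleted, they are all of [S]. Then the other new vertex survives, and
     it has a surviving end because its edge differs from [R s]. *)
  move=> sS; case: (boolP (R s \subset S0)) => Rs; last exact: hub0.
  have RE : R s = S0 by apply/eqP; rewrite eqEcard Rs Rcard; lia.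
  have D0 : #|D| = 0 by move: SE; rewrite -RE Rcard; lia.
  have tS : inr (~~ s) \notin S.
    by apply/negP => tS; move/eqP: D0; rewrite cards_eq0 => /eqP/setP/(_ (~~ s)); rewrite !inE tS.
  have [|x xS con] := hub0 (~~ s) _ tS.
    apply/negP => Rt; have : R (~~ s) = S0 by apply/eqP; rewrite eqEcard Rt Rcard -RE Rcard.
    by move: Rneq; rewrite -RE; case: (s) => /= /eqP h; [apply/h|move/esym/h].
  exists x => //; apply: connect_trans con; apply: connect1.
  by rewrite /on_rel /= !inE sS tS; case: (s).
have all z : z \notin S -> exists2 x, x \notin S0 & connect (on_rel (~: S) ext) z (inl x).
  by case: z => [x xS|s /hub//]; exists x; rewrite ?inE ?connect0.
move=> u v; rewrite inE => /all[x xS ux]; rewrite inE => /all[y yS vy].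
apply: connect_trans ux _; apply: connect_trans (liv x y xS yS) _.
by rewrite symc.
Qed.

Lemma ext_cubic_3conn : cubic e -> three_connected e -> cubic_3conn ext.
Proof.
by move=> cub conn; split; [exact: ext_sym|exact: ext_irr|exact: ext_cubic|exact: ext_3conn].
Qed.
End Ext.

(** * Neighbours in cubic graphs and the implications obtained by subdivision *)

Lemma cubic_nbr (T : finType) (e : rel T) (x : T) (s : seq T) :
  cubic e -> size s < 3 -> exists y, e x y /\ y \notin s.
Proof.
move=> cub s3; have /subsetPn[y] : ~~ ([set y | e x y] \subset s).
  apply/negP => /subset_leq_card; rewrite cub => h.
  by have := leq_trans h (card_size s); lia.
by rewrite inE; exists y.
Qed.

Lemma cubic_nbrs (T : finType) (e : rel T) (x y : T) : cubic e -> e x y ->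
  exists u w, [/\ e x u, e x w, [&& u != y, w != y & u != w] &
    forall z, e x z = (z \in [:: u; y; w])].
Proof.
move=> cub exy; have [|u [w [uy wy uw E]]] := card3E (cub x) (r := y); first by rewrite inE.
have EP z : e x z = (z \in [:: u; y; w]) by move/setP/(_ z): E; rewrite !inE orbA.
by exists u, w; split; rewrite ?EP ?inE ?eqxx ?orbT // uy wy.
Qed.

Lemma inl_imset (A B : finType) (V : {set A}) v : (inl v \in @inl A B @: V) = (v \in V).
Proof. by rewrite mem_imset //; move=> x y []. Qed.

Lemma inr_imset (A B : finType) (V : {set A}) s : (inr s \in @inl A B @: V) = false.
Proof. by apply/imsetP => -[]. Qed.

Lemma inl_inj (A B : Type) : injective (@inl A B).
Proof. by move=> x y []. Qed.

Definition pairb (T : finType) (P Q : {set T}) (s : bool) := if s then Q else P.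

Lemma ext_pairb (T : finType) (e : rel T) P Q : cubic_3conn e ->
  P \in edge_set e -> Q \in edge_set e -> P != Q -> cubic_3conn (ext e (pairb P Q)).
Proof.
move=> [symE irrE cub conn] Pe Qe PQ; apply: ext_cubic_3conn => //.
by case.
Qed.

Lemma card_ext (T : finType) : #|{: T + bool}| = #|T| + 2.
Proof. by rewrite card_sum card_bool. Qed.

Lemma cubic_irr (T : finType) (e : rel T) x y : irreflexive e -> e x y -> x != y.
Proof. by move=> irr; apply: contraTneq => ->; rewrite irr. Qed.

Lemma mod6D k m r : m %% 6 = r -> (m + k) %% 6 = (r + k) %% 6.
Proof. by move=> <-; rewrite modnDml. Qed.

Lemma t2_z7 : stmt_t2 -> stmt_z7.
Proof.
move=> t2 T e G T6 X Xe /eqP/cards2P[A [B [AB XE]]].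
have [symE _ _ _] := G.
have Ae : A \in edge_set e by apply: (subsetP Xe); rewrite XE !inE eqxx.
have Be : B \in edge_set e by apply: (subsetP Xe); rewrite XE !inE eqxx orbT.
have G' := ext_pairb G Ae Be AB; have [symE' _ _ _] := G'.
have := t2 _ _ G' _ (inr false) (inr true) isT; rewrite card_ext => /(_ (mod6D 2 T6)).
rewrite (_ : ~: _ = inl @: [set: T]); last first.
  by apply/setP=> -[v|s]; rewrite ?inl_imset ?inr_imset !inE //; case: s.
apply: has_pull => //; [exact: inl_inj|exact: del_edges_sym|].
by move=> u v _ _; rewrite XE.
Qed.

(** [A] and an edge xy different from [A] are subdivided. The deleted path runs from x over the new
    vertex on xy to the one on [A], which leaves the old graph without x and [A]; the edge xy
    disappears with x. *)
Lemma z8_f2 : stmt_z8 -> stmt_f2.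
Proof.
move=> z8 T e G T6 x A Ae; have [symE irrE cub _] := G.
have [y [exy xyA]] : exists y, e x y /\ [set x; y] != A.
  have [a [b [eab AE]]] := edge_setP _ _ Ae.
  have [y [exy]] := @cubic_nbr _ e x [:: a; b] cub isT.
  rewrite !inE negb_or => /andP[ya yb]; exists y; split=> //.
  by rewrite AE set2_eq (negPf ya) (negPf yb) !andbF.
have G' : cubic_3conn (ext e (pairb A [set x; y])).
  by apply: ext_pairb; rewrite ?edge_set2 // eq_sym.
have [symE' _ _ _] := G'.
have := z8 _ _ G' _ [:: inl x; inr true; inr false]; rewrite card_ext => /(_ (mod6D 2 T6)).
rewrite /= !inE eqxx => /(_ isT erefl).
rewrite (_ : ~: _ = inl @: (~: [set x])); last first.
  apply/setP=> -[v|s]; rewrite ?inl_imset ?inr_imset !inE; last by case: s.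
  by rewrite (inj_eq (@inl_inj _ _)) orbF.
apply: has_pull => //; [exact: inl_inj|exact: del_edges_sym|].
move=> u v _ _ /andP[euv]; rewrite !inE negb_or /del_edges => /andP[uv _].
by rewrite euv !inE.
Qed.

Lemma mem_path_edges (T : finType) (x y : T) (s : seq T) :
  ((x, y) \in zip s (behead s)) || ((y, x) \in zip s (behead s)) -> [set x; y] \in path_edges s.
Proof.
rewrite inE => /orP[] xy; apply/existsP; first by exists (x, y); rewrite xy eqxx.
by exists (y, x); rewrite xy /= setUC eqxx.
Qed.

(** The edges xy and zz' are subdivided, z' being a neighbour of z other than y. Deleting y, z and
    the new vertex on zz' leaves the new vertex on xy pendant at x, so its path continues over x to
    some w, and w, x, y, z is the required path. *)
Lemma z8_f6 : stmt_z8 -> stmt_f6.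
Proof.
move=> z8 T e G T6 x y z; have [symE irrE cub _] := G.
rewrite /= !inE negb_or !andbT => /andP[/andP[/andP[xy xz] yz] /andP[exy eyz]].
have [z' [ezz]] := @cubic_nbr _ e z [:: y] cub isT; rewrite inE => z'y.
have G' : cubic_3conn (ext e (pairb [set x; y] [set z; z'])).
  apply: ext_pairb; rewrite ?edge_set2 // set2_eq.
  by rewrite (negPf xz) (negPf yz) andbF.
have [symE' irrE' _ _] := G'.
have := z8 _ _ G' _ [:: inl y; inl z; inr true]; rewrite card_ext => /(_ (mod6D 2 T6)).
rewrite /= /del_edges !inE /= eyz !set2_eq !(inj_eq (@inl_inj T bool)) (eq_sym z x) (eq_sym y x).
rewrite (eq_sym z y) (negPf yz) (negPf xz) (negPf xy) !eqxx (eq_sym y z') (negPf z'y).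
rewrite ?andbF /= => /(_ isT erefl).
case/(@has_pendant _ _ _ (inr false) (inl x) symE').
- by rewrite !inE.
- move=> [v|[]]; rewrite !inE //= !inE.
  by rewrite (inj_eq (@inl_inj _ _)) => vy /orP[]/eqP vE; rewrite ?vE //; case/negP: vy; rewrite vE eqxx.
move=> [w|s] [_ []]; rewrite !inE; last by case: s.
rewrite !(inj_eq (@inl_inj _ _)) !negb_or /= => /and3P[wy wz _] _ wx /andP[exw _] fac.
exists [:: w; x; y; z]; split=> //.
- by rewrite /= !inE !negb_or wx wy wz xy xz yz symE exw exy eyz.
- by split; apply: mem_path_edges; rewrite !inE !eqxx ?orbT.
- by right.
move: fac; rewrite (_ : _ :\: _ = inl @: (~: [set w0 in [:: w; x; y; z]])); last first.
  apply/setP=> -[v|s]; rewrite ?inl_imset ?inr_imset !inE /=; last by case: s.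
  rewrite !(inj_eq (@inl_inj _ _)).
  by do 4!case: (v == _).
apply: has_pull => //; first exact: inl_inj.
by move=> u v _ _ /andP[].
Qed.

(** The two edges xu and xw at x other than xy are subdivided. Deleting x and the edge between the
    new vertices makes these pendant at u and w; their paths supply the outer parts of the 5-vertex
    path, which passes x along xu and xw and so avoids xy. *)
Lemma f2_t4 : stmt_f2 -> stmt_t4.
Proof.
move=> f2 T e G T6 x y exy; have [symE irrE cub _] := G.
have [u [w [exu exw /and3P[uy wy uw] nx]]] := cubic_nbrs cub exy.
have G' : cubic_3conn (ext e (pairb [set x; u] [set x; w])).
  apply: ext_pairb; rewrite ?edge_set2 // set2_eq eqxx (negPf uw) /=.
  by rewrite (negPf (cubic_irr irrE exw)).
have [symE' irrE' _ _] := G'.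
have xu := cubic_irr irrE exu; have xw := cubic_irr irrE exw; have xy := cubic_irr irrE exy.
have := f2 _ _ G' _ (inl x) [set inr false; inr true]; rewrite card_ext edge_set2 // => /(_ (mod6D 2 T6) isT).
set E' := del_edges _ _.
have sE' : symmetric E' by apply: del_edges_sym.
case/(@has_pendant _ _ _ (inr false) (inl u) sE').
- by rewrite !inE.
- move=> [v|s]; rewrite !inE /E' /del_edges /= ?inE.
    by move=> vx /andP[/orP[]/eqP vE _]; rewrite ?vE //; case/negP: vx; rewrite vE.
  by case: s; rewrite ?eqxx //= => _.
move=> [w1|s] [_ []]; rewrite !inE /E' /del_edges /=; last first.
  by case: s => //; rewrite !inE (eq_sym u x) (negPf xu) (negPf uw).
rewrite !(inj_eq (@inl_inj _ _)) => w1x _ w1u /andP[/andP[euw1 _] _].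
case/(@has_pendant _ _ _ (inr true) (inl w) sE').
- by rewrite !inE.
- move=> [v|s]; rewrite !inE /E' /del_edges /= ?inE.
    by move=> /andP[_ vx] /andP[/orP[]/eqP vE _]; rewrite ?vE //; case/negP: vx; rewrite vE.
  by case: s; rewrite ?eqxx //= => _.
move=> [w2|s] []; rewrite !inE /E' /del_edges /=; last first.
  by move=> _ []; rewrite !inE; case: s.
rewrite !(inj_eq (@inl_inj _ _)) !negb_or => /andP[/andP[wu ww1] _] [].
move=> /andP[/andP[w2u w2w1] w2x] _ w2w /andP[/andP[eww2 _] _] fac.
exists [:: w1; u; x; w; w2]; split=> //.
- rewrite /= !inE !negb_or w1u w1x (eq_sym w1) ww1 (eq_sym w1) w2w1 (eq_sym u x) xu uw (eq_sym u) w2u.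
  by rewrite xw (eq_sym x) w2x (eq_sym w) w2w symE euw1 symE exu exw eww2.
- rewrite inE; apply/existsPn => -[p q]; rewrite !inE /= !xpair_eqE set2_eq.
  apply/negP => /andP[/or4P[]/andP[/eqP-> /eqP->]].
  + by rewrite (eq_sym x w1) (negPf w1x) (negPf xu).
  + by rewrite (negPf xu) (eq_sym y u) (negPf uy) andbF.
  + by rewrite (eq_sym y w) (negPf wy) (negPf xw) andbF.
  + by rewrite (eq_sym x w2) (negPf w2x) (negPf xw).
move: fac; rewrite (_ : _ :\: _ = inl @: (~: [set w0 in [:: w1; u; x; w; w2]])); last first.
  apply/setP=> -[v|s]; rewrite ?inl_imset ?inr_imset !inE /=; last by case: s.
  rewrite !(inj_eq (@inl_inj _ _)).
  by do 5!case: (v == _).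
apply: has_pull => //; first exact: inl_inj.
by move=> a b _ _ /andP[/andP[]].
Qed.

(** Two rounds of subdivision: first of the edges xu and xw, then of xy and of the edge joining the
    first two new vertices. Deleting x with its two first-round neighbours leaves the new vertex on
    the joining edge pendant at the one on xy, whose only other remaining neighbour is y. Hence y is
    consumed too, and exactly x and y are missing from the old graph. *)
Lemma z8_t2 : stmt_z8 -> stmt_t2.
Proof.
move=> z8 T e G T6 x y exy; have [symE irrE cub _] := G.
have [u [w [exu exw /and3P[uy wy uw] nx]]] := cubic_nbrs cub exy.
have xu := cubic_irr irrE exu; have xw := cubic_irr irrE exw; have xy := cubic_irr irrE exy.
have G1 : cubic_3conn (ext e (pairb [set x; u] [set x; w])).
  by apply: ext_pairb; rewrite ?edge_set2 // set2_eq eqxx (negPf uw) /= (negPf xw).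
have [symE1 irrE1 _ _] := G1.
have G2 : cubic_3conn (ext (ext e (pairb [set x; u] [set x; w]))
    (pairb [set inl x; inl y] [set inr false; inr true])).
  apply: ext_pairb; rewrite ?edge_set2 //; last by rewrite set2_eq.
  rewrite /= /del_edges exy !inE !set2_eq eqxx (eq_sym y u) (negPf uy) (eq_sym y w) (negPf wy).
  by rewrite (negPf xu) (negPf xw) ?andbF.
have [symE2 irrE2 _ _] := G2.
have := z8 _ _ G2 _ [:: inl (inr false); inl (inl x); inl (inr true)]; rewrite !card_ext => /(_ (mod6D 2 (mod6D 2 T6))).
rewrite /= /del_edges !inE /= !set2_eq !inE eqxx ?andbF => /(_ isT erefl).
case/(@has_pendant _ _ _ (inr true) (inr false) symE2).
- by rewrite !inE.
- move=> [[v|s]|s]; rewrite !inE /= ?inE //; last by case: s.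
  by case: s.
move=> [[v|s]|s] [_ []]; rewrite !inE /= ?inE; [|by case: s|by case: s].
rewrite !(inj_eq (@inl_inj _ _)) orbF => vx _ _; rewrite (negPf vx) /= => /eqP vy.
rewrite (_ : _ :\: _ = (inl \o inl) @: (~: [set x; y])); last first.
  have inj2 : injective ((@inl (T + bool)%type bool) \o (@inl T bool)) by move=> a b [].
  apply/setP=> -[[z|s]|s]; rewrite !inE; last 2 first.
  - rewrite (_ : inl (inr s) \in _ = false) //; last by apply/imsetP=> -[].
    by case: s.
  - rewrite (_ : inr s \in _ = false) //; last by apply/imsetP=> -[].
    by case: s.
  rewrite (mem_imset (f := inl \o inl) _ _ inj2) !inE vy.
  by rewrite !(inj_eq (@inl_inj _ _)); do 2!case: (z == _).
apply: has_pull => //; first by move=> a b [].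
by move=> a b _ _ /andP[/andP[]].
Qed.

(** * Replacing vertices of a frame by copies of a graph minus a vertex *)

Section Composite.
Variables (H A : finType) (eH : rel H) (e : rel A) (a : A) (M : {set H}) (pt : H -> H -> A).

(* An unreplaced vertex h is (h, a); the copy of [A - a] at h in [M] consists of the (h, v), v <> a.
   [pt h h'] is the end on the side of h of the edge coming from the edge hh' of the frame. *)
Definition blowup_ok : pred (H * A) := [pred p | (p.2 == a) == (p.1 \notin M)].
Definition blowup : finType := {p : H * A | blowup_ok p}.
Definition co (x : blowup) : H := (val x).1.
Definition ve (x : blowup) : A := (val x).2.
Definition crel : rel blowup := fun x y =>
  ((co x == co y) && e (ve x) (ve y)) ||
  [&& eH (co x) (co y), ve x == pt (co x) (co y) & ve y == pt (co y) (co x)].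

Lemma blowup_inj x y : co x = co y -> ve x = ve y -> x = y.
Proof.
move=> h v; apply: val_inj; move: h v; rewrite /co /ve.
by case: (val x) (val y) => ? ? [? ?] /= -> ->.
Qed.

Lemma card_blowup : #|blowup| = #|~: M| + #|M| * (#|A|.-1).
Proof.
have -> : #|blowup| = \sum_h \sum_(v | blowup_ok (h, v)) 1.
  by rewrite card_sig pair_big_dep /= sum1_card; apply: eq_card => -[h v].
rewrite (eq_bigr (fun h => if h \in M then #|A|.-1 else 1)); last first.
  move=> h _; rewrite sum1dep_card; case: ifP => hM /=.
    rewrite (_ : [set v | _] = ~: [set a]) ?cardsC1 //.
    by apply/setP=> v; rewrite !inE /blowup_ok /= hM; case: (v == a).
  by rewrite (_ : [set v | _] = [set a]) ?cards1 //; apply/setP=> v; rewrite !inE /blowup_ok /= hM; case: (v == a).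
rewrite (bigID (mem M)) /= addnC; congr (_ + _).
  transitivity (\sum_(h in ~: M) 1); last by rewrite sum1_card.
  by apply: eq_big => h; [rewrite !inE|move/negPf->].
by rewrite (eq_bigr (fun=> #|A|.-1)) ?sum_nat_const // => h ->.
Qed.

Hypotheses (GH : cubic_3conn eH) (GA : cubic_3conn e).
Hypothesis ptS : forall h h', h \notin M -> pt h h' = a.
Hypothesis ptM : forall h h', h \in M -> eH h h' -> e a (pt h h').
Hypothesis pt_inj : forall h h1 h2, h \in M -> eH h h1 -> eH h h2 -> pt h h1 = pt h h2 -> h1 = h2.
Variable c0 : blowup.

Let symH : symmetric eH. Proof. by case: GH. Qed.
Let irrH : irreflexive eH. Proof. by case: GH. Qed.
Let symA : symmetric e. Proof. by case: GA. Qed.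
Let irrA : irreflexive e. Proof. by case: GA. Qed.

Definition at_ h v : blowup := insubd c0 (h, v).

Lemma at_val h v : blowup_ok (h, v) -> val (at_ h v) = (h, v).
Proof. exact: insubdK. Qed.

Lemma co_at h v : blowup_ok (h, v) -> co (at_ h v) = h.
Proof. by move=> ok; rewrite /co at_val. Qed.

Lemma ve_at h v : blowup_ok (h, v) -> ve (at_ h v) = v.
Proof. by move=> ok; rewrite /ve at_val. Qed.

Lemma at_co x : at_ (co x) (ve x) = x.
Proof. by apply: val_inj; rewrite at_val /co /ve -surjective_pairing //; apply: valP. Qed.

Lemma at_eq h v x : co x = h -> ve x = v -> at_ h v = x.
Proof. by move=> <- <-; apply: at_co. Qed.

Lemma ok_co x : blowup_ok (co x, ve x).
Proof. by rewrite /co /ve -surjective_pairing; apply: valP. Qed.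

Lemma okM h v : h \in M -> blowup_ok (h, v) = (v != a).
Proof. by rewrite /blowup_ok /= => ->; case: (v == a). Qed.

Lemma okS h v : h \notin M -> blowup_ok (h, v) = (v == a).
Proof. by rewrite /blowup_ok /= => ->; case: (v == a). Qed.

Lemma ok_pt h h' : eH h h' -> blowup_ok (h, pt h h').
Proof.
move=> hh; case: (boolP (h \in M)) => hM; last by rewrite okS // ptS.
by rewrite okM // eq_sym; apply: cubic_irr irrA _; apply: ptM.
Qed.

Lemma crel_sym : symmetric crel.
Proof.
by move=> x y; rewrite /crel eq_sym symA symH; congr (_ || (_ && _)); rewrite andbC.
Qed.

Lemma crel_irr : irreflexive crel.
Proof. by move=> x; rewrite /crel irrA irrH andbF. Qed.

Lemma crel_in h v v' : blowup_ok (h, v) -> blowup_ok (h, v') -> crel (at_ h v) (at_ h v') = e v v'.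
Proof. by move=> ok ok'; rewrite /crel !co_at // !ve_at // eqxx irrH orbF. Qed.

Lemma crel_cross h h' : eH h h' -> crel (at_ h (pt h h')) (at_ h' (pt h' h)).
Proof.
move=> hh; have hh' : eH h' h by rewrite symH.
by rewrite /crel !co_at ?ok_pt // !ve_at ?ok_pt // hh !eqxx orbT.
Qed.

Lemma crel_out x y : crel x y -> co x != co y ->
  [/\ eH (co x) (co y), x = at_ (co x) (pt (co x) (co y)) & y = at_ (co y) (pt (co y) (co x))].
Proof.
rewrite /crel => /orP[/andP[->//]|/and3P[hh /eqP xE /eqP yE]] _.
by split=> //; [rewrite -xE at_co|rewrite -yE at_co].
Qed.

(** Three frame edges are attached injectively to the three neighbours of [a], so every neighbour is
    hit. *)
Lemma pt_surj h v : h \in M -> e a v -> exists2 h', eH h h' & v = pt h h'.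
Proof.
move=> hM eav; have : v \in [set pt h h' | h' in [set h' | eH h h']].
  rewrite (_ : [set _ | _ in _] = [set v | e a v]) ?inE //.
  apply/eqP; rewrite eqEcard; apply/andP; split.
    by apply/subsetP=> z /imsetP[h2]; rewrite !inE => hh ->; apply: ptM.
  have [_ _ cubA _] := GA; have [_ _ cubH _] := GH.
  rewrite cubA card_in_imset ?cubH // => h1 h2; rewrite !inE; exact: pt_inj.
by case/imsetP=> h'; rewrite inE => hh ->; exists h'.
Qed.

Lemma crel_cubic : cubic crel.
Proof.
have [_ _ cubA _] := GA; have [_ _ cubH _] := GH.
move=> x; case: (boolP (co x \in M)) => hM.
  (* From inside a copy the outside plays the role of [a]; with this reading the neighbours of x
     correspond to those of [ve x] in [A]. *)
  pose g (y : blowup) := if co y == co x then ve y else a.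
  have vx : ve x != a by rewrite -(okM _ hM) ok_co.
  have gi : {in [set y | crel x y] &, injective g}.
    move=> y z; rewrite !inE /g => xy xz.
    have na w : co w == co x -> ve w != a by move=> /eqP cw; rewrite -(okM (h := co w)) ?ok_co ?cw.
    case: eqVneq => cy; case: eqVneq => cz E.
    - by apply: blowup_inj; rewrite ?cy ?cz.
    - by case/eqP: (na y (introT eqP cy)).
    - by case/eqP: (na z (introT eqP cz)).
    rewrite eq_sym in cy; rewrite eq_sym in cz.
    have [hy xEy ->] := crel_out xy cy; have [hz xEz ->] := crel_out xz cz.
    suff -> : co y = co z by [].
    apply: (pt_inj hM) => //; move: (congr1 ve xEy) (congr1 ve xEz).
    by rewrite !ve_at ?ok_pt // => <-.
  rewrite -(card_in_imset gi) -(cubA (ve x)); congr #|pred_of_set _|; apply/setP=> v.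
  rewrite inE; apply/imsetP/idP => [[y]|xv].
    rewrite inE /g => xy ->; case: eqVneq => cy.
      by move: xy; rewrite /crel cy irrH eqxx /= orbF.
    rewrite eq_sym in cy; have [hy xE _] := crel_out xy cy.
    by rewrite xE ve_at ?ok_pt // symA ptM.
  have [va|va] := eqVneq v a.
    move: xv; rewrite va symA => /(pt_surj hM)[h' hh xE].
    have hh' : eH h' (co x) by rewrite symH.
    exists (at_ h' (pt h' (co x))).
      by rewrite inE -{1}[x]at_co xE crel_cross.
    by rewrite /g co_at ?ok_pt // eq_sym (negPf (cubic_irr irrH hh)).
  have ok : blowup_ok (co x, v) by rewrite okM.
  exists (at_ (co x) v); last by rewrite /g co_at // eqxx ve_at.
  by rewrite inE -{1}[x]at_co crel_in // ok_co.
have vx : ve x = a by apply/eqP; rewrite -(okS _ hM) ok_co.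
have ne y : crel x y -> co x != co y.
  apply: contraTneq => cE; rewrite /crel cE eqxx irrH orbF /= vx.
  have -> : ve y = a by apply/eqP; rewrite -(okS (h := co y)) ?ok_co // -cE.
  by rewrite irrA.
have gi : {in [set y | crel x y] &, injective co}.
  move=> y z; rewrite !inE => xy xz cE.
  by have [_ _ ->] := crel_out xy (ne _ xy); have [_ _ ->] := crel_out xz (ne _ xz); rewrite cE.
rewrite -(card_in_imset gi) -(cubH (co x)); congr #|pred_of_set _|; apply/setP=> h.
rewrite inE; apply/imsetP/idP => [[y]|xh].
  by rewrite inE => xy ->; case: (crel_out xy (ne _ xy)).
have xh' : eH h (co x) by rewrite symH.
exists (at_ h (pt h (co x))); last by rewrite co_at ?ok_pt.
by rewrite inE -{1}[x]at_co vx -(ptS h hM) crel_cross.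
Qed.

Lemma crel_3conn : three_connected crel.
Proof.
have [_ _ cubA [A3 connA]] := GA; have [_ _ cubH [H3 connH]] := GH.
split; first by rewrite card_blowup -(cardsC M) addnC in H3 *; move: H3 A3; clear; nia.
move=> S S3; pose P := co @: S.
have PS : #|P| < 3 by apply: leq_ltn_trans (leq_imset_card _ _) S3.
have symc := on_rel_connect_sym (~: S) crel_sym.
have alive h v : h \notin P -> blowup_ok (h, v) -> at_ h v \notin S.
  by move=> hP ok; apply: contra hP => aS; apply/imsetP; exists (at_ h v); rewrite ?co_at.
have c1 h v v' : h \notin P -> blowup_ok (h, v) -> blowup_ok (h, v') ->
    connect (on_rel (~: S) crel) (at_ h v) (at_ h v').
  move=> hP; case: (boolP (h \in M)) => hM; last first.
    by rewrite !okS // => /eqP-> /eqP->; apply: connect0.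
  rewrite !okM // => va v'a.
  have : connect (on_rel (~: [set a]) e) v v' by apply: connA; rewrite ?cards1 ?inE.
  apply: (connect_homo (f := at_ h)) => x y; rewrite /on_rel /= !inE => /and3P[xa ya xy].
  by apply: connect1; rewrite /on_rel /= !inE !alive ?okM // crel_in ?okM.
have [b eab] : exists b, e a b by have [b []] := @cubic_nbr _ e a [::] cubA isT; exists b.
(* One representative vertex per piece, so that walks in the frame can be lifted. *)
pose rv h := if h \in M then b else a.
have okr h : blowup_ok (h, rv h).
  rewrite /rv; case: (boolP (h \in M)) => hM; last by rewrite okS.
  by rewrite okM // eq_sym (cubic_irr irrA).
have c2 i j : i \notin P -> j \notin P ->
    connect (on_rel (~: S) crel) (at_ i (rv i)) (at_ j (rv j)).
  move=> iP jP; have : connect (on_rel (~: P) eH) i j by apply: connH; rewrite ?inE.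
  apply: (connect_homo (f := fun h => at_ h (rv h))) => x y.
  rewrite /on_rel /= !inE => /and3P[xP yP xy]; have yx : eH y x by rewrite symH.
  apply: connect_trans (c1 x (rv x) (pt x y) xP (okr x) (ok_pt xy)) _.
  apply: connect_trans (c1 y (pt y x) (rv y) yP (ok_pt yx) (okr y)).
  by apply: connect1; rewrite /on_rel /= !inE !alive ?ok_pt // crel_cross.
(* Pieces free of [S] are connected inside, as [A] minus [a] is, and to each other, as the frame
   minus [P] is. What remains is that every surviving vertex of a damaged piece can reach an
   undamaged one. *)
have c3 z : z \notin S -> exists h v, [/\ h \notin P, blowup_ok (h, v) &
    connect (on_rel (~: S) crel) z (at_ h v)].
  move=> zS; case: (boolP (co z \in P)) => zP; last first.
    by exists (co z), (ve z); rewrite at_co ok_co connect0.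
  set h := co z in zP *.
  have hM : h \in M.
    apply/negPn/negP => hM; case/imsetP: zP => s sS sE.
    suff : z = s by move=> zE; rewrite zE sS in zS.
    apply: blowup_inj => //.
    have /eqP -> : ve z == a by rewrite -(okS (h := co z)) ?ok_co.
    by apply/esym/eqP; rewrite -(okS (h := co s)) ?ok_co // -sE.
  pose Sh := ve @: [set s in S | co s == h]; pose P' := P :\ h.
  have Sh_alive v : v != a -> v \notin Sh -> at_ h v \notin S.
    move=> va; apply: contra => aS; apply/imsetP; exists (at_ h v); rewrite ?ve_at ?okM //.
    by rewrite inE aS co_at ?okM ?eqxx.
  have cS : #|Sh| + #|P'| < 3.
    apply: leq_ltn_trans S3; rewrite -(cardsID [set s | co s == h] S) leq_add //.
      rewrite (_ : S :&: _ = [set s in S | co s == h]) ?leq_imset_card //.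
      by apply/setP=> s; rewrite !inE.
    apply: leq_trans (leq_imset_card co _); apply: subset_leq_card; apply/subsetP=> h'.
    rewrite !inE => /andP[h'h /imsetP[s sS sE]]; apply/imsetP; exists s => //.
    by rewrite !inE sS andbT -sE.
  have Sh1 : 0 < #|Sh|.
    case/imsetP: zP => s sS sE; apply/card_gt0P; exists (ve s); apply: imset_f.
    by rewrite inE sS sE eqxx.
  pose Q := pt h @: [set h' in P' | eH h h'].
  have cQ : #|Q| <= #|P'|.
    apply: leq_trans (leq_imset_card _ _) _; apply: subset_leq_card; apply/subsetP=> h'.
    by rewrite inE => /andP[].
  have aQ : a \notin Q.
    apply/imsetP=> -[h']; rewrite !inE => /andP[_ hh] aE.
    by have := ptM hM hh; rewrite -aE irrA.
  have aSh : a \notin Sh.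
    apply/imsetP=> -[s]; rewrite inE => /andP[_ /eqP sh] aE.
    by have := ok_co s; rewrite sh okM // -aE eqxx.
  (* [Q] consists of the ports towards other damaged pieces. Since [Sh] and [Q] together have fewer
     than three vertices, [A] contains a walk from v to [a] avoiding both; its last vertex before
     [a] is a port towards an undamaged piece. *)
  have esc v : v \notin Q -> v \notin Sh -> v != a ->
      exists h' v', [/\ h' \notin P, blowup_ok (h', v') & connect (on_rel (~: S) crel) (at_ h v) (at_ h' v')].
    move=> vQ vSh va.
    have : connect (on_rel (~: (Sh :|: Q)) e) v a.
      apply: connA; rewrite ?inE ?negb_or ?vSh ?vQ ?aQ ?aSh //.
      by apply: leq_ltn_trans (leq_card_setU _ _) (leq_ltn_trans (leq_add (leqnn _) cQ) cS).
    case/connectP=> p; elim: p v vQ vSh va => [|w p IH] v vQ vSh va /=.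
      by move=> _ aE; rewrite aE eqxx in va.
    rewrite {1}/on_rel /= !inE !negb_or -!andbA => /and5P[_ _ wSh wQ /andP[vw pth]] lastE.
    have [wa|wa] := eqVneq w a.
      move: vw; rewrite wa symA => /(pt_surj hM)[h' hh vE].
      have hh' : eH h' h by rewrite symH.
      have h'P : h' \notin P.
        apply: contra vQ => h'P; rewrite vE; apply: imset_f.
        by rewrite !inE h'P hh eq_sym (cubic_irr irrH hh).
      exists h', (pt h' h); rewrite ok_pt //; split=> //; apply: connect1.
      by rewrite /on_rel /= !inE Sh_alive // alive ?ok_pt // vE crel_cross.
    have [h' [v' [h'P ok con]]] := IH w wQ wSh wa pth lastE.
    exists h', v'; split=> //; apply: connect_trans con; apply: connect1.
    by rewrite /on_rel /= !inE !Sh_alive // crel_in ?okM.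
  have va : ve z != a by rewrite -(okM _ hM) ok_co.
  have vSh : ve z \notin Sh.
    apply/imsetP => -[s]; rewrite inE => /andP[sS /eqP sh] sE.
    by rewrite (blowup_inj (esym sh) sE) sS in zS.
  (* If z itself is a bad port, then [Sh] has one vertex and z is the only bad port. Inside the
     copy, which stays connected without that vertex, z reaches some other vertex w, and w
     escapes. *)
  rewrite -[z]at_co -/h; case: (boolP (ve z \in Q)) => vQ; last exact: esc.
  have Q1 : 0 < #|Q| by apply/card_gt0P; exists (ve z).
  have cP' : #|P'| = 1 by clear - cS cQ Q1 Sh1; lia.
  have QE : Q = [set ve z].
    by apply/esym/eqP; rewrite eqEcard sub1set vQ cards1 -cP'.
  have [w wP] : exists w, w \notin a |: (ve z |: Sh).
    have /subsetPn[w _ wP] : ~~ (setT \subset a |: (ve z |: Sh)).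
      apply: contraL A3 => /subset_leq_card; rewrite cardsT -leqNgt.
      by clear - cS cP'; rewrite !cardsU1; do 2!case: (_ \notin _); lia.
    by exists w.
  move: wP; rewrite !inE !negb_or => /and3P[wa wz wSh].
  have [|||h' [v' [h'P ok con]]] := esc w; rewrite ?QE ?inE //.
  exists h', v'; split=> //; apply: connect_trans con.
  have : connect (on_rel (~: (a |: Sh)) e) (ve z) w.
    apply: connA; rewrite ?inE ?negb_or ?va ?wa //.
    by clear - cS cP'; rewrite cardsU1; case: (_ \notin _); lia.
  apply: (connect_homo (f := at_ h)) => x y; rewrite /on_rel /= !inE !negb_or -!andbA.
  case/and5P=> xa xS ya yS xy; apply: connect1.
  by rewrite /on_rel /= !inE !Sh_alive // crel_in ?okM.
move=> u v; rewrite !inE => /c3[h [x [hP okx ux]]] /c3[h' [y [h'P oky vy]]].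
apply: connect_trans ux _; rewrite symc; apply: connect_trans vy _.
apply: connect_trans (c1 h' y (rv h') h'P oky (okr _)) _.
apply: connect_trans (c2 h' h h'P hP) _.
exact: c1.
Qed.

Lemma crel_cubic_3conn : cubic_3conn crel.
Proof. by split; [exact: crel_sym|exact: crel_irr|exact: crel_cubic|exact: crel_3conn]. Qed.
End Composite.

(** * Crossings of a factor between the pieces of a blow-up *)

Section Flow.
Variables (H A : finType) (eH : rel H) (e : rel A) (a : A) (M : {set H}) (pt : H -> H -> A).
Hypotheses (GH : cubic_3conn eH) (GA : cubic_3conn e).
Hypothesis ptS : forall h h', h \notin M -> pt h h' = a.
Hypothesis ptM : forall h h', h \in M -> eH h h' -> e a (pt h h').
Hypothesis pt_inj : forall h h1 h2, h \in M -> eH h h1 -> eH h h2 -> pt h h1 = pt h h2 -> h1 = h2.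
Variable c0 : blowup a M.
Variable c : blowup a M -> blowup a M.
Hypothesis cc : forall u, c (c u) = c u.

Let symH : symmetric eH. Proof. by case: GH. Qed.
Let irrH : irreflexive eH. Proof. by case: GH. Qed.
Let symA : symmetric e. Proof. by case: GA. Qed.
Let irrA : irreflexive e. Proof. by case: GA. Qed.
Let okp h h' : eH h h' -> blowup_ok a M (h, pt h h').
Proof. exact: (ok_pt GA ptS ptM). Qed.
Let Rel := crel eH e (a := a) (M := M) pt.
Let At := at_ c0.

(* What is needed of [c] at [h] only: elsewhere it need not come from a factor, since for t3 the
   deleted vertices are given artificial centres. *)
Definition good h : Prop :=
  (forall u, (co u == h) || (co (c u) == h) -> u != c u -> Rel u (c u)) /\
  (forall u, co (c u) = h -> #|[set w | c w == c u]| = 3).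

(* The edge hh' lies on a path centred at its end in h'. *)
Definition flow h h' := eH h h' && (c (At h (pt h h')) == At h' (pt h' h)).
Definition outs h := [set h' | flow h h'].
Definition ins h := [set h' | flow h' h].

Lemma flow_asym h h' : flow h h' -> flow h' h -> False.
Proof.
move=> /andP[hh /eqP cp] /andP[hh' /eqP cq].
have := cc (At h (pt h h')); rewrite cp cq => /(congr1 (@co _ _ _ _)).
by rewrite !co_at ?okp // => hE; rewrite hE irrH in hh.
Qed.

Lemma good_out h u : good h -> co u = h -> co (c u) != h ->
  exists h', flow h h' /\ u = At h (pt h h').
Proof.
move=> [g _] uh cuh; have uc : u != c u by apply: contraNneq cuh => <-; rewrite uh.
have ruc : Rel u (c u) by apply: g => //; rewrite uh eqxx.
have nco : co u != co (c u) by rewrite uh eq_sym.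
have [hh uE cE] := crel_out c0 ruc nco; rewrite uh in hh uE cE.
by exists (co (c u)); rewrite /flow /At -uE -cE hh eqxx.
Qed.

Lemma good_in h u : good h -> co u != h -> co (c u) = h ->
  exists h', flow h' h /\ u = At h' (pt h' h).
Proof.
move=> [g _] uh cuh; have uc : u != c u by apply: contraNneq uh => ->; rewrite cuh.
have ruc : Rel u (c u) by apply: g => //; rewrite cuh eqxx orbT.
have nco : co u != co (c u) by rewrite cuh.
have [hh uE cE] := crel_out c0 ruc nco; rewrite cuh in hh uE cE.
by exists (co u); rewrite /flow /At -uE -cE hh eqxx.
Qed.

Lemma card_piece h : h \in M -> #|[set u : blowup a M | co u == h]| = #|A|.-1.
Proof.
move=> hM; rewrite -(cardsC1 a) -(card_in_imset (f := At h) (D := [set~ a])).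
  congr #|pred_of_set _|; apply/setP=> u; rewrite inE; apply/eqP/imsetP => [uh|[v]].
    exists (ve u); last by rewrite -uh /At at_co.
    by rewrite !inE -(okM a _ hM) -uh ok_co.
  by rewrite !inE => va ->; rewrite co_at ?okM.
move=> v w; rewrite !inE => va wa /(congr1 (@ve _ _ _ _)).
by rewrite !ve_at ?okM.
Qed.

(** The set [Y] of vertices centred in the piece is a union of fibres of size 3. It differs from the
    piece [X] by the end vertices of the crossings; as the ports are distinct, these are counted by
    frame edges. *)
Lemma flow_count h : h \in M -> good h ->
  #|A|.-1 + #|ins h| = #|outs h| %[mod 3].
Proof.
move=> hM g.
pose X := [set u : blowup a M | co u == h]; pose Y := [set u | co (c u) == h].
have inE' : #|Y :\: X| = #|ins h|.
  rewrite -(card_in_imset (f := fun h' => At h' (pt h' h)) (D := mem (ins h))).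
    congr #|pred_of_set _|; apply/setP=> u; rewrite !inE; apply/andP/imsetP.
      case=> uh /eqP cuh; have [h' [fl uE]] := good_in g uh cuh.
      by exists h'; rewrite ?inE.
    case=> h'; rewrite inE => fl ->; have /andP[hh /eqP->] := fl.
    have hh' : eH h h' by rewrite symH.
    by rewrite !co_at ?okp // (cubic_irr irrH hh).
  move=> h1 h2; rewrite !inE => /andP[e1 _] /andP[e2 _] /(congr1 (@co _ _ _ _)).
  by rewrite !co_at ?okp.
have outE : #|X :\: Y| = #|outs h|.
  rewrite -(card_in_imset (f := fun h' => At h (pt h h')) (D := mem (outs h))).
    congr #|pred_of_set _|; apply/setP=> u; rewrite !inE; apply/andP/imsetP.
      case=> cuh /eqP uh; have [h' [fl uE]] := good_out g uh cuh.
      by exists h'; rewrite ?inE.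
    case=> h'; rewrite inE => fl ->; have /andP[hh /eqP->] := fl.
    have hh' : eH h' h by rewrite symH.
    by rewrite !co_at ?okp // (cubic_irr irrH hh').
  move=> h1 h2; rewrite !inE => /andP[e1 _] /andP[e2 _] /(congr1 (@ve _ _ _ _)).
  by rewrite !ve_at ?okp //; apply: pt_inj.
have dvd : 3 %| #|Y|.
  rewrite -sum1_card (partition_big c (fun r => co r == h)) /=; last by move=> u; rewrite inE.
  apply: dvdn_sum => r /eqP rh; rewrite sum1dep_card.
  case: (set_0Vmem [set u | (u \in Y) && (c u == r)]) => [->|[u]]; first by rewrite cards0.
  rewrite !inE => /andP[/eqP cuh /eqP ur]; rewrite (_ : [set _ | _] = [set w | c w == c u]).
    by rewrite (g.2 u cuh).
  by apply/setP=> w; rewrite !inE ur; case: (eqVneq (c w) r) => [->|]; rewrite ?rh ?eqxx ?andbF.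
have cX := card_piece hM.
have := cardsID Y X; have := cardsID X Y; rewrite inE' outE setIC cX.
move/dvdnP: dvd => [k ->] E1 <-.
by rewrite addnAC E1 modnMDl.
Qed.

(** An unreplaced vertex has no neighbour in its own piece: it is an end of a path centred
    elsewhere, or a centre whose two ends both lie elsewhere. *)
Lemma flow_single h : h \notin M -> good h ->
  (#|outs h| = 1 /\ #|ins h| = 0) \/ (#|outs h| = 0 /\ #|ins h| = 2).
Proof.
move=> hM g; pose x := At h a.
have ok : blowup_ok a M (h, a) by rewrite okS.
have xh : co x = h by rewrite co_at.
have xE u : co u = h -> u = x.
  move=> uh; apply: (@blowup_inj _ _ a M); rewrite ?xh // ve_at //.
  by apply/eqP; rewrite -(okS a (h := co u) (M := M)) ?ok_co ?uh.
have px h' : At h (pt h h') = x by rewrite ptS.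
case: (eqVneq (c x) x) => [cx|cx].
  right; split.
    apply: eq_card0 => h'; rewrite !inE; apply/negP => /andP[hh].
    rewrite px cx => /eqP/(congr1 (@co _ _ _ _)).
    by rewrite xh co_at ?okp 1?symH // => hE; rewrite hE irrH in hh.
  have f3 : #|[set w | c w == c x]| = 3 by apply: g.2; rewrite cx.
  have xf : x \in [set w | c w == c x] by rewrite inE.
  rewrite (cardsD1 x) xf in f3; case: f3 => f2.
  rewrite -(card_in_imset (f := fun h' => At h' (pt h' h)) (D := mem (ins h))).
    rewrite -f2; congr #|pred_of_set _|; apply/setP=> u; rewrite !inE cx.
    apply/imsetP/andP => [[h']|[ux /eqP cux]].
      rewrite inE => fl ->; have /andP[hh /eqP->] := fl; rewrite px; split=> //.
      by apply/eqP => /(congr1 (@co _ _ _ _)); rewrite xh co_at ?okp // => hE; rewrite hE irrH in hh.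
    have uh : co u != h by apply: contraNneq ux => /xE->.
    have [|h' [fl uE]] := good_in g uh; first by rewrite cux.
    by exists h'; rewrite ?inE.
  move=> h1 h2; rewrite !inE => /andP[e1 _] /andP[e2 _] /(congr1 (@co _ _ _ _)).
  by rewrite !co_at ?okp.
left; split; last first.
  apply: eq_card0 => h'; rewrite !inE; apply/negP => /andP[hh /eqP].
  by rewrite px => cE; case/eqP: cx; rewrite -cE cc.
have cxh : co (c x) != h by apply: contraNneq cx => /xE->.
have [h' [fl _]] := good_out g xh cxh.
rewrite (_ : outs h = [set h']) ?cards1 //; apply/setP=> h2; rewrite !inE.
apply/idP/eqP => [fl2|-> //].
move: fl fl2 => /andP[e1 /eqP c1] /andP[e2 /eqP].
rewrite px in c1; rewrite px c1 => /(congr1 (@co _ _ _ _)).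
by rewrite !co_at ?okp 1?symH.
Qed.

(** [A] is placed on the copy at [h], with [a] on the outer end of the edge to [h1]. The image of
    [a] has just one neighbour in the copy, so adjacency is reflected by this map though in general
    not preserved. *)
Let f (h h1 : H) (v : A) := if v == a then At h1 (pt h1 h) else At h v.

Let f_inj h h1 : h \in M -> eH h h1 -> injective (f h h1).
Proof.
move=> hM hh v w; have hh' : eH h1 h by rewrite symH.
have ne x : x != a -> At h1 (pt h1 h) <> At h x.
  move=> xa /(congr1 (@co _ _ _ _)); rewrite !co_at ?okp ?okM // => hE.
  by rewrite hE irrH in hh.
rewrite /f; case: eqVneq => va; case: eqVneq => wa; first by rewrite va wa.
- by move/(ne _ wa).
- by move/esym/(ne _ va).
by move/(congr1 (@ve _ _ _ _)); rewrite !ve_at ?okM.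
Qed.

Let f_rel h h1 u v : h \in M -> eH h h1 -> Rel (f h h1 u) (f h h1 v) -> e u v.
Proof.
move=> hM hh; have hh' : eH h1 h by rewrite symH.
have key x : x != a -> Rel (At h x) (At h1 (pt h1 h)) -> e x a.
  move=> xa rx; have xE : co (At h x) = h by rewrite co_at ?okM.
  have [|_] := crel_out c0 rx; first by rewrite xE co_at ?okp // (cubic_irr irrH).
  rewrite xE (co_at c0 (okp hh')) => /(congr1 (@ve _ _ _ _)).
  by rewrite !ve_at ?okp ?okM // => -> _; rewrite symA ptM.
rewrite /f; case: eqVneq => va; case: eqVneq => wa.
- by rewrite /Rel (crel_irr pt GH GA).
- by rewrite va symA /Rel (crel_sym pt GH GA); apply: key.
- by rewrite wa; apply: key.
by rewrite /Rel (crel_in e pt GH) ?okM.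
Qed.

Let Rel_sym : symmetric Rel.
Proof. exact: (crel_sym pt GH GA). Qed.

Lemma flow_none h : h \in M -> good h -> #|outs h| = 0 -> #|ins h| = 0 ->
  has_lfactor (~: [set a]) e.
Proof.
move=> hM g /cards0_eq o0 /cards0_eq i0.
have [_ _ cubH _] := GH; have [h1 [hh _]] := @cubic_nbr _ eH h [::] cubH isT.
apply: (has_pull (f := f h h1) (E' := Rel)) => //; first exact: f_inj.
  by move=> u v _ _; apply: f_rel.
rewrite (_ : _ @: _ = [set u | co u == h]); last first.
  apply/setP=> u; rewrite !inE; apply/imsetP/eqP => [[v]|uh].
    by rewrite !inE /f => /[dup] va /negPf-> ->; rewrite co_at ?okM.
  have va : ve u != a by rewrite -(okM a _ hM) -uh ok_co.
  by exists (ve u); rewrite ?inE // /f (negPf va) -uh /At at_co.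
apply/has_starP; first exact: Rel_sym.
eexists; apply: (star_closed (c := c)) => u; rewrite !inE; last first.
  move=> /eqP uh; split; rewrite ?cc //; first by apply: g.1; rewrite uh eqxx.
  apply: g.2; apply/eqP/negPn/negP => cuh; have [h' [fl _]] := good_out g uh cuh.
  by move/setP/(_ h'): o0; rewrite !inE fl.
apply/eqP/eqP => uh; apply/eqP/negPn/negP => cuh.
  by have [h' [fl _]] := good_in g cuh uh; move/setP/(_ h'): i0; rewrite !inE fl.
by have [h' [fl _]] := good_out g uh cuh; move/setP/(_ h'): o0; rewrite !inE fl.
Qed.

(** The copy together with the outer end [q] of the single crossing is a union of paths, and [q]
    takes the place of [a] as an end vertex. *)
Lemma flow_in1 h : h \in M -> good h -> #|outs h| = 0 -> #|ins h| = 1 ->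
  has_lfactor setT e.
Proof.
move=> hM g /cards0_eq o0 /eqP/cards1P[h1 i1].
have fl1 : flow h1 h by have : h1 \in ins h by [rewrite i1 inE]; rewrite inE.
have /andP[hh' /eqP cq] := fl1; have hh : eH h h1 by rewrite symH.
set q := At h1 _ in cq; set p := At h _ in cq.
have ph : co p = h by rewrite /p co_at ?okp.
have qh : co q != h by rewrite /q co_at ?okp // eq_sym (cubic_irr irrH hh).
apply: (has_pull (f := f h h1) (E' := Rel)) => //; first exact: f_inj.
  by move=> u v _ _; apply: f_rel.
rewrite (_ : _ @: _ = [set u | (co u == h) || (u == q)]); last first.
  apply/setP=> u; rewrite !inE; apply/imsetP/orP => [[v _ ->]|[/eqP uh|/eqP->]].
  - by rewrite /f; case: (eqVneq v a) => va; [right|left; rewrite co_at ?okM].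
  - have va : ve u != a by rewrite -(okM a _ hM) -uh ok_co.
    by exists (ve u); rewrite ?inE // /f (negPf va) -uh /At at_co.
  by exists a; rewrite ?inE // /f eqxx.
have stay u : co u = h -> co (c u) = h.
  move=> uh; apply/eqP/negPn/negP => cuh; have [h' [fl _]] := good_out g uh cuh.
  by move/setP/(_ h'): o0; rewrite !inE fl.
apply/has_starP; first exact: Rel_sym.
have cnq u : c u != q.
  by apply/eqP => cuq; have := cc u; rewrite cuq cq => pq; rewrite -pq ph eqxx in qh.
eexists; apply: (star_closed (c := c)) => u; rewrite !inE; last first.
  move=> uP; have cuh : co (c u) = h by case/orP: uP => /eqP uE; [exact: stay|rewrite uE cq].
  split; rewrite ?cc //; last exact: g.2.
  by apply: g.1; rewrite cuh eqxx orbT.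
rewrite (negPf (cnq u)) orbF; apply/eqP/orP => [cuh|[/eqP/stay //|/eqP->]]; last by rewrite cq.
case: (eqVneq (co u) h) => uh; [by left|right].
have [h' [fl uE]] := good_in g uh cuh.
have : h' \in ins h by rewrite inE.
by rewrite i1 inE => /eqP h'E; rewrite uE h'E.
Qed.

(** Only the two ports of the crossings belong to paths centred outside; the rest of the copy is a
    union of paths. The three vertices removed from [A] form a path with centre [a]. *)
Lemma flow_out2 h h1 h2 : h \in M -> good h -> outs h = [set h1; h2] -> #|ins h| = 0 ->
  has_lfactor (~: [set pt h h1; a; pt h h2]) e.
Proof.
move=> hM g o2 /cards0_eq i0.
have fl1 : flow h h1 by have : h1 \in outs h by [rewrite o2 !inE eqxx]; rewrite inE.
have fl2 : flow h h2 by have : h2 \in outs h by [rewrite o2 !inE eqxx orbT]; rewrite inE.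
have /andP[hh1 /eqP cp1] := fl1; have /andP[hh2 /eqP cp2] := fl2.
have hh1' : eH h1 h by rewrite symH.
have hh2' : eH h2 h by rewrite symH.
have a1 : pt h h1 != a by rewrite eq_sym (cubic_irr irrA) ?ptM.
have a2 : pt h h2 != a by rewrite eq_sym (cubic_irr irrA) ?ptM.
set p1 := At h _ in cp1; set p2 := At h (pt h h2) in cp2.
have cp1h : co (c p1) != h by rewrite cp1 co_at ?okp // (cubic_irr irrH).
have cp2h : co (c p2) != h by rewrite cp2 co_at ?okp // (cubic_irr irrH).
apply: (has_pull (f := f h h1) (E' := Rel)) => //; first exact: f_inj.
  by move=> u v _ _; apply: f_rel.
rewrite (_ : _ @: _ = [set u | [&& co u == h, u != p1 & u != p2]]); last first.
  apply/setP=> u; rewrite !inE; apply/imsetP/and3P => [[v]|[/eqP uh u1 u2]].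
    rewrite !inE !negb_or => /andP[/andP[v1 va] v2] ->; rewrite /f (negPf va).
    split; first by rewrite co_at ?okM.
      by apply: contraNneq v1 => /(congr1 (@ve _ _ _ _)); rewrite !ve_at ?okM // => ->.
    by apply: contraNneq v2 => /(congr1 (@ve _ _ _ _)); rewrite !ve_at ?okM // => ->.
  have va : ve u != a by rewrite -(okM a _ hM) -uh ok_co.
  have uE : u = At h (ve u) by rewrite -uh /At at_co.
  exists (ve u); last by rewrite /f (negPf va).
  rewrite !inE !negb_or va andbT; apply/andP; split.
    by apply: contraNneq u1 => vE; rewrite uE vE.
  by apply: contraNneq u2 => vE; rewrite uE vE.
have stay u : co u = h -> u != p1 -> u != p2 -> [&& co (c u) == h, c u != p1 & c u != p2].
  move=> uh u1 u2; have cuh : co (c u) == h.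
    apply/negPn/negP => cuh; have [h' [fl uE]] := good_out g uh cuh.
    have : h' \in outs h by rewrite inE.
    by rewrite o2 !inE => /orP[]/eqP h'E; [case/eqP: u1|case/eqP: u2]; rewrite uE h'E.
  rewrite cuh /=; apply/andP; split; apply/eqP => cE.
    by move: cp1h; rewrite -cE cc cuh.
  by move: cp2h; rewrite -cE cc cuh.
apply/has_starP; first exact: Rel_sym.
eexists; apply: (star_closed (c := c)) => u; rewrite !inE; last first.
  move=> /and3P[/eqP uh u1 u2]; have /and3P[/eqP cuh _ _] := stay u uh u1 u2.
  by split; rewrite ?cc //; [apply: g.1; rewrite uh eqxx|exact: g.2].
apply/idP/idP => [/and3P[/eqP cuh _ _]|/and3P[/eqP uh u1 u2]]; last exact: stay.
apply/and3P; split.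
- apply/negPn/negP => uh; have [h' [fl _]] := good_in g uh cuh.
  by move/setP/(_ h'): i0; rewrite !inE fl.
- by apply: contraNneq cp1h => <-; rewrite cuh.
- by apply: contraNneq cp2h => <-; rewrite cuh.
Qed.

(* out + 2 in = 2 is what a Lambda-factor of the piece with [a] restored looks like:
   [a] is an end (in = 1) or a centre (out = 2). *)
Lemma flow_exact h : h \in M -> good h -> #|outs h| + 2 * #|ins h| = 2 ->
  has_lfactor setT e.
Proof.
move=> hM g E.
have [i1|i0] : #|ins h| = 1 \/ #|ins h| = 0 by clear - E; lia.
  by apply: (flow_in1 hM g _ i1); clear - E i1; lia.
have o2' : #|outs h| = 2 by clear - E i0; lia.
have /eqP/cards2P[h1 [h2 [h12 o2]]] := o2'.
have fac := flow_out2 hM g o2 i0.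
have fl1 : flow h h1 by have : h1 \in outs h by [rewrite o2 !inE eqxx]; rewrite inE.
have fl2 : flow h h2 by have : h2 \in outs h by [rewrite o2 !inE eqxx orbT]; rewrite inE.
have /andP[hh1 _] := fl1; have /andP[hh2 _] := fl2.
have e1 := ptM hM hh1; have e2 := ptM hM hh2.
have p12 : pt h h1 != pt h h2 by apply: contraNneq h12 => /pt_inj->.
apply: (lfactor_eq (V := [set pt h h1; a; pt h h2] :|: ~: [set pt h h1; a; pt h h2])).
  by rewrite setUCr.
apply: has_union => //; first by rewrite -setI_eq0 setICr.
apply: has_triple => //; rewrite 1?symA //.
  by rewrite eq_sym (cubic_irr irrA).
by rewrite eq_sym (cubic_irr irrA).
Qed.
End Flow.

(** * The frames K33 and K4 *)

Section Frames.

Definition k33 : rel (bool * 'I_3) := fun x y => x.1 != y.1.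
Definition k4 : rel (option 'I_3) := fun x y => x != y.

Lemma k33_side s : #|[set x : bool * 'I_3 | x.1 == s]| = 3.
Proof.
rewrite (_ : [set x | _] = [set (s, j) | j in 'I_3]).
  by rewrite card_imset ?card_ord // => i j [].
apply/setP=> -[t j]; rewrite !inE /=; apply/eqP/imsetP => [->|[i _ [-> _]] //].
by exists j.
Qed.

Lemma k33_cubic_3conn : cubic_3conn k33.
Proof.
split; first by move=> x y; rewrite /k33 eq_sym.
- by move=> x; rewrite /k33 eqxx.
- move=> x; apply: etrans (k33_side (~~ x.1)); apply: eq_card => y; rewrite !inE /k33.
  by case: x.1; case: y.1.
split; first by rewrite card_prod card_bool card_ord.
move=> S S3 u v uS vS; rewrite -/(on_rel (~: S) k33).
case: (boolP (k33 u v)) => uv; first by apply: connect1; rewrite /on_rel /= uS vS.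
(* Non-adjacent vertices lie on one side and have all three vertices of the other side as common
   neighbours, one of which survives. *)
have [w wu wS] : exists2 w, k33 u w & w \in ~: S.
  have /subsetPn[w] : ~~ ([set x | x.1 == ~~ u.1] \subset S).
    by apply: contraL S3 => /subset_leq_card; rewrite k33_side -leqNgt.
  rewrite inE => /eqP wE wS; exists w; last by rewrite inE.
  by rewrite /k33 wE; case: u.1.
have wv : k33 w v by move: uv wu; rewrite /k33; case: u.1; case: v.1; case: w.1.
by apply: (connect_trans (y := w)); apply: connect1; rewrite /on_rel /= ?uS ?vS wS ?wu.
Qed.

Lemma k4_cubic_3conn : cubic_3conn k4.
Proof.
split; first by move=> x y; rewrite /k4 eq_sym.
- by move=> x; rewrite /k4 eqxx.
- move=> x; rewrite (_ : [set y | _] = ~: [set x]) ?cardsC1 ?card_option ?card_ord //.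
  by apply/setP=> y; rewrite !inE /k4 eq_sym.
split; first by rewrite card_option card_ord.
move=> S S3 u v uS vS; have [->|uv] := eqVneq u v; first exact: connect0.
by apply: connect1; rewrite /= uS vS.
Qed.
End Frames.

Section FlowStar.
Variables (H A : finType) (eH : rel H) (e : rel A) (a : A) (M : {set H}) (pt : H -> H -> A).
Hypotheses (GH : cubic_3conn eH) (GA : cubic_3conn e).
Hypothesis ptS : forall h h', h \notin M -> pt h h' = a.
Hypothesis ptM : forall h h', h \in M -> eH h h' -> e a (pt h h').
Variable c0 : blowup a M.
Let Rel := crel eH e (a := a) (M := M) pt.

(** The vertices off [V] get new centres that lie off [V] and outside the piece [h], so the fibres
    of the centres in that piece are those of [c]. *)
Lemma good_star_ext V c c' h : star_fun V Rel c -> {in V, c' =1 c} ->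
  (forall u, u \notin V -> [/\ c' u \notin V, co (c' u) != h & u != c' u -> Rel u (c' u)]) ->
  good eH e pt c' h.
Proof.
move=> sc inV outV; split=> [u _ uc|u uh].
  case: (boolP (u \in V)) => uV; last by case: (outV u uV) => _ _; apply.
  by rewrite inV // in uc *; case: (sc.2 u uV) => _ _ + _; apply.
case: (boolP (u \in V)) => uV; last by case: (outV u uV) => _; rewrite uh eqxx.
case: (sc.2 u uV) => cuV _ _ <-; apply: eq_card => w; rewrite !inE (inV u uV).
case: (boolP (w \in V)) => wV; first by rewrite inV.
have [c'w _ _] := outV w wV; rewrite (sc.1 w wV).
have /negPf-> : c' w != c u by apply: contraNneq c'w => ->.
by apply/esym/negbTE; apply: contraNneq wV => ->.
Qed.

Lemma good_star V c h : star_fun V Rel c -> (forall u, co u = h -> u \in V) ->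
  good eH e pt c h.
Proof.
move=> sc hV; apply: (good_star_ext sc) => // u uV; rewrite sc.1 //; split=> //.
  by apply: contraNneq uV => /hV.
by rewrite eqxx.
Qed.

(** A deleted vertex is fixed by [c] and is the centre of nothing else, so no path crosses at an
    edge with a deleted end. *)
Lemma dead_flow V c h h' : star_fun V Rel c -> at_ c0 h (pt h h') \notin V -> eH h h' ->
  flow eH pt c0 c h h' = false /\ flow eH pt c0 c h' h = false.
Proof.
have [symH irrH _ _] := GH.
move=> sc hV hh; have hh' : eH h' h by rewrite symH.
have ne : at_ c0 h (pt h h') != at_ c0 h' (pt h' h).
  apply/eqP => /(congr1 (@co _ _ _ _)); rewrite !co_at ?(ok_pt GA ptS ptM) // => hE.
  by rewrite hE irrH in hh.
rewrite /flow hh hh' sc.1 // (negPf ne); split=> //=.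
apply: contraNF hV => /eqP cE; rewrite -cE (star_fun_in _ sc).
apply/negPn/negP => h'V; move/eqP: ne; apply; rewrite -cE; exact: sc.1.
Qed.

Lemma card_outs c h : #|outs eH pt c0 c h| = \sum_h' flow eH pt c0 c h h'.
Proof. by rewrite -sum1dep_card big_mkcond; apply: eq_bigr => h' _; case: flow. Qed.

Lemma card_ins c h : #|ins eH pt c0 c h| = \sum_h' flow eH pt c0 c h' h.
Proof. by rewrite -sum1dep_card big_mkcond; apply: eq_bigr => h' _; case: flow. Qed.

Lemma dead_single V c h : star_fun V Rel c -> h \notin M -> at_ c0 h a \notin V ->
  #|outs eH pt c0 c h| = 0 /\ #|ins eH pt c0 c h| = 0.
Proof.
have [symH _ _ _] := GH; move=> sc hM hV.
split; apply: eq_card0 => h'; rewrite !inE; apply/negP => fl; have /andP[hh _] := fl.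
  by have [] := dead_flow (h := h) (h' := h') sc; rewrite ?ptS ?fl.
by have [] := dead_flow (h := h) (h' := h') sc; rewrite ?ptS ?fl // symH.
Qed.

End FlowStar.

(** * Copies in the frame K33 *)

Section K33.
Variables (A : finType) (e : rel A) (a : A) (M : {set bool * 'I_3}) (nb : 'I_3 -> A).
Hypotheses (GA : cubic_3conn e) (nb_inj : injective nb) (nbE : forall j, e a (nb j)).
Variable c0 : blowup a M.

Definition pt33 (h h' : bool * 'I_3) : A := if h \in M then nb h'.2 else a.

Lemma pt33S h h' : h \notin M -> pt33 h h' = a.
Proof. by rewrite /pt33 => /negPf->. Qed.

Lemma pt33M h h' : h \in M -> k33 h h' -> e a (pt33 h h').
Proof. by rewrite /pt33 => -> _. Qed.

Lemma pt33_inj h h1 h2 : h \in M -> k33 h h1 -> k33 h h2 -> pt33 h h1 = pt33 h h2 -> h1 = h2.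
Proof.
rewrite /pt33 => -> ; case: h h1 h2 => [s i] [s1 i1] [s2 i2]; rewrite /k33 /= => n1 n2 /nb_inj->.
by congr (_, _); case: s s1 s2 n1 n2 => [] [] [].
Qed.

Definition rel33 : rel (blowup a M) := crel k33 e pt33.

Lemma rel33_cubic_3conn : cubic_3conn rel33.
Proof.
exact: (crel_cubic_3conn k33_cubic_3conn GA pt33S pt33M pt33_inj c0).
Qed.

Variable c : blowup a M -> blowup a M.
Local Notation outs33 := (outs k33 pt33 c0 c).
Local Notation ins33 := (ins k33 pt33 c0 c).
Definition load33 i := #|outs33 (false, i)| + 2 * #|ins33 (false, i)|.

(** All edges of K33 join the two sides, so an out-crossing of one side is an in-crossing of the
    other and the weights 1 and 2 trade places. *)
Lemma load33_sum :
  \sum_i load33 i = \sum_j (#|ins33 (true, j)| + 2 * #|outs33 (true, j)|).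
Proof.
have split_side (F : bool * 'I_3 -> nat) : \sum_h F h = \sum_j F (true, j) + \sum_j F (false, j).
  rewrite (eq_bigr (fun h => F (h.1, h.2))); last by case.
  by rewrite -(pair_bigA _ (fun s j => F (s, j))) big_bool.
have flow_side s i j : flow k33 pt33 c0 c (s, i) (s, j) = false by rewrite /flow /k33 eqxx.
have outsE s i : #|outs33 (s, i)| = \sum_j flow k33 pt33 c0 c (s, i) (~~ s, j).
  rewrite card_outs split_side; case: s.
    by rewrite [X in X + _]big1 // => j _; rewrite flow_side.
  by rewrite [X in _ + X]big1 ?addn0 // => j _; rewrite flow_side.
have insE s i : #|ins33 (s, i)| = \sum_j flow k33 pt33 c0 c (~~ s, j) (s, i).
  rewrite card_ins split_side; case: s.
    by rewrite [X in X + _]big1 // => j _; rewrite flow_side.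
  by rewrite [X in _ + X]big1 ?addn0 // => j _; rewrite flow_side.
have dist (F : 'I_3 -> nat) : \sum_i 2 * F i = 2 * \sum_i F i by rewrite big_distrr.
rewrite /load33 [LHS]big_split [RHS]big_split !dist; congr (_ + 2 * _).
  under eq_bigr do rewrite outsE; rewrite exchange_big /=.
  by apply: eq_bigr => j _; rewrite insE.
under eq_bigr do rewrite insE; rewrite exchange_big /=.
by apply: eq_bigr => j _; rewrite outsE.
Qed.
End K33.

Lemma cubic_ports (A : finType) (e : rel A) (a : A) : cubic e ->
  exists nb : 'I_3 -> A, injective nb /\ forall j, e a (nb j).
Proof.
move=> cub; exists (fun j => nth a (enum [set y | e a y]) j).
have sz : size (enum [set y | e a y]) = 3 by rewrite -cardE cub.
split=> [i j /eqP|j].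
  by rewrite nth_uniq ?sz ?enum_uniq // => /eqP/val_inj.
have : nth a (enum [set y | e a y]) j \in enum [set y | e a y] by rewrite mem_nth ?sz.
by rewrite mem_enum inE.
Qed.

(** Built directly and not by [at_], which needs a point of the blow-up as its default value. *)
Definition apex (H A : finType) (a : A) (M : {set H}) (h : H) (hM : h \notin M) : blowup a M :=
  exist (fun p => blowup_ok a M p) (h, a) (etrans (okS a a hM) (eqxx a)).

Section K33Load.
Variables (A : finType) (e : rel A) (a : A) (M : {set bool * 'I_3}) (nb : 'I_3 -> A).
Hypotheses (GA : cubic_3conn e) (nb_inj : injective nb) (nbE : forall j, e a (nb j)).
Variable c0 : blowup a M.
Variable c : blowup a M -> blowup a M.
Hypothesis cc : forall u, c (c u) = c u.
Local Notation pt := (pt33 a M nb).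
Local Notation outs33 := (outs k33 pt c0 c).
Local Notation ins33 := (ins k33 pt c0 c).
Let ptS := @pt33S A a M nb.
Let ptM := pt33M nbE (M := M).
Let pt_inj := pt33_inj (a := a) (M := M) nb_inj.

Lemma load_single j : (true, j) \notin M -> good k33 e pt c (true, j) ->
  #|ins33 (true, j)| + 2 * #|outs33 (true, j)| = 2.
Proof.
move=> hM g.
by case: (flow_single k33_cubic_3conn GA ptS ptM c0 cc hM g) => -[-> ->].
Qed.

Lemma load_mod i : (false, i) \in M -> good k33 e pt c (false, i) ->
  load33 nb c0 c i = #|A|.-1 %[mod 3].
Proof.
move=> hM g; have := flow_count k33_cubic_3conn GA ptS ptM pt_inj c0 hM g.
by rewrite /load33; clear; lia.
Qed.
End K33Load.

Lemma z1_f1 : stmt_z1 -> stmt_f1.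
Proof.
move=> z1 A e GA A4 a; have [_ _ cubA _] := GA.
have [nb [nb_inj nbE]] := cubic_ports a cubA.
pose M := [set h : bool * 'I_3 | h.1 == false].
have TM j : (true, j) \notin M by rewrite inE.
have FM i : (false, i) \in M by rewrite inE.
pose c0 := apex a (TM ord0).
have G := rel33_cubic_3conn GA nb_inj nbE c0.
have cM : #|M| = 3 := k33_side false.
have cT : #|blowup a M| %% 6 = 0.
  have := cardsC M; rewrite card_blowup cM card_prod card_bool card_ord; clear - A4; lia.
have [symR _ _ _] := G.
have [c sc] : exists c, star_fun setT (rel33 e (a := a) (M := M) nb) c by apply/has_starP => //; apply: z1.
have cc u : c (c u) = c u := star_fun_idem u sc.
have g h : good k33 e (pt33 a M nb) c h by apply: (good_star sc) => u _; rewrite inE.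
have [i li] : exists i, load33 nb c0 c i = 0.
  case: (pickP (fun i => load33 nb c0 c i == 0)) => [i /eqP li|none]; first by exists i.
  have l3 i : 3 <= load33 nb c0 c i.
    have := load_mod GA nb_inj nbE c0 (FM i) (g _); have := none i; clear - A4; lia.
  have sE : \sum_i load33 nb c0 c i = 6.
    rewrite load33_sum (eq_bigr (fun=> 2)) ?sum_nat_const ?card_ord // => j _.
    exact: (load_single GA nbE c0 cc (TM j) (g _)).
  have : \sum_(i < 3) 3 <= \sum_i load33 nb c0 c i by apply: leq_sum => i _; apply: l3.
  by rewrite sE sum_nat_const card_ord.
apply: (flow_none k33_cubic_3conn GA (@pt33S A a M nb) (pt33M nbE (M := M))
  (c0 := c0) cc (FM i) (g _)).
  by move: li; rewrite /load33; clear; lia.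
by move: li; rewrite /load33; clear; lia.
Qed.

(* K33 with two vertices of one side replaced by copies of [A - a]; the third one is the vertex
   given to (t1) or (t3). *)
Section TwoCopies.
Variables (A : finType) (e : rel A) (a : A) (nb : 'I_3 -> A).
Hypotheses (GA : cubic_3conn e) (A0 : #|A| %% 6 = 0).
Hypotheses (nb_inj : injective nb) (nbE : forall j, e a (nb j)).

Definition pair_set : {set bool * 'I_3} := [set (false, ord0); (false, inord 1)].
Local Notation M := pair_set.
Local Notation i1 := (inord 1 : 'I_3).
Local Notation x2 := (false, inord 2 : 'I_3).

Lemma pairT j : (true, j) \notin M. Proof. by rewrite !inE. Qed.
Lemma pair0 : (false, ord0) \in M. Proof. by rewrite !inE eqxx. Qed.
Lemma pair1 : (false, i1) \in M. Proof. by rewrite !inE eqxx orbT. Qed.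
Lemma pair2 : x2 \notin M.
Proof. by rewrite !inE !xpair_eqE /= -!val_eqE /= !inordK. Qed.

Definition two_apex : blowup a M := apex a pair2.
Local Notation c0 := two_apex.
Local Notation pt := (pt33 a M nb).

Lemma two_G : cubic_3conn (rel33 e (a := a) (M := M) nb).
Proof. exact: (rel33_cubic_3conn GA nb_inj nbE c0). Qed.

Lemma two_card : #|blowup a M| %% 6 = 2.
Proof.
have cM : #|M| = 2.
  by rewrite cards2 xpair_eqE /= -val_eqE /= inordK.
have := cardsC M; rewrite card_blowup cM card_prod card_bool card_ord; clear - A0 GA.
have [_ _ _ [A3 _]] := GA; clear GA; lia.
Qed.

(** The common end of t1 and t3. Both copies have load 2 mod 3, so the bound 4 forces load exactly
    2, as [flow_exact] requires. The two uses differ only in how the bound is reached. *)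
Lemma two_exact (c : blowup a M -> blowup a M) : (forall u, c (c u) = c u) ->
  good k33 e pt c (false, ord0) -> good k33 e pt c (false, i1) ->
  load33 nb c0 c (inord 2) = 0 ->
  \sum_j (#|ins k33 pt c0 c (true, j)| + 2 * #|outs k33 pt c0 c (true, j)|) <= 4 ->
  has_lfactor setT e.
Proof.
move=> cc g0 g1 l2 sum4; rewrite -load33_sum in sum4.
have m0 := load_mod GA nb_inj nbE c0 pair0 g0.
have m1 := load_mod GA nb_inj nbE c0 pair1 g1.
have le4 : load33 nb c0 c ord0 + load33 nb c0 c i1 <= 4.
  apply: leq_trans sum4; rewrite (bigD1 ord0) //= leq_add2l (bigD1 i1) ?leq_addr //.
  by rewrite -val_eqE /= inordK.
have lE : load33 nb c0 c ord0 = 2.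
  by have [_ _ _ [A3 _]] := GA; clear - m0 m1 le4 A3 A0; lia.
exact: (flow_exact k33_cubic_3conn GA (@pt33S A a M nb) (pt33M nbE (M := M))
  (pt33_inj (a := a) (M := M) nb_inj) (c0 := c0) cc pair0 g0 lE).
Qed.

Lemma two_apexE u : co u = x2 -> u = c0.
Proof.
move=> uh; apply: (@blowup_inj _ _ a M) => //.
by apply/eqP; have := ok_co u; rewrite uh okS // pair2.
Qed.

Lemma two_nbr u : rel33 e (a := a) (M := M) nb c0 u -> exists j, co u = (true, j) /\ ve u = a.
Proof.
have G := two_G; move=> r; have ne : co c0 != co u.
  have [_ irr _ _] := G; apply: contraTneq r => /esym/two_apexE->.
  by rewrite irr.
have [k _ _] := crel_out c0 r ne; case uh : (co u) => [s j].
have sE : s = true by move: k; rewrite uh /k33 /=; case: s uh.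
exists j; rewrite -sE; split=> //; apply/eqP.
by have := ok_co u; rewrite uh sE okS // pairT.
Qed.
End TwoCopies.

Lemma t1_z1 : stmt_t1 -> stmt_z1.
Proof.
move=> t1 A e GA A0; have [_ _ cubA [A3 _]] := GA.
have [a _] : exists a : A, a \in A by apply/card_gt0P; apply: leq_trans A3.
have [nb [nb_inj nbE]] := cubic_ports a cubA.
have G := two_G GA nb_inj nbE; have [symR _ _ _] := G.
have [y [xy]] := t1 _ _ G (two_card a GA A0) (two_apex a).
have [j0 [yh yv]] := two_nbr GA nb_inj nbE xy.
case/has_starP=> // c sc.
have cc u : c (c u) = c u := star_fun_idem u sc.
have g h : h != (false, inord 2) -> h != (true, j0) -> good k33 e (pt33 a (pair_set) nb) c h.
  move=> h2 hj; apply: (good_star sc) => u uh; rewrite !inE negb_or.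
  by apply/andP; split; [apply: contra_neq h2 => uE|apply: contra_neq hj => uE]; rewrite -uh uE.
have at0 : at_ (two_apex a) (false, inord 2) a = two_apex a by apply: two_apexE; rewrite co_at // okS // pair2.
have aty : at_ (two_apex a) (true, j0) a = y by apply: at_eq.
have dead h : h \notin pair_set -> at_ (two_apex a) h a \notin ~: [set two_apex a; y] ->
  #|outs k33 (pt33 a pair_set nb) (two_apex a) c h| = 0 /\ #|ins k33 (pt33 a pair_set nb) (two_apex a) c h| = 0.
  exact: (dead_single k33_cubic_3conn GA (@pt33S A a pair_set nb) (pt33M nbE (M := pair_set)) sc).
apply: (two_exact GA A0 nb_inj nbE cc).
- by apply: g; rewrite // xpair_eqE /= -val_eqE /= inordK.
- by apply: g; rewrite // xpair_eqE /= -val_eqE /= !inordK.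
- have [|o0 i0] := dead _ pair2; first by rewrite at0 !inE eqxx.
  by rewrite /load33 o0 i0.
(* The deleted neighbour of the apex contributes nothing and the other two vertices of its side
   contribute 2 each. *)
rewrite (bigD1 j0) //=; have [|-> ->] := dead _ (pairT j0).
  by rewrite aty !inE eqxx orbT.
rewrite add0n; apply: (leq_trans (n := \sum_(j < 3 | j != j0) 2)); last first.
  by rewrite sum_nat_const (cardC1 j0) card_ord.
apply: leq_sum => j jj; rewrite (load_single GA nbE) ?pairT //.
by apply: g; rewrite // xpair_eqE.
Qed.

Lemma t3_z1 : stmt_t3 -> stmt_z1.
Proof.
move=> t3 A e GA A0; have [_ _ cubA [A3 _]] := GA.
have [a _] : exists a : A, a \in A by apply/card_gt0P; apply: leq_trans A3.
have [nb [nb_inj nbE]] := cubic_ports a cubA.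
have G := two_G GA nb_inj nbE; have [symR irrR _ _] := G.
set x := two_apex a.
have [W [pW sW nW]] := t3 _ _ G (two_card a GA A0) x.
case: W pW sW nW => [|w0 [|w1 [|w2 [|w3 [|w4 []]]]]] //= /andP[uW] /and5P[r01 r1x rx3 r34 _] _ xE.
subst w2; rewrite symR in r1x.
have [j1 [h1 v1]] := two_nbr GA nb_inj nbE r1x.
have [j3 [h3 v3]] := two_nbr GA nb_inj nbE rx3.
move: uW; rewrite !inE !negb_or => /and4P[/and4P[n01 n0x n03 n04] /and3P[n1x n13 n14] /andP[nx3 nx4]].
rewrite andbT => n34.
have j13 : j1 != j3.
  by apply: contraNneq n13 => jE; apply/eqP/(@blowup_inj _ _ a pair_set); rewrite ?h1 ?h3 ?jE // v1 v3.
case/has_starP=> // c sc.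
set V := ~: _ in sc.
have VE u : (u \in V) = (u \notin [:: w0; w1; x; w3; w4]) by rewrite !inE.
(* The outer vertices [w0] and [w4] may lie in the copies, where their absence would spoil the
   count. They are returned as if centred at [w1] and [w3]; these are unreplaced vertices, so the
   copies become complete and their own fibres keep size 3. *)
pose c' u := if u == w0 then w1 else if u == w4 then w3 else c u.
have cV u : u \notin V -> c u = u := sc.1 u.
have outV u : u \notin V -> [\/ u = w0, u = w4 | [/\ c' u = u & u \in [:: w1; x; w3]]].
  rewrite VE negbK !inE => uW.
  have cuu : c u = u by apply: cV; rewrite VE negbK !inE.
  rewrite /c' cuu; case: (eqVneq u w0) uW => [|_] /=; first by constructor 1.
  case: (eqVneq u w4) => [|_] /=; first by constructor 2.
  by rewrite orbF; constructor 3.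
have c0E : c' w0 = w1 by rewrite /c' eqxx.
have c4E : c' w4 = w3 by rewrite /c' eq_sym (negPf n04) eqxx.
have c1E : c' w1 = w1 by rewrite /c' eq_sym (negPf n01) (negPf n14) cV // VE negbK !inE eqxx orbT.
have c3E : c' w3 = w3 by rewrite /c' eq_sym (negPf n03) (negPf n34) cV // VE negbK !inE eqxx !orbT.
have cxE : c' x = x by rewrite /c' eq_sym (negPf n0x) (negPf nx4) cV // VE negbK !inE eqxx !orbT.
have inV : {in V, c' =1 c}.
  by move=> u; rewrite VE !inE !negb_or /c' => /and5P[/negPf-> _ _ _ /negPf->].
have cc u : c' (c' u) = c' u.
  case: (boolP (u \in V)) => uV; first by rewrite !(inV u uV) inV ?(star_fun_in _ sc) // (star_fun_idem _ sc).
  by case: (outV u uV) => [->|->|[uE _]]; [rewrite c0E|rewrite c4E|rewrite !uE].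
have g h : h != (false, inord 2) -> h != (true, j1) -> h != (true, j3) ->
    good k33 e (pt33 a pair_set nb) c' h.
  move=> k2 k1 k3; apply: (good_star_ext sc inV) => u uV.
  have D1 : w1 \notin V by rewrite VE negbK !inE eqxx orbT.
  have D3 : w3 \notin V by rewrite VE negbK !inE eqxx !orbT.
  case: (outV u uV) => [->|->|[-> uw]].
  - by rewrite c0E h1 eq_sym k1 D1; split.
  - by rewrite c4E h3 eq_sym k3 D3; split=> // _; have := r34; rewrite symR.
  rewrite uV eqxx; split=> //; move: uw; rewrite !inE => /or3P[]/eqP->; rewrite ?h1 ?h3 eq_sym //.
have at1 : at_ x (true, j1) a = w1 by apply: at_eq.
have at3 : at_ x (true, j3) a = w3 by apply: at_eq.
have atx : at_ x (false, inord 2) a = x by apply: two_apexE; rewrite co_at // okS // pair2.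
have okp h h' : k33 h h' -> blowup_ok a pair_set (h, pt33 a pair_set nb h h').
  exact: (ok_pt GA (@pt33S A a pair_set nb) (pt33M nbE (M := pair_set))).
have dead h z : h \notin pair_set -> at_ x h a = z -> c' z = z ->
    (forall w, (forall u, c' u = z -> u = w \/ u = z) ->
      #|ins k33 (pt33 a pair_set nb) x c' h| <= 1) /\
    ((forall u, c' u = z -> u = z) -> #|ins k33 (pt33 a pair_set nb) x c' h| = 0) /\
    #|outs k33 (pt33 a pair_set nb) x c' h| = 0.
  move=> hM atz cz; have ptz h' : pt33 a pair_set nb h h' = a by apply: pt33S.
  have noz h' : k33 h' h -> at_ x h' (pt33 a pair_set nb h' h) <> z.
    move=> hh; rewrite -atz => /(congr1 (@co _ _ _ _)); rewrite !co_at ?okp //; last by rewrite okS.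
    by move=> hE; rewrite hE /k33 eqxx in hh.
  split; last split.
  - move=> w uw; apply: leq_trans (eq_leq (cards1 (co w))); apply: subset_leq_card; apply/subsetP => h'.
    rewrite !inE => /andP[hh /eqP]; rewrite ptz atz => /uw[wE|/(noz _ hh)//].
    by rewrite -wE co_at ?okp.
  - move=> uw; apply: eq_card0 => h'; rewrite !inE; apply/negP => /andP[hh /eqP].
    by rewrite ptz atz => /uw/(noz _ hh).
  apply: eq_card0 => h'; rewrite !inE; apply/negP => /andP[hh /eqP].
  by rewrite ptz atz cz => /esym/noz; apply; rewrite /k33 eq_sym.
have onto u z : z \notin V -> c' u = z -> [\/ u = w0 /\ z = w1, u = w4 /\ z = w3 | u = z].
  move=> zV cz; case: (boolP (u \in V)) => uV.
    by rewrite inV // in cz; rewrite -cz (star_fun_in _ sc) uV in zV.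
  case: (outV u uV) => [uE|uE|[uE _]].
  - by constructor 1; rewrite -cz uE c0E.
  - by constructor 2; rewrite -cz uE c4E.
  by constructor 3; rewrite -cz uE.
(* The artificial centre [w1] receives at most the crossing from [w0], so it weighs at most 1 where
   an intact vertex weighs 2. With [w3] likewise, the side totals at most 1 + 1 + 2 = 4. *)
have dead1 : #|ins k33 (pt33 a pair_set nb) x c' (true, j1)| + 2 * #|outs k33 (pt33 a pair_set nb) x c' (true, j1)| <= 1.
  have [/(_ w0) i1 [_ o1]] := dead _ _ (pairT j1) at1 c1E.
  rewrite o1 muln0 addn0; apply: i1 => u cu.
  case: (@onto u w1 _ cu) => [|[->]|[_ w13]|->]; [by rewrite VE negbK !inE eqxx orbT|by left| |by right].
  by rewrite w13 eqxx in n13.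
have dead3 : #|ins k33 (pt33 a pair_set nb) x c' (true, j3)| + 2 * #|outs k33 (pt33 a pair_set nb) x c' (true, j3)| <= 1.
  have [/(_ w4) i3 [_ o3]] := dead _ _ (pairT j3) at3 c3E.
  rewrite o3 muln0 addn0; apply: i3 => u cu.
  case: (@onto u w3 _ cu) => [|[_ w31]|[-> _]|->]; [by rewrite VE negbK !inE eqxx !orbT| |by left|by right].
  by rewrite w31 eqxx in n13.
apply: (two_exact GA A0 nb_inj nbE cc).
- by apply: g; rewrite // xpair_eqE /= -val_eqE /= inordK.
- by apply: g; rewrite // xpair_eqE /= -val_eqE /= !inordK.
- have [_ [i2 o2]] := dead _ _ pair2 atx cxE; rewrite /load33 o2 i2 // => u cu.
  case: (@onto u x _ cu) => [|[_ xw]|[_ xw]|//]; first by rewrite VE negbK !inE eqxx !orbT.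
    by rewrite xw eqxx in n1x.
  by rewrite xw eqxx in nx3.
rewrite (bigD1 j1) //= (bigD1 j3) 1?eq_sym //=.
apply: (@leq_trans (1 + (1 + \sum_(j < 3 | (j != j1) && (j != j3)) 2))).
  rewrite leq_add // leq_add //; apply: leq_sum => j /andP[jj1 jj3].
  by rewrite (load_single GA nbE) ?pairT //; apply: g; rewrite // xpair_eqE.
have : \sum_(j < 3) 2 = 6 by rewrite sum_nat_const card_ord.
by rewrite (bigD1 j1) //= (bigD1 j3) 1?eq_sym //= => -[]; rewrite add0n => ->.
Qed.

(* K4 with three of its vertices replaced by copies of [A - a]; the edges from the copies to the
   fourth vertex [None] all use the neighbour [y2] of [a]. *)
Section K4.
Variables (A : finType) (e : rel A) (a y0 y1 y2 : A).
Hypotheses (GA : cubic_3conn e) (A0 : #|A| %% 6 = 0).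
Hypotheses (e0 : e a y0) (e1 : e a y1) (e2 : e a y2).
Hypotheses (n01 : y0 != y1) (n02 : y0 != y2) (n12 : y1 != y2).

Definition some_set : {set option 'I_3} := [set h | h != None].
Local Notation M := some_set.

(** The three copies are joined cyclically: each uses [y0] towards the next and [y1] towards the
    previous one. By this symmetry the conclusion is the same whichever copy turns out to be the
    suitable one. *)
Definition pt4 (h h' : option 'I_3) : A :=
  match h, h' with
  | None, _ => a
  | Some i, None => y2
  | Some i, Some j => if val j == i.+1 %% 3 then y0 else y1
  end.

Lemma pt4S h h' : h \notin M -> pt4 h h' = a.
Proof. by rewrite inE negbK => /eqP->. Qed.

Lemma pt4M h h' : h \in M -> k4 h h' -> e a (pt4 h h').
Proof. by rewrite inE; case: h h' => [i|//] [j|] //= _ _; case: ifP. Qed.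

Lemma pt4_inj h h1 h2 : h \in M -> k4 h h1 -> k4 h h2 -> pt4 h h1 = pt4 h h2 -> h1 = h2.
Proof.
rewrite inE /k4; case: h h1 h2 => [i|//] [j|] [k|] //= _ ij ik; last first.
- by case: ifP => _ E; move: n12 n02; rewrite E eqxx.
- by case: ifP => _ E; move: n12 n02; rewrite -E eqxx.
have {}ij : val i != val j by apply: contraNneq ij => /val_inj->.
have {}ik : val i != val k by apply: contraNneq ik => /val_inj->.
case: eqP => jE; case: eqP => kE E; try by move: n01; rewrite E eqxx.
  by congr Some; apply: val_inj; rewrite /= jE kE.
congr Some; apply: val_inj => /=; move: (ltn_ord i) (ltn_ord j) (ltn_ord k) ij ik jE kE => /=.
by clear; lia.
Qed.

Lemma some_setN : None \notin M. Proof. by rewrite inE. Qed.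

Definition k4_apex : blowup a M := apex a some_setN.
Local Notation c0 := k4_apex.
Definition rel4 : rel (blowup a M) := crel k4 e pt4.

Lemma rel4_cubic_3conn : cubic_3conn rel4.
Proof. exact: (crel_cubic_3conn k4_cubic_3conn GA pt4S pt4M pt4_inj c0). Qed.

Lemma k4_card : #|blowup a M| %% 6 = 4.
Proof.
have cM : #|M| = 3.
  rewrite (_ : M = ~: [set None]) ?cardsC1 ?card_option ?card_ord //.
  by apply/setP=> h; rewrite !inE.
have := cardsC M; rewrite card_blowup cM card_option card_ord; clear - A0 GA.
have [_ _ _ [A3 _]] := GA; clear GA; lia.
Qed.

Lemma k4_apexE u : co u = None -> u = c0.
Proof.
move=> uh; apply: (@blowup_inj _ _ a M) => //.
by apply/eqP; have := ok_co u; rewrite uh okS // inE.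
Qed.

(** With the apex deleted only two frame edges at the copy can carry crossings, so outs + ins is at
    most 2, while outs - ins is 2 mod 3. Both solutions satisfy outs + 2 ins = 2. *)
Lemma k4_piece V c k : star_fun V rel4 c -> c0 \notin V -> good k4 e pt4 c (Some k) ->
  let o := outs k4 pt4 c0 c (Some k) in let i := ins k4 pt4 c0 c (Some k) in
  o \subset ~: [set None; Some k] /\ (#|o| = 2 /\ #|i| = 0 \/ #|o| = 0 /\ #|i| = 1).
Proof.
move=> sc xV g o i; have cc u : c (c u) = c u := star_fun_idem u sc.
have kM : Some k \in M by rewrite inE.
have at0 : at_ c0 None a = c0 by apply: k4_apexE; rewrite co_at // okS // inE.
have dead : flow k4 pt4 c0 c None (Some k) = false /\ flow k4 pt4 c0 c (Some k) None = false.
  by apply: (dead_flow k4_cubic_3conn GA pt4S pt4M sc) => //=; rewrite at0.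
have oS : o \subset ~: [set None; Some k].
  apply/subsetP=> h; rewrite !inE negb_or => fl; apply/andP; split.
    by apply: contraTneq fl => ->; rewrite dead.2.
  by apply: contraTneq fl => ->; rewrite /flow /k4 eqxx.
have iS : i \subset ~: [set None; Some k].
  apply/subsetP=> h; rewrite !inE negb_or => fl; apply/andP; split.
    by apply: contraTneq fl => ->; rewrite dead.1.
  by apply: contraTneq fl => ->; rewrite /flow /k4 eqxx.
have dis : [disjoint o & i].
  rewrite -setI_eq0; apply/eqP/setP=> h; rewrite !inE; apply/negP => /andP[fl fl'].
  exact: (flow_asym k4_cubic_3conn GA pt4S pt4M cc fl fl').
have oi2 : #|o| + #|i| <= 2.
  have oiE : #|o :|: i| = #|o| + #|i| by rewrite cardsU (disjoint_setI0 dis) cards0 subn0.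
  rewrite -oiE; apply: leq_trans (subset_leq_card (_ : _ \subset ~: [set None; Some k])) _.
    by rewrite subUset oS iS.
  by rewrite cardsCs setCK cards2 card_option card_ord.
have cnt : #|A|.-1 + #|i| = #|o| %[mod 3] := flow_count k4_cubic_3conn GA pt4S pt4M pt4_inj c0 kM g.
split=> //; have [_ _ _ [A3 _]] := GA.
by move: oi2 cnt; clear - A3 A0; lia.
Qed.

(* Exactly one of the three copies is entered from both others: that is the wanted one. *)
Lemma k4_middle : has_lfactor (~: [set c0]) rel4 -> has_lfactor (~: [set y0; a; y1]) e.
Proof.
have [symR _ _ _] := rel4_cubic_3conn.
case/has_starP=> // c sc; have cc u : c (c u) = c u := star_fun_idem u sc.
have xV : c0 \notin ~: [set c0] by rewrite !inE eqxx.
have g k : good k4 e pt4 c (Some k).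
  by apply: (good_star sc) => u uh; rewrite !inE; apply/eqP => uE; rewrite uE in uh.
(* If copy 0 does not qualify, it has one in-crossing. The copy from which this comes has an
   out-crossing, hence two by [k4_piece]. *)
have [k [o2 i0]] : exists k, #|outs k4 pt4 c0 c (Some k)| = 2 /\ #|ins k4 pt4 c0 c (Some k)| = 0.
  have [oS [o2|[o0 i1]]] := k4_piece sc xV (g ord0); first by exists ord0.
  have /eqP/cards1P[h hE] := i1.
  have fl : flow k4 pt4 c0 c h (Some ord0) by have := set11 h; rewrite -hE inE.
  have hk : exists k, h = Some k.
    case: h {hE} fl => [k _|fl]; first by exists k.
    have at0 : at_ c0 None a = c0 by apply: k4_apexE; rewrite co_at // okS // inE.
    have hV : at_ c0 None (pt4 None (Some ord0)) \notin ~: [set c0] by rewrite /= at0.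
    by have [] := dead_flow k4_cubic_3conn GA pt4S pt4M sc hV isT; rewrite fl.
  case: hk fl => k -> fl; exists k.
  have [_ [//|[/eqP]]] := k4_piece sc xV (g k).
  by rewrite cards_eq0 => /eqP/setP/(_ (Some ord0)); rewrite !inE fl.
have kM : Some k \in M by rewrite inE.
have [oS _] := k4_piece sc xV (g k).
have /eqP/cards2P[h1 [h2 [h12 oE]]] := o2.
have fac := flow_out2 k4_cubic_3conn GA pt4S pt4M cc kM (g k) oE i0.
rewrite oE in oS.
have ok h : h \in [set h1; h2] -> k4 (Some k) h /\ (pt4 (Some k) h = y0 \/ pt4 (Some k) h = y1).
  move/(subsetP oS); rewrite !inE negb_or; case: h => [j|] //= kj; rewrite /k4 eq_sym; split=> //.
  by case: ifP; auto.
have [k1 p1] := ok h1 (set21 _ _); have [k2 p2] := ok h2 (set22 _ _).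
have ne : pt4 (Some k) h1 <> pt4 (Some k) h2.
  by move/(pt4_inj kM k1 k2) => hE; rewrite hE eqxx in h12.
apply: lfactor_eq fac; congr (~: _); apply/setP=> z; rewrite !inE.
case: p1 p2 ne => -> [] -> // _.
by case: (z == y0); case: (z == a); case: (z == y1).
Qed.

(** With the apex as an inner vertex, [Z] meets only two of the copies: one vertex on one side of
    the apex, two vertices of a single copy on the other. The third copy is intact and [k4_piece]
    applies to it. *)
Lemma k4_exact Z : gpath rel4 Z -> size Z = 4 -> nth c0 Z 1 = c0 \/ nth c0 Z 2 = c0 ->
  has_lfactor (~: [set y in Z]) rel4 -> has_lfactor setT e.
Proof.
have G := rel4_cubic_3conn; have [symR irrR _ _] := G.
move=> pZ sZ nZ fac.
have [z0 [z1 [z2 [r0 r1 r2 [n0 n1 ZE]]]]] : exists z0 z1 z2,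
    [/\ rel4 c0 z0, rel4 c0 z1, rel4 z1 z2 &
    [/\ z0 != z1, z2 != c0 & forall u, (u \in Z) = (u \in [:: z0; c0; z1; z2])]].
  case: Z pZ sZ nZ {fac} => [|z0 [|z1 [|z2 [|z3 []]]]] //= /andP[] + /and4P[r01 r12 r23 _] _.
  rewrite !inE !negb_or => /and4P[/and3P[n01' n02' n03] /andP[n12' n13] n23 _] [zE|zE].
    subst z1; exists z0, z2, z3; split=> //; first by rewrite symR.
    by split=> //; rewrite eq_sym.
  subst z2; exists z3, z1, z0; split; rewrite // 1?symR //; split=> //.
    by rewrite eq_sym.
  by move=> u; rewrite !inE; do 4!case: (u == _).
have nb u : rel4 c0 u -> exists i, co u = Some i /\ u = at_ c0 (Some i) y2.
  move=> r; have ne : co c0 != co u.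
    by apply: contraTneq r => /esym/k4_apexE->; rewrite irrR.
  have [k _] := crel_out c0 r ne; case uh : (co u) => [i|] uE; first by exists i.
  by rewrite uh eqxx in ne.
have [i0 [h0 u0]] := nb _ r0; have [i1 [h1 u1]] := nb _ r1.
have i01 : i0 != i1 by apply: contraNneq n0 => iE; rewrite u0 u1 iE.
(* [z1] is the port towards the apex, whose only neighbour outside its copy is the apex itself; so
   the path continues within the copy. *)
have h2 : co z2 = Some i1.
  apply/eqP/negPn/negP => ne.
  have [] := crel_out c0 r2; rewrite h1 1?eq_sym // => kk uE _.
  have okp h h' : k4 h h' -> blowup_ok a M (h, pt4 h h') := ok_pt GA pt4S pt4M (h := h) (h' := h').
  have : pt4 (Some i1) None = pt4 (Some i1) (co z2).
    have := congr1 (@ve _ _ _ _) (etrans (esym u1) uE).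
    by rewrite !ve_at ?okp // -[y2]/(pt4 (Some i1) None) okp.
  move/pt4_inj; rewrite inE /= => /(_ isT isT kk)/esym/k4_apexE z2E.
  by rewrite z2E eqxx in n1.
have [k k01] : exists k, k \notin [:: i0; i1].
  have /subsetPn[k _ kP] : ~~ ([set: 'I_3] \subset [:: i0; i1]).
    by apply/negP => /subset_leq_card; rewrite cardsT card_ord => h; have := leq_trans h (card_size _).
  by exists k.
case/has_starP: fac => // c sc; have cc u : c (c u) = c u := star_fun_idem u sc.
have xV : c0 \notin ~: [set y in Z] by rewrite !inE negbK ZE !inE eqxx orbT.
have g : good k4 e pt4 c (Some k).
  apply: (good_star sc) => u uh; rewrite !inE ZE !inE; move: k01; rewrite !inE.
  apply: contra => /or4P[]/eqP uE; move: uh; rewrite uE ?h0 ?h1 ?h2 //.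
  - by move=> [->]; rewrite eqxx.
  - by move=> [->]; rewrite eqxx orbT.
  - by move=> [->]; rewrite eqxx orbT.
have kM : Some k \in M by rewrite inE.
apply: (flow_exact k4_cubic_3conn GA pt4S pt4M pt4_inj cc kM g (c0 := c0)).
by have [_ [[-> ->]|[-> ->]]] := k4_piece sc xV g.
Qed.
End K4.

Lemma f1_z8 : stmt_f1 -> stmt_z8.
Proof.
move=> f1 A e GA A0 L pL sL; have [symA irrA cubA _] := GA.
case: L pL sL => [|y0 [|a [|y1 []]]] //= /andP[]; rewrite !inE !negb_or !andbT.
move=> /andP[/andP[n0a n01] na1] /andP[e0 e1] _.
have [u [w [eu ew /and3P[u1 w1 uw] N]]] := cubic_nbrs cubA e1.
rewrite symA in e0.
have [y2 [e2 /andP[n02 n12]]] : exists y2, e a y2 /\ (y0 != y2) && (y1 != y2).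
  have := e0; rewrite N !inE (negPf n01) /= => /orP[]/eqP y0E.
    by exists w; rewrite y0E uw eq_sym w1.
  by exists u; rewrite y0E eq_sym uw eq_sym u1.
apply: (@lfactor_eq _ (~: [set y0; a; y1])).
  by apply/setP=> z; rewrite !inE -orbA.
apply: (k4_middle GA A0 e0 e1 e2 n01 n02 n12).
by apply: f1; [exact: rel4_cubic_3conn|exact: (k4_card _ GA)].
Qed.

Lemma f3_z1 : stmt_f3 -> stmt_z1.
Proof.
move=> f3 A e GA A0; have [_ _ cubA [A3 _]] := GA.
have [a _] : exists a : A, a \in A by apply/card_gt0P; apply: leq_trans A3.
have [nb [nb_inj nbE]] := cubic_ports a cubA.
have n i j : i != j -> nb i != nb j by apply: contra_neq => /nb_inj.
have n01 := n ord0 (inord 1) ltac:(by rewrite -val_eqE /= inordK).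
have n02 := n ord0 (inord 2) ltac:(by rewrite -val_eqE /= inordK).
have n12 := n (inord 1) (inord 2) ltac:(by rewrite -val_eqE /= !inordK).
have [Z [pZ sZ nZ fac]] := f3 _ _ (rel4_cubic_3conn GA (nbE _) (nbE _) (nbE _) n01 n02 n12)
  (k4_card a GA A0) (k4_apex a).
exact: (k4_exact GA A0 (nbE _) (nbE _) (nbE _) n01 n02 n12 pZ sZ nZ fac).
Qed.

(** * Contracting a side of a 3-edge cut *)

(** The 3|T| ordered adjacent pairs fall into increasing and decreasing ones with respect to a
    ranking of the vertices, and reversal matches the two kinds. *)
Lemma cubic_even (T : finType) (e : rel T) : symmetric e -> irreflexive e -> cubic e -> ~~ odd #|T|.
Proof.
move=> symE irrE cub.
pose P := [set xy : T * T | e xy.1 xy.2].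
have cP : #|P| = #|T| * 3.
  rewrite -sum1dep_card -(pair_big_dep xpredT (fun x y => e x y) (fun _ _ => 1)) /=.
  by rewrite -sum_nat_const; apply: eq_bigr => x _; rewrite sum1dep_card cub.
pose r (x : T) := val (enum_rank x).
pose Q := [set xy in P | r xy.1 < r xy.2].
have sE : P :\: Q = (fun xy => (xy.2, xy.1)) @: Q.
  apply/setP=> -[x y]; rewrite !inE /=; apply/andP/imsetP => [[nq exy]|[[x' y']]].
    exists (y, x) => //; rewrite !inE /= symE exy /=.
    move: nq; rewrite exy /= -leqNgt leq_eqVlt => /orP[/eqP/val_inj/enum_rank_inj yx|//].
    by rewrite yx irrE in exy.
  rewrite !inE /= => /andP[exy lt] [-> ->]; rewrite symE exy; split=> //=.
  by rewrite -leqNgt ltnW.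
have : #|P| = #|Q| + #|Q|.
  rewrite -[LHS](cardsID Q) (setIidPr _); last by apply/subsetP=> xy; rewrite !inE => /andP[].
  by rewrite sE card_imset // => -[x y] [x' y'] [-> ->].
by rewrite cP => E; apply/negP => o; have := congr1 odd E; rewrite oddM o oddD addbb.
Qed.

Lemma star_union_ex (T : finType) (V1 V2 : {set T}) (E : rel T) c1 c2 : [disjoint V1 & V2] ->
  star_fun V1 E c1 -> star_fun V2 E c2 ->
  exists c, [/\ star_fun (V1 :|: V2) E c, {in V1, c =1 c1} & {in V2, c =1 c2}].
Proof.
move=> dis s1 s2; exists (c1 \o c2); split; first exact: star_union.
  by move=> v vV /=; rewrite (s2.1 v) // (disjointFr dis).
by move=> v vV /=; rewrite s1.1 // (disjointFl dis) // (star_fun_in _ s2).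
Qed.

Section Cut.
Variables (T : finType) (e : rel T).
Hypothesis G : cubic_3conn e.
Let symE : symmetric e. Proof. by case: G. Qed.
Let irrE : irreflexive e. Proof. by case: G. Qed.

(** The cut edges oriented out of [X], so that the end on either side can be named. *)
Definition cpairs (X : {set T}) : {set T * T} :=
  [set pq : T * T | [&& pq.1 \in X, pq.2 \notin X & e pq.1 pq.2]].

Definition edge_of (pq : T * T) : {set T} := [set pq.1; pq.2].

Lemma edge_of_inj X : {in cpairs X &, injective edge_of}.
Proof.
move=> [p q] [p' q']; rewrite !inE /= => /and3P[pX qX _] /and3P[p'X q'X _] /eqP.
rewrite /edge_of /= set2_eq => /orP[]/andP[/eqP pE /eqP qE]; first by rewrite pE qE.
by rewrite -pE pX in q'X.
Qed.

Lemma cutE X : cut e X = edge_of @: cpairs X.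
Proof.
apply/setP=> A; apply/idP/imsetP => [|[[p q]]].
  rewrite inE => /andP[/edge_setP[x [y [exy ->]]]].
  have xy : x != y by apply: cubic_irr exy.
  have I2 : [set x; y] :&: X = [set z in [:: x; y] | z \in X].
    by apply/setP=> z; rewrite !inE.
  case: (boolP (x \in X)) => xX; case: (boolP (y \in X)) => yX.
  - rewrite (_ : _ :&: _ = [set x; y]) ?cards2 ?xy //.
    by apply/setIidPl/subsetP=> z; rewrite !inE => /orP[]/eqP->.
  - by move=> _; exists (x, y); rewrite // inE /= xX yX.
  - by move=> _; exists (y, x); rewrite ?inE /= ?xX ?yX 1?symE // /edge_of setUC.
  - rewrite (_ : _ :&: _ = set0) ?cards0 //.
    by apply/setP=> z; rewrite !inE; case: eqVneq => [->|_]; case: eqVneq => [->|_] //=;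
      rewrite ?(negPf xX) ?(negPf yX).
rewrite inE /= => /and3P[pX qX epq] ->; rewrite inE edge_set2 // epq /=.
rewrite (_ : _ :&: _ = [set p]) ?cards1 //.
apply/setP=> z; rewrite !inE /=; case: eqVneq => [->|_] //=.
by case: eqVneq => [->|]; rewrite ?(negPf qX).
Qed.

Lemma card_cut X : #|cut e X| = #|cpairs X|.
Proof. by rewrite cutE card_in_imset //; apply: edge_of_inj. Qed.

Section Side.
Variable X : {set T}.
Hypotheses (C3 : #|cpairs X| = 3) (X2 : 1 < #|X|) (Y1 : X != setT).

(** If at most one cut edge could be reached from u within [X] minus [s], deleting that edge and [s]
    would separate u from the complement of [X], although 3-connectedness survives as
    2-connectedness after losing one edge. *)
Lemma two_exits (s : {set T}) u : s \subset X -> #|s| < 2 -> u \in X :\: s ->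
  1 < #|[set pq in cpairs X | connect (on_rel (X :\: s) e) u pq.1]|.
Proof.
move=> sX s2 uX; set K := [set _ in _ | _]; rewrite ltnNge; apply/negP => K1.
have [_ _ _ [T3 conn]] := G.
have [y _ yX] : exists2 y, y \in [set: T] & y \notin X by apply/subsetPn; rewrite subTset.
have ys : y \notin s by apply: contra yX; apply: (subsetP sX).
have us : u \notin s by move: uX; rewrite inE => /andP[].
have [p [q [pq KE]]] : exists p q, p != q /\ K \subset [set (p, q)].
  move: K1; rewrite leq_eqVlt ltnS leqn0 cards_eq0 => /orP[/cards1P[[p q] KE]|/eqP->].
    exists p, q; rewrite KE; split=> //.
    have : (p, q) \in K by rewrite KE inE.
    by rewrite !inE /= => /andP[/and3P[pX qX _] _]; apply: contraNneq qX => <-.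
  (* With no reachable cut edge, any pair of distinct vertices serves as the edge to delete. *)
  by exists u, y; rewrite sub0set; split=> //; apply: contraNneq yX => <-; move: uX; rewrite inE => /andP[].
have := kconn_del (b := q) symE pq T3 conn.
have T3' : 3 <= #|T| by apply: ltnW.
move=> /(_ s s2 u y); rewrite !inE => /(_ us ys) /connectP[pth].
have : connect (on_rel (X :\: s) e) u u by apply: connect0.
have : u \in X by move: uX; rewrite inE => /andP[].
elim: pth {-2}u => [|w pth IH] v vX uv /=; first by move=> _ yv; rewrite yv vX in yX.
rewrite !in_setC => /andP[/and3P[vs ws /andP[evw]]]; rewrite inE => nvw pw yE.
case: (boolP (w \in X)) => wX.
  apply: (IH w wX _ pw yE); apply: connect_trans uv _; apply: connect1.
  by rewrite /on_rel /= !inE vs ws vX wX.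
have : (v, w) \in K by rewrite !inE /= vX wX evw.
move/(subsetP KE); rewrite inE => /eqP[vE wE].
by rewrite vE wE eqxx in nvw.
Qed.

(** If two cut edges shared the end p, then after deleting p only the third one could still be
    reached from the rest of [X], against [two_exits]. *)
Lemma cpairs_fst_inj : {in cpairs X &, injective fst}.
Proof.
move=> [p q] [p' q'] pqC pq'C /= pE; subst p'; congr (_, _); apply/eqP/negPn/negP => qq.
have pX : p \in X by move: pqC; rewrite inE => /and3P[].
have [u] : exists u, u \in X :\ p.
  by apply/set0Pn; rewrite -card_gt0; move: X2; rewrite (cardsD1 p) pX.
rewrite -[X :\ p]/(X :\: [set p]) => uX.
have := two_exits _ _ uX; rewrite cards1 sub1set pX => /(_ isT isT).
rewrite ltnNge; apply/negP; rewrite negbK.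
have sub : [set pq in cpairs X | connect (on_rel (X :\: [set p]) e) u pq.1] \subset
    cpairs X :\: [set (p, q); (p, q')].
  apply/subsetP=> -[a b]; rewrite inE => /andP[abC con]; rewrite inE abC andbT.
  have ap : a != p.
    apply/eqP => ap; rewrite /= ap in con.
    have [pE|] := eqVneq u p; first by rewrite pE !inE eqxx in uX.
    case/connectP: con => pth; elim/last_ind: pth => [|pth z _]; first by move=> _ ->; rewrite eqxx.
    rewrite rcons_path last_rcons => /andP[_] + pz; rewrite -pz /on_rel /= !inE eqxx.
    by rewrite andbF.
  by rewrite !inE !xpair_eqE (negPf ap).
apply: leq_trans (subset_leq_card sub) _.
have -> : 1 = #|cpairs X| - #|[set (p, q); (p, q')]| by rewrite C3 cards2 xpair_eqE eqxx qq.
rewrite cardsD leq_sub2l //; apply: subset_leq_card; apply/subsetP=> z zE; rewrite inE zE andbT.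
by move: zE; rewrite !inE => /orP[]/eqP->; [move: pqC|move: pq'C]; rewrite inE.
Qed.

Definition sideT : finType := ({x : T | x \in X} + unit)%type.

Definition bdry (x : T) := [exists q, (q \notin X) && e x q].

Definition side_rel : rel sideT := fun u v =>
  match u, v with
  | inl x, inl y => e (val x) (val y)
  | inl x, inr _ => bdry (val x)
  | inr _, inl x => bdry (val x)
  | inr _, inr _ => false
  end.

Definition proj (x : T) : sideT := if insub x is Some y then inl y else inr tt.

Lemma proj_in x (xX : x \in X) : proj x = inl (Sub x xX).
Proof. by rewrite /proj insubT. Qed.

Lemma proj_out x : x \notin X -> proj x = inr tt.
Proof. by move=> xX; rewrite /proj insubN. Qed.

Lemma proj_val (y : {x : T | x \in X}) : proj (val y) = inl y.
Proof. by rewrite /proj valK. Qed.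

Lemma proj_inj : {in X &, injective proj}.
Proof. by move=> x y xX yX; rewrite !proj_in => -[]. Qed.

Lemma side_relE x y : x \in X -> y \in X -> side_rel (proj x) (proj y) = e x y.
Proof. by move=> xX yX; rewrite !proj_in. Qed.

Lemma side_rel_root x : x \in X -> side_rel (proj x) (inr tt) = bdry x.
Proof. by move=> xX; rewrite proj_in. Qed.

Lemma bdryP x : reflect (exists2 q, q \notin X & e x q) (bdry x).
Proof. by apply: (iffP existsP) => [[q /andP[]]|[q qX exq]]; exists q => //; rewrite qX. Qed.

Lemma side_sym : symmetric side_rel.
Proof. by move=> [x|[]] [y|[]] //=; rewrite symE. Qed.

Lemma side_irr : irreflexive side_rel.
Proof. by move=> [x|[]] //=; rewrite irrE. Qed.

Lemma card_side : #|sideT| = #|X| + 1.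
Proof. by rewrite card_sum card_unit card_sig. Qed.

Lemma card_bdry : #|[set x in X | bdry x]| = 3.
Proof.
rewrite -C3 -(card_in_imset cpairs_fst_inj); congr #|pred_of_set _|; apply/setP=> x.
rewrite inE; apply/andP/imsetP => [[xX /bdryP[q qX exq]]|[[p q]]].
  by exists (x, q); rewrite // inE /= xX qX.
rewrite inE /= => /and3P[pX qX epq] ->; split=> //.
by apply/bdryP; exists q.
Qed.

Lemma card_sig_set (p : pred T) : #|[set y : {x : T | x \in X} | p (val y)]| = #|[set x in X | p x]|.
Proof.
rewrite -(card_imset _ val_inj); congr #|pred_of_set _|; apply/setP=> x; rewrite inE.
apply/imsetP/andP => [[y]|[xX px]]; first by rewrite inE => py ->; split=> //; apply: valP.
by exists (Sub x xX); rewrite ?inE.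
Qed.

Lemma side_cubic : cubic side_rel.
Proof.
have [_ _ cub _] := G.
move=> [x|[]]; rewrite card_sum_set /=; last first.
  rewrite (_ : [set _ : unit | false] = set0) ?cards0 ?addn0; last by apply/setP=> z; rewrite !inE.
  by rewrite (card_sig_set bdry) card_bdry.
rewrite (card_sig_set (e (val x))) -(cub (val x)) -[RHS](cardsID X); congr (_ + _).
  by apply: eq_card => y; rewrite !inE andbC.
have xX : val x \in X by apply: valP.
case: (boolP (bdry (val x))) => [/bdryP[q qX exq]|nb]; last first.
  rewrite (_ : [set _ : unit | false] = set0) ?cards0; last by apply/setP=> z; rewrite !inE.
  apply/esym/eqP; rewrite cards_eq0; apply/eqP/setP=> q; rewrite !inE.
  apply/negP => /andP[qX exq]; case/negP: nb; apply/bdryP; by exists q.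
rewrite (_ : [set _ : unit | true] = [set tt]) ?cards1; last by apply/setP=> -[]; rewrite !inE.
rewrite (_ : _ :\: _ = [set q]) ?cards1 //; apply/setP=> q'; rewrite !inE.
apply/andP/eqP => [[q'X exq']|->]; last by [].
have h : (val x, q') = (val x, q).
  by apply: cpairs_fst_inj; rewrite ?inE //= xX ?qX ?q'X.
by case: h.
Qed.

Lemma side_3conn : three_connected side_rel.
Proof.
have [_ _ _ [T3 conn]] := G.
have X3 : 2 < #|X|.
  by rewrite -card_bdry; apply: subset_leq_card; apply/subsetP=> x; rewrite inE => /andP[].
split; first by rewrite card_side addn1.
have [y _ yX] : exists2 y, y \in [set: T] & y \notin X by apply/subsetPn; rewrite subTset.
move=> S S3; pose s := [set x in X | proj x \in S].
have symc := on_rel_connect_sym (~: S) side_sym.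
have sS : #|s| <= #|S :\ inr tt|.
  rewrite -(card_in_imset (f := proj) (D := mem s)); last first.
    by move=> a b; rewrite !inE => /andP[aX _] /andP[bX _]; apply: proj_inj.
  apply: subset_leq_card; apply/subsetP=> z /imsetP[x]; rewrite !inE => /andP[xX xS] ->.
  by rewrite xS proj_in.
have alive x : x \notin s -> x \in X -> proj x \notin S by rewrite inE => + xX; rewrite xX.
have sX : s \subset X by apply/subsetP=> x; rewrite inE => /andP[].
have projE (z : sideT) : z \notin S -> z != inr tt -> exists2 x, x \in X :\: s & z = proj x.
  case: z => [z|[]] // zS _; exists (val z); last by rewrite proj_val.
  by rewrite !inE (valP z) proj_val zS.
case: (boolP (inr tt \in S)) => rS.
  have s2 : #|s| < 2 by apply: leq_ltn_trans sS _; move: S3; rewrite (cardsD1 (inr tt)) rS.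
  have inX u v : connect (on_rel (X :\: s) e) u v -> connect (on_rel (~: S) side_rel) (proj u) (proj v).
    apply: connect_homo => {}u {}v; rewrite /on_rel /= !inE.
    move=> /and3P[/andP[us uX] /andP[vs vX] euv]; apply: connect1.
    by rewrite /= !inE (negPf (alive u _ _)) ?(negPf (alive v _ _)) ?inE //= side_relE.
  move=> u v; rewrite !inE => uS vS.
  have [|x xX ->] := projE u uS; first by apply: contraNneq uS => ->.
  have [|z zX ->] := projE v vS; first by apply: contraNneq vS => ->.
  (* With the contracted vertex deleted, x and z must be joined inside [X]. Each reaches two of the
     three cut edges, so they reach a common one. *)
  have kx := two_exits sX s2 xX; have kz := two_exits sX s2 zX.
  set Kx := [set _ in _ | _] in kx; set Kz := [set _ in _ | _] in kz.
  have [pq] : exists pq, pq \in Kx :&: Kz.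
    apply/set0Pn; rewrite -card_gt0; move: kx kz.
    have : #|Kx :|: Kz| <= 3.
      by rewrite -C3; apply: subset_leq_card; apply/subsetP=> pq; rewrite !inE => /orP[]/andP[].
    by rewrite cardsU; clear; have := subset_leq_card (subsetIl Kx Kz); lia.
  rewrite !inE => /andP[/andP[_ cx] /andP[_ cz]].
  by apply: connect_trans (inX _ _ cx) _; rewrite symc; apply: inX.
(* A walk in the original graph from x to a vertex outside [X] avoiding [s] is followed until it
   first leaves [X]; that exit is an edge to the contracted vertex. *)
have root x : x \in X :\: s -> connect (on_rel (~: S) side_rel) (proj x) (inr tt).
  move=> xXs; have s3 : #|s| < 3 by apply: leq_ltn_trans S3; apply: leq_trans sS _; rewrite subset_leq_card // subD1set.
  have xs : x \in ~: s by move: xXs; rewrite !inE => /andP[].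
  have ys : y \in ~: s by rewrite !inE (negPf yX).
  have xX : x \in X by move: xXs; rewrite inE => /andP[].
  case/connectP: (conn s s3 x y xs ys) => pth.
  elim: pth x {xXs xs} xX => [|w pth IH] x xX /=; first by move=> _ yE; rewrite -yE (negPf yX) in xX *.
  move=> /andP[/and3P[xs ws exw] pw] yE; rewrite !inE xX /= in xs.
  case: (boolP (w \in X)) => wX; last first.
    apply: connect1; rewrite /on_rel /= !inE rS xs /= side_rel_root //.
    by apply/bdryP; exists w.
  apply: connect_trans (IH w wX pw yE); apply: connect1.
  by rewrite /on_rel /= side_relE // exw !inE xs /=; move: ws; rewrite !inE wX => /= ->.
have rt z : z \notin S -> connect (on_rel (~: S) side_rel) z (inr tt).
  have [->|zr] := eqVneq z (inr tt); first by rewrite connect0.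
  by move=> zS; have [x xX ->] := projE z zS zr; apply: root.
move=> u v; rewrite !inE => uS vS; apply: connect_trans (rt u uS) _.
by rewrite symc; apply: rt.
Qed.

Lemma side_cubic_3conn : cubic_3conn side_rel.
Proof. by split; [exact: side_sym|exact: side_irr|exact: side_cubic|exact: side_3conn]. Qed.

Lemma side_pull (V : {set sideT}) : inr tt \notin V -> has_lfactor V side_rel ->
  has_lfactor [set x | proj x \in V] e.
Proof.
move=> rV /has_starP; case; first exact: side_sym.
move=> c sc; have [y _ yX] : exists2 y, y \in [set: T] & y \notin X by apply/subsetPn; rewrite subTset.
(* The value [y] outside [X] only makes [f] total and injective; the contracted vertex is not in
   [V]. *)
pose f (u : sideT) : T := if u is inl x then val x else y.
have f_inj : injective f.
  move=> [x|[]] [z|[]] //=; first by move=> /val_inj->.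
    by move=> xE; have := valP x; rewrite /= xE (negPf yX).
  by move=> xE; have := valP z; rewrite /= -xE (negPf yX).
have [|c' [sc' _]] := star_push f_inj (E' := e) _ sc.
  by move=> [x|[]] [z|[]] //= uV vV; rewrite ?(negPf rV) // in uV vV *.
apply/has_starP => //; exists c'; rewrite (_ : [set _ | _] = f @: V) //.
apply/setP=> x; rewrite inE; apply/idP/imsetP => [xV|[[z|[]] zV ->]].
- have xX : x \in X by apply: contraNT rV => /proj_out <-.
  by exists (proj x) => //; rewrite proj_in.
- by rewrite /f proj_val.
by rewrite (negPf rV) in zV.
Qed.
End Side.
End Cut.

(** [Z] may be listed in either direction; up to reversal it is w, x, y, z. *)
Lemma f6_shape (T : finType) (e : rel T) (Z : seq T) x y z : symmetric e ->
  gpath e Z -> size Z = 4 -> uniq [:: x; y; z] ->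
  [set x; y] \in path_edges Z -> [set y; z] \in path_edges Z ->
  head x Z = z \/ last x Z = z ->
  exists w, [/\ e w x, w \notin [:: x; y; z] & Z =i [:: w; x; y; z]].
Proof.
move=> symE; case: Z => [|z0 [|z1 [|z2 [|z3 []]]]] //= /andP[+ /and4P[e01 e12 e23 _]] _.
rewrite !inE !negb_or !andbT => /and3P[/and3P[n01 n02 n03] /andP[n12 n13] n23].
move=> /andP[/andP[xy xz] yz] /existsP[[a b]]; rewrite !inE /= !xpair_eqE set2_eq => /andP[m1 E1].
move=> /existsP[[a' b']]; rewrite !inE /= !xpair_eqE set2_eq => /andP[m2 E2] hl.
suff [[-> -> ->]|[-> -> ->]] : [/\ x = z1, y = z2 & z = z3] \/ [/\ x = z2, y = z1 & z = z0].
- by exists z0; split; rewrite // !inE !negb_or n01 n02 n03.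
- exists z3; split; rewrite 1?symE // ?inE ?negb_or; last first.
    by move=> u; rewrite !inE; do 4!case: (u == _).
  by rewrite (eq_sym z3 z2) n23 (eq_sym z3 z1) n13 (eq_sym z3 z0) n03.
case: hl => zE; subst z; [right|left].
  have {m2 E2} yE : y = z1.
    case/or3P: m2 E2 => /andP[/eqP-> /eqP->] /orP[]/andP[/eqP yE /eqP zE] //;
      subst; rewrite ?eqxx // in n01 n02 n03 n12 n13 n23 xy xz yz *.
  subst y; case/or3P: m1 E1 => /andP[/eqP-> /eqP->] /orP[]/andP[/eqP xE /eqP zE];
      subst; rewrite ?eqxx // in n01 n02 n03 n12 n13 n23 xy xz yz *.
have {m2 E2} yE : y = z2.
  case/or3P: m2 E2 => /andP[/eqP-> /eqP->] /orP[]/andP[/eqP yE /eqP zE] //;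
    subst; rewrite ?eqxx // in n01 n02 n03 n12 n13 n23 xy xz yz *.
subst y; case/or3P: m1 E1 => /andP[/eqP-> /eqP->] /orP[]/andP[/eqP xE /eqP zE];
    subst; rewrite ?eqxx // in n01 n02 n03 n12 n13 n23 xy xz yz *.
Qed.

Lemma star_of_triple (T : finType) (e : rel T) a b d : symmetric e -> uniq [:: a; b; d] ->
  e a b -> e b d ->
  exists c, star_fun [set z in [:: a; b; d]] e c /\ {in [:: a; b; d], forall v, c v = b}.
Proof.
move=> symE; rewrite /= !inE negb_or !andbT => /andP[/andP[ab ad] bd] eab ebd.
rewrite (_ : [set z in _] = [set a; b; d]); last by apply/setP=> z; rewrite !inE orbA.
eexists; split; first by apply: star_triple; rewrite // 1?eq_sym // symE.
by move=> v; rewrite !inE orbA /= => ->.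
Qed.

(** The remainders of the two sides and the two crossing paths partition the vertices, which is what
    the sum of the four memberships being 1 expresses. *)
Lemma glue4 (T : finType) (e : rel T) (VX VY : {set T}) a1 b1 d1 a2 b2 d2 : symmetric e ->
  has_lfactor VX e -> has_lfactor VY e ->
  uniq [:: a1; b1; d1] -> uniq [:: a2; b2; d2] ->
  [/\ e a1 b1, e b1 d1, e a2 b2 & e b2 d2] ->
  (forall v, (v \in VX) + (v \in VY) + (v \in [:: a1; b1; d1]) + (v \in [:: a2; b2; d2]) = 1) ->
  exists c, [/\ star_fun setT e c, {in [:: a1; b1; d1], forall v, c v = b1},
    {in [:: a2; b2; d2], forall v, c v = b2},
    forall v, v \in VX -> c v \in VX & forall v, v \in VY -> c v \in VY].
Proof.
move=> symE /has_starP[]// cX sX /has_starP[]// cY sY u1 u2 [e1 e1' e2 e2'] part.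
have [c1 [s1 c1E]] := star_of_triple symE u1 e1 e1'.
have [c2 [s2 c2E]] := star_of_triple symE u2 e2 e2'.
have [|cA [sA AX AY]] := star_union_ex _ sX sY.
  rewrite -setI_eq0; apply/eqP/setP=> v; have := part v; rewrite !inE.
  by case: (v \in VX); case: (v \in VY).
have [|cB [sB B1 B2]] := star_union_ex _ s1 s2.
  rewrite -setI_eq0; apply/eqP/setP=> v; have := part v; rewrite !inE.
  by case: [|| _, _ | _]; case: [|| _, _ | _] => //; rewrite !addn1.
have [|c [s A B]] := star_union_ex _ sA sB.
  rewrite -setI_eq0; apply/eqP/setP=> v; have := part v; rewrite !inE.
  by case: (v \in VX); case: (v \in VY); do 2!case: [|| _, _ | _].
exists c; split.
- rewrite (_ : setT = (VX :|: VY) :|: ([set z in [:: a1; b1; d1]] :|: [set z in [:: a2; b2; d2]])) //.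
  apply/setP=> v; have := part v; rewrite !inE.
  by case: (v \in VX); case: (v \in VY); do 2!case: [|| _, _ | _].
- by move=> v v1; rewrite B ?in_setU ?in_set ?v1 // B1 ?in_set // c1E.
- by move=> v v2; rewrite B ?in_setU ?in_set ?v2 ?orbT // B2 ?in_set // c2E.
- by move=> v vV; rewrite A ?AX ?(star_fun_in _ sX) // !inE vV.
- by move=> v vV; rewrite A ?AY ?(star_fun_in _ sY) // !inE vV orbT.
Qed.

(** * Prescribed crossings of a 3-edge cut *)

Section Z9.
Variables (T : finType) (e : rel T).
Hypothesis G : cubic_3conn e.
Let symE : symmetric e. Proof. by case: G. Qed.
Let irrE : irreflexive e. Proof. by case: G. Qed.

(** An edge is used by a factor exactly when one of its ends is the centre of the other; so the
    first two edges are used and the third is not. *)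
Definition crosses p1 q1 p2 q2 p3 q3 : Prop := exists c, star_fun setT e c /\
  [/\ c p1 = q1 \/ c q1 = p1, c p2 = q2 \/ c q2 = p2, c p3 <> q3 & c q3 <> p3].

Lemma crossesC p1 q1 p2 q2 p3 q3 : crosses q1 p1 q2 p2 q3 p3 -> crosses p1 q1 p2 q2 p3 q3.
Proof.
by move=> [c [sc [h1 h2 h3 h4]]]; exists c; split=> //; split=> //; [case: h1|case: h2]; auto.
Qed.

Variable X : {set T}.
Variables p1 q1 p2 q2 p3 q3 : T.
Hypothesis CE : forall p q, ((p, q) \in cpairs e X) = ((p, q) \in [:: (p1, q1); (p2, q2); (p3, q3)]).
Hypothesis CU : uniq [:: (p1, q1); (p2, q2); (p3, q3)].

Let card3 : #|cpairs e X| = 3.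
Proof.
rewrite (eq_card (B := mem [:: (p1, q1); (p2, q2); (p3, q3)])); last by move=> [p q]; rewrite CE.
by move/card_uniqP: CU.
Qed.

Let C1 : [/\ p1 \in X, q1 \notin X & e p1 q1].
Proof. by have := CE p1 q1; rewrite !inE eqxx /= => /and3P. Qed.
Let C2 : [/\ p2 \in X, q2 \notin X & e p2 q2].
Proof. by have := CE p2 q2; rewrite !inE eqxx orbT /= => /and3P. Qed.
Let C3 : [/\ p3 \in X, q3 \notin X & e p3 q3].
Proof. by have := CE p3 q3; rewrite !inE eqxx !orbT /= => /and3P. Qed.

Lemma crosses_lfactor : crosses p1 q1 p2 q2 p3 q3 ->
  exists F, is_lfactor setT e F /\ forall A, A \in cut e X ->
    (A \in edge_set F) = (A \in [set [set p1; q1]; [set p2; q2]]).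
Proof.
move=> [c [sc [h1 h2 h3 h4]]]; have lF := star_lfactor symE sc.
exists (star_rel setT c); split=> // A; rewrite cutE // => /imsetP[[p q] pqC ->].
have symF : symmetric (star_rel setT c) by case: lF.
have -> : ([set p1; q1] : {set T}) = edge_of (p1, q1) by [].
have -> : ([set p2; q2] : {set T}) = edge_of (p2, q2) by [].
have inC k : k \in [:: (p1, q1); (p2, q2); (p3, q3)] -> k \in cpairs e X.
  by case: k => a b; rewrite CE.
have inj k : k \in [:: (p1, q1); (p2, q2); (p3, q3)] -> (edge_of (p, q) == edge_of k) = ((p, q) == k).
  by move=> kC; apply/eqP/eqP => [/(edge_of_inj pqC (inC _ kC))|->].
have -> : (edge_of (p, q) \in edge_set (star_rel setT c)) = star_rel setT c p q by apply: edge_set2.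
rewrite !in_set2 !inj ?inE ?eqxx ?orbT // /star_rel /= !in_setT /=.
have pq : p != q by move: pqC; rewrite inE /= => /and3P[pX qX _]; apply: contraNneq qX => <-.
rewrite pq /=; move: pqC; rewrite CE !inE => /or3P[]/eqP kE; rewrite kE ?eqxx ?orbT.
- rewrite /=; by case: kE => -> ->; apply/orP; case: h1 => ->; rewrite eqxx; auto.
- by case: kE => -> ->; apply/orP; case: h2 => ->; rewrite eqxx; auto.
move: CU; rewrite /= !inE !negb_or => /and3P[/andP[_ n13] n23 _].
rewrite (eq_sym (p3, q3) (p1, q1)) (negPf n13) (eq_sym (p3, q3)) (negPf n23).
by case: kE => -> ->; apply/negbTE; rewrite negb_or; apply/andP; split; apply/eqP.
Qed.

(** The cut is the star of a vertex x, and using two of its edges means that q1, x, q2 is one of the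
    paths; z8 prescribes it. *)
Lemma crosses_single : stmt_z8 -> #|T| %% 6 = 0 -> #|X| = 1 -> crosses p1 q1 p2 q2 p3 q3.
Proof.
move=> z8 T6 /eqP/cards1P[x XE].
move: C1 C2 C3; rewrite XE !inE => -[/eqP pE1 q1x e1] [/eqP pE2 q2x e2] [/eqP pE3 q3x e3].
subst p1 p2 p3; move: CU; rewrite /= !inE !xpair_eqE !eqxx negb_or !andbT /=.
move=> /andP[/andP[n12 n13] n23].
have pL : gpath e [:: q1; x; q2].
  by rewrite /= !inE negb_or q1x n12 eq_sym q2x symE e1 e2.
have [c sc] : exists c, star_fun (~: [set y in [:: q1; x; q2]]) e c.
  by apply/has_starP => //; apply: z8.
have e1' : e q1 x by rewrite symE.
have uL : uniq [:: q1; x; q2] by case/andP: pL.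
have [ct [st ctE]] := star_of_triple symE uL e1' e2.
have [|c' [s' cE' tE']] := star_union_ex _ sc st; first by rewrite disjoint_sym disjoints_subset setCK.
exists c'; rewrite setUC setUCr in s'; split=> //; split.
- by right; rewrite tE' ?ctE // !inE eqxx.
- by right; rewrite tE' ?ctE // !inE eqxx ?orbT.
- rewrite tE' ?ctE // ?inE ?eqxx ?orbT // => xq; by rewrite xq eqxx in q3x.
have q3V : q3 \in ~: [set y in [:: q1; x; q2]].
  by rewrite !inE !negb_or q3x eq_sym n13 eq_sym n23.
rewrite cE' // => cq; have := star_fun_in q3 sc; rewrite q3V cq !inE eqxx orbT.
by [].
Qed.

Lemma proj_eq x y : x \in X -> y \in X -> (proj X x == proj X y) = (x == y).
Proof. by move=> xX yX; apply/eqP/eqP => [/proj_inj->|->]. Qed.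

Lemma side_pull_seq (V : {set sideT X}) (zs : seq T) : X != setT ->
  (forall z, z \in zs -> z \in X) ->
  V =i [predC inr tt :: map (proj X) zs] ->
  has_lfactor V (side_rel e (X := X)) -> has_lfactor [set x in X | x \notin zs] e.
Proof.
move=> XT zX VE fac.
have rV : inr tt \notin V by rewrite VE !inE eqxx.
apply: lfactor_eq (side_pull G XT rV fac); apply/setP=> x; rewrite !inE VE.
case: (boolP (x \in X)) => xX; last by rewrite proj_out // !inE eqxx.
rewrite !inE negb_or {1}(proj_in xX) /=; congr (~~ _); apply/mapP/idP => [[z zz pE]|xz].
  by rewrite (proj_inj xX (zX _ zz) pE).
by exists x.
Qed.

Section BigSide.
Hypotheses (X2 : 1 < #|X|) (XT : X != setT).

Let GX := side_cubic_3conn G card3 X2 XT.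

Lemma ends_uniq : uniq [:: p1; p2; p3].
Proof.
have inC k : k \in [:: (p1, q1); (p2, q2); (p3, q3)] -> k \in cpairs e X by case: k => a b; rewrite CE.
have inj := cpairs_fst_inj G card3 X2 XT.
move: CU; rewrite /= !inE !negb_or !andbT => /andP[/andP[n12 n13] n23].
apply/andP; split; first (apply/andP; split).
- by apply: contraNneq n12 => pE; apply/eqP/inj; rewrite ?inC ?inE ?eqxx ?orbT.
- by apply: contraNneq n13 => pE; apply/eqP/inj; rewrite ?inC ?inE ?eqxx ?orbT.
by apply: contraNneq n23 => pE; apply/eqP/inj; rewrite ?inC ?inE ?eqxx ?orbT.
Qed.

Lemma bdry_ends p : p \in X -> bdry e X p = (p \in [:: p1; p2; p3]).
Proof.
move=> pX; apply/bdryP/idP => [[q qX epq]|].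
  have : (p, q) \in cpairs e X by rewrite inE /= pX qX.
  by rewrite CE !inE !xpair_eqE => /or3P[]/andP[-> _]; rewrite ?orbT.
move: C1 C2 C3 => [_ x1 y1] [_ x2 y2] [_ x3 y3].
by rewrite !inE => /or3P[]/eqP->; [exists q1|exists q2|exists q3].
Qed.

Lemma root_edge p : p \in [:: p1; p2; p3] -> side_rel e (inr tt) (proj X p).
Proof.
move=> pE; have pX : p \in X.
  by move: C1 C2 C3 pE => [? _ _] [? _ _] [? _ _]; rewrite !inE => /or3P[]/eqP->.
by rewrite side_sym ?side_rel_root ?bdry_ends.
Qed.

Lemma root_nbr u : side_rel e (inr tt) u -> exists2 p, p \in [:: p1; p2; p3] & u = proj X p.
Proof.
case: u => [y|[]] //= yb; exists (val y); last by rewrite proj_val.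
by rewrite -bdry_ends // (valP y).
Qed.

Lemma root_path : gpath (side_rel e (X := X)) [:: proj X p1; inr tt; proj X p2].
Proof.
have [symS _ _ _] := GX; have [x1 _ _] := C1; have [x2 _ _] := C2.
have := ends_uniq; rewrite /= !inE !negb_or => /and3P[/andP[n12 n13] n23 _].
apply/andP; split.
  have d12 : proj X p1 != proj X p2 by apply: contraNneq n12 => /proj_inj->.
  by rewrite d12 !proj_in.
have r1 : side_rel e (inr tt) (proj X p1) by apply: root_edge; rewrite !inE eqxx.
have r2 : side_rel e (inr tt) (proj X p2) by apply: root_edge; rewrite !inE eqxx orbT.
by rewrite symS r1 /= andbT; apply: r2.
Qed.

(** Contraction adds one vertex, giving 0 mod 6; the deleted path has the contracted vertex as its
    centre and p1, p2 as its ends. *)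
Lemma side_z8 : stmt_z8 -> #|X| %% 6 = 5 -> has_lfactor [set x in X | x \notin [:: p1; p2]] e.
Proof.
move=> z8 X5; have [x1 _ _] := C1; have [x2 _ _] := C2.
have := z8 _ _ GX _ _ root_path erefl; rewrite card_side (mod6D 1 X5) => /(_ erefl) fac.
apply: (side_pull_seq XT _ _ fac).
  by move=> z; rewrite !inE => /orP[]/eqP->.
by move=> z; rewrite !inE /= ?inE; do 3!case: (z == _).
Qed.

Lemma side_f6 : stmt_f6 -> #|X| %% 6 = 3 -> exists w, [/\ w \in X, e p1 w,
  w \notin [:: p1; p2] & has_lfactor [set x in X | x \notin [:: w; p1; p2]] e].
Proof.
move=> f6 X3; have [x1 _ _] := C1; have [x2 _ _] := C2; have [symS _ _ _] := GX.
have := ends_uniq; rewrite /= !inE !negb_or => /and3P[/andP[n12 n13] n23 _].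
have pL := root_path.
have := f6 _ _ GX _ _ _ _ pL; rewrite card_side (mod6D 1 X3) => /(_ erefl)[Z [pZ sZ [E1 E2] hl fac]].
have uL : uniq [:: proj X p1; inr tt; proj X p2] by case/andP: pL.
have [u [eu nu ZE]] := f6_shape symS pZ sZ uL E1 E2 hl.
case: u eu nu ZE => [y|[]]; last by rewrite !inE eqxx orbT.
rewrite -proj_val; have yX : val y \in X := valP y; move: (val y) yX => w wX.
rewrite side_relE // !inE !negb_or !proj_eq // => ew /and3P[w1 _ w2] ZE.
exists w; rewrite symE; split=> //; first by rewrite !inE negb_or w1.
apply: (side_pull_seq XT _ _ fac).
  by move=> z; rewrite !inE => /or3P[]/eqP->.
by move=> z; rewrite !inE ZE /= ?inE; do 4!case: (z == _).
Qed.

(** The contracted vertex is the centre of the 5-vertex path and the edge towards p3 is the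
    forbidden one, so the path must pass through p1 and p2, in one of the two orders. *)
Lemma side_t4 : stmt_t4 -> #|X| %% 6 = 1 -> exists y1 y2, [/\ y1 \in X, y2 \in X,
  e p1 y1 /\ e p2 y2, uniq [:: y1; p1; p2; y2] &
  has_lfactor [set x in X | x \notin [:: y1; p1; p2; y2]] e].
Proof.
move=> t4 X1; have [x1 _ _] := C1; have [x2 _ _] := C2; have [x3 _ _] := C3.
have [symS _ _ _] := GX.
have p3E : p3 \in [:: p1; p2; p3] by rewrite !inE eqxx !orbT.
have := t4 _ _ GX _ (inr tt) (proj X p3) (root_edge p3E); rewrite card_side (mod6D 1 X1).
case/(_ erefl)=> W [pW sW nW n3 fac].
case: W pW sW nW n3 fac => [|w0 [|w1 [|r [|w3 [|w4 []]]]]] //= /andP[+ /and5P[r01 r1r rr3 r34 _]] _ rE.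
subst r; rewrite symS in r1r.
have [a aE w1E] := root_nbr r1r; have [b bE w3E] := root_nbr rr3.
subst w1 w3 => uW n3 fac.
have a3 : a != p3.
  apply: contraNneq n3 => ->; apply: mem_path_edges.
  by rewrite !inE !eqxx !orbT.
have b3 : b != p3.
  apply: contraNneq n3 => ->; apply: mem_path_edges.
  by rewrite !inE !eqxx !orbT.
have aX : a \in X by move: aE; rewrite !inE => /or3P[]/eqP->.
have bX : b \in X by move: bE; rewrite !inE => /or3P[]/eqP->.
move: uW; rewrite !inE !negb_or => /and4P[/and4P[m01 m0r m03 m04] /and3P[m1r m13 m14] /andP[mr3 mr4]].
rewrite andbT => m34.
case: w0 r01 m01 m0r m03 m04 fac n3 => [y|[]]; last by rewrite eqxx.
rewrite -proj_val; have yX : val y \in X := valP y; move: (val y) yX => y0 y0X.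
case: w4 r34 m14 mr4 m34 => [y'|[]]; last by rewrite eqxx.
rewrite -proj_val; have y'X : val y' \in X := valP y'; move: (val y') y'X => y4 y4X.
rewrite !side_relE // !proj_eq // => e34 m14 _ m34 e01 m01 _ m03 m04 fac _.
have {}m13 : a != b by apply: contraNneq m13 => ->.
have fac' : has_lfactor [set x in X | x \notin [:: y0; a; b; y4]] e.
  apply: (side_pull_seq XT _ _ fac).
    by move=> z; rewrite !inE => /or4P[]/eqP->.
  by move=> z; rewrite !inE /= ?inE; do 5!case: (z == _).
have : a == p1 /\ b == p2 \/ a == p2 /\ b == p1.
  move: aE bE m13; rewrite !inE (negPf a3) (negPf b3) !orbF.
  by move=> /orP[]/eqP-> /orP[]/eqP->; rewrite ?eqxx //; [left|right].
case=> -[/eqP aE' /eqP bE']; subst a b.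
  exists y0, y4; split=> //; first by rewrite symE.
  by rewrite /= !inE !negb_or m01 m03 m04 m13 m14 m34.
exists y4, y0; split=> //; first by rewrite [e p2 _]symE.
  by rewrite /= !inE !negb_or (eq_sym y4 p1) m34 (eq_sym y4 p2) m14 (eq_sym y4) m04 eq_sym m13 eq_sym m03 eq_sym m01.
apply: lfactor_eq fac'; apply/setP=> z; rewrite !inE.
by do 4!case: (z == _).
Qed.
End BigSide.
End Z9.

(** * Gluing the two sides of the cut *)

Section Crosses.
Variables (T : finType) (e : rel T).
Hypothesis G : cubic_3conn e.
Let symE : symmetric e. Proof. by case: G. Qed.

(** The order of the enumeration matters: its first two edges are the prescribed ones. *)
Definition lists_cut (X : {set T}) (s : seq (T * T)) :=
  uniq s /\ forall p q, ((p, q) \in cpairs e X) = ((p, q) \in s).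

Lemma lists_cutC X p1 q1 p2 q2 p3 q3 :
  lists_cut X [:: (p1, q1); (p2, q2); (p3, q3)] -> lists_cut (~: X) [:: (q1, p1); (q2, p2); (q3, p3)].
Proof.
have swap (a b c d : T) : ((a, b) == (c, d)) = ((b, a) == (d, c)) by rewrite !xpair_eqE andbC.
move=> [U CE]; split; first by move: U; rewrite /= !inE !(swap p1) !(swap p2).
move=> q p; have := CE p q; rewrite !inE /= negbK (swap q) (swap q) (swap q) => <-.
by rewrite symE andbCA.
Qed.

Lemma lists_cut_swap X k1 k2 k3 : lists_cut X [:: k1; k2; k3] -> lists_cut X [:: k2; k1; k3].
Proof.
move=> [U CE]; split; last by move=> p q; rewrite CE !inE orbCA.
by move: U; rewrite /= !inE !negb_or eq_sym => /and3P[/andP[-> ->] -> _].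
Qed.

Lemma lists_cut_in X p q s : lists_cut X s -> (p, q) \in s -> [/\ p \in X, q \notin X & e p q].
Proof. by move=> [_ CE]; rewrite -CE inE /= => /and3P. Qed.

Lemma crosses_glue X p1 q1 p2 q2 p3 q3 (VX VY : {set T}) a1 b1 d1 a2 b2 d2 :
  lists_cut X [:: (p1, q1); (p2, q2); (p3, q3)] ->
  uniq [:: p1; p2; p3] -> uniq [:: q1; q2; q3] ->
  VX \subset X -> VY \subset ~: X ->
  has_lfactor VX e -> has_lfactor VY e ->
  uniq [:: a1; b1; d1] -> uniq [:: a2; b2; d2] ->
  [/\ e a1 b1, e b1 d1, e a2 b2 & e b2 d2] ->
  (forall v, (v \in VX) + (v \in VY) + (v \in [:: a1; b1; d1]) + (v \in [:: a2; b2; d2]) = 1) ->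
  a1 = p1 /\ b1 = q1 \/ a1 = q1 /\ b1 = p1 ->
  a2 = p2 /\ b2 = q2 \/ a2 = q2 /\ b2 = p2 ->
  crosses e p1 q1 p2 q2 p3 q3.
Proof.
move=> LC up uq /subsetP VXX /subsetP VYX fX fY u1 u2 es part ab1 ab2.
have [p1X q1X _] : [/\ p1 \in X, q1 \notin X & e p1 q1] by apply: (lists_cut_in LC); rewrite !inE eqxx.
have [p2X q2X _] : [/\ p2 \in X, q2 \notin X & e p2 q2] by apply: (lists_cut_in LC); rewrite !inE eqxx orbT.
have [p3X q3X _] : [/\ p3 \in X, q3 \notin X & e p3 q3] by apply: (lists_cut_in LC); rewrite !inE eqxx !orbT.
move: up uq; rewrite /= !inE !negb_or !andbT => /andP[/andP[_ p13] p23] /andP[/andP[_ q13] q23].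
have [c [sc c1 c2 cX cY]] := glue4 symE fX fY u1 u2 es part.
have ne p q : p \in X -> q \notin X -> p <> q by move=> pX qX pq; rewrite pq (negPf qX) in pX.
have p3b : b1 != p3 /\ b2 != p3.
  split; [case: ab1 => -[_ ->]|case: ab2 => -[_ ->]] => //; apply/eqP => E.
    by rewrite E p3X in q1X.
  by rewrite E p3X in q2X.
have q3b : b1 != q3 /\ b2 != q3.
  split; [case: ab1 => -[_ ->]|case: ab2 => -[_ ->]] => //; apply/eqP => E.
    by rewrite E (negPf q3X) in p1X.
  by rewrite E (negPf q3X) in p2X.
have place v : [\/ v \in VX, v \in VY, v \in [:: a1; b1; d1] | v \in [:: a2; b2; d2]].
  have := part v; case: (v \in VX); first by constructor 1.
  case: (v \in VY); first by constructor 2.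
  case: (v \in [:: a1; b1; d1]); first by constructor 3.
  by case: (v \in [:: a2; b2; d2]); first by constructor 4.
have tri1 : c a1 = b1 by apply: c1; rewrite inE eqxx.
have tri2 : c a2 = b2 by apply: c2; rewrite inE eqxx.
exists c; split=> //; split.
- by case: ab1 => -[<- <-]; auto.
- by case: ab2 => -[<- <-]; auto.
- case: (place p3) => [vV|/VYX|v1|v2].
  + by apply: ne => //; apply: VXX; apply: cX.
  + by rewrite inE p3X.
  + by rewrite c1 //; apply/eqP; case: q3b.
  + by rewrite c2 //; apply/eqP; case: q3b.
case: (place q3) => [/VXX|vV|v1|v2].
- by rewrite (negPf q3X).
- by move=> E; have := VYX _ (cY _ vV); rewrite E inE p3X.
- by rewrite c1 //; apply/eqP; case: p3b.
- by rewrite c2 //; apply/eqP; case: p3b.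
Qed.

(** The side with residue 5 gives up p1 and p2, the other gives up two vertices for each crossing;
    both crossing paths are centred outside [X]. *)
Lemma crosses_51 X p1 q1 p2 q2 p3 q3 : stmt_z8 -> stmt_t4 ->
  lists_cut X [:: (p1, q1); (p2, q2); (p3, q3)] -> 1 < #|X| -> 1 < #|~: X| ->
  #|X| %% 6 = 5 -> #|~: X| %% 6 = 1 -> crosses e p1 q1 p2 q2 p3 q3.
Proof.
move=> z8 t4 LC X2 Y2 X5 Y1; have LY := lists_cutC LC.
have XT : X != setT by apply: contraTneq Y2 => ->; rewrite setCT cards0.
have YT : ~: X != setT by apply: contraTneq X2 => XE; rewrite -[X]setCK XE setCT cards0.
have up := ends_uniq G LC.2 LC.1 X2 XT.
have uq := ends_uniq G LY.2 LY.1 Y2 YT.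
have fX := side_z8 G LC.2 LC.1 X2 XT z8 X5.
have [y1 [y2 [y1Y y2Y [e1 e2] uy fY]]] := side_t4 G LY.2 LY.1 Y2 YT t4 Y1.
have [p1X q1X e1'] : [/\ p1 \in X, q1 \notin X & e p1 q1] by apply: (lists_cut_in LC); rewrite !inE eqxx.
have [p2X q2X e2'] : [/\ p2 \in X, q2 \notin X & e p2 q2] by apply: (lists_cut_in LC); rewrite !inE eqxx orbT.
move: (up) uy; rewrite /= !inE !negb_or !andbT => /andP[/andP[p12 _] _].
move=> /and3P[/and3P[y1q1 y1q2 y1y2] /andP[q12 q1y2] q2y2].
rewrite !inE in y1Y y2Y.
have ne p q : p \in X -> q \notin X -> p != q by move=> pX; apply: contraNneq => <-.
apply: (crosses_glue (VX := [set x in X | x \notin [:: p1; p2]]) (VY := [set x in ~: X | x \notin [:: y1; q1; q2; y2]])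
  (a1 := p1) (b1 := q1) (d1 := y1) (a2 := p2) (b2 := q2) (d2 := y2) LC up uq) => //.
- by apply/subsetP=> x; rewrite inE => /andP[].
- by apply/subsetP=> x; rewrite inE => /andP[].
- by rewrite /= !inE negb_or (ne p1 q1) // (ne p1 y1) // (eq_sym q1) y1q1.
- by rewrite /= !inE negb_or (ne p2 q2) // (ne p2 y2) // q2y2.
- move=> v; rewrite !inE !negb_or; case: (boolP (v \in X)) => vX /=.
    have nq q : q \notin X -> (v == q) = false by move=> qX; apply/negbTE; apply: ne.
    rewrite (nq q1) // (nq q2) // (nq y1) // (nq y2) //=.
    case: (eqVneq v p1) => [->|_] /=; first by rewrite (negPf p12).
    by case: (v == p2).
  have np p : p \in X -> (v == p) = false by move=> pX; rewrite eq_sym; apply/negbTE; apply: ne.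
  rewrite (np p1) // (np p2) //=.
  case: (eqVneq v y1) => [->|_] /=; first by rewrite (negPf y1q1) (negPf y1q2) (negPf y1y2).
  case: (eqVneq v q1) => [->|_] /=; first by rewrite (negPf q12) (negPf q1y2).
  case: (eqVneq v q2) => [->|_] /=; first by rewrite ?(negPf q2y2).
  by case: (v == y2).
- by left.
- by left.
Qed.

(** Each side gives up three vertices, so one crossing path is centred at p1 in [X] and the other at
    q2 outside. The swap of the first two cut edges makes f6 attach its extra vertex at q2 rather
    than q1. *)
Lemma crosses_33 X p1 q1 p2 q2 p3 q3 : stmt_f6 ->
  lists_cut X [:: (p1, q1); (p2, q2); (p3, q3)] -> 1 < #|X| -> 1 < #|~: X| ->
  #|X| %% 6 = 3 -> #|~: X| %% 6 = 3 -> crosses e p1 q1 p2 q2 p3 q3.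
Proof.
move=> f6 LC X2 Y2 X5 Y1; have LY := lists_cutC LC; have LZ := lists_cut_swap LY.
have XT : X != setT by apply: contraTneq Y2 => ->; rewrite setCT cards0.
have YT : ~: X != setT by apply: contraTneq X2 => XE; rewrite -[X]setCK XE setCT cards0.
have up := ends_uniq G LC.2 LC.1 X2 XT.
have uq := ends_uniq G LY.2 LY.1 Y2 YT.
have [x [xX ex nx fX]] := side_f6 G LC.2 LC.1 X2 XT f6 X5.
have [y [yY ey ny fY]] := side_f6 G LZ.2 LZ.1 Y2 YT f6 Y1.
have [p1X q1X e1'] : [/\ p1 \in X, q1 \notin X & e p1 q1] by apply: (lists_cut_in LC); rewrite !inE eqxx.
have [p2X q2X e2'] : [/\ p2 \in X, q2 \notin X & e p2 q2] by apply: (lists_cut_in LC); rewrite !inE eqxx orbT.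
move: (up) (uq); rewrite /= !inE !negb_or !andbT => /andP[/andP[p12 _] _] /andP[/andP[q12 _] _].
move: nx ny yY; rewrite !inE !negb_or => /andP[xp1 xp2] /andP[yq2 yq1] yY.
have ne p q : p \in X -> q \notin X -> p != q by move=> pX; apply: contraNneq => <-.
apply: (crosses_glue (VX := [set z in X | z \notin [:: x; p1; p2]]) (VY := [set z in ~: X | z \notin [:: y; q2; q1]])
  (a1 := q1) (b1 := p1) (d1 := x) (a2 := p2) (b2 := q2) (d2 := y) LC up uq) => //.
- by apply/subsetP=> z; rewrite inE => /andP[].
- by apply/subsetP=> z; rewrite inE => /andP[].
- by rewrite /= !inE negb_or (eq_sym q1) (ne p1 q1) // (eq_sym q1) (ne x q1) // (eq_sym p1) xp1.
- by rewrite /= !inE negb_or (ne p2 q2) // (ne p2 y) // (eq_sym q2) yq2.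
- by split=> //; rewrite symE.
- move=> v; rewrite !inE !negb_or; case: (boolP (v \in X)) => vX /=.
    have nq q : q \notin X -> (v == q) = false by move=> qX; apply/negbTE; apply: ne.
    rewrite (nq q1) // (nq q2) // (nq y) //=.
    case: (eqVneq v x) => [->|_] /=; first by rewrite (negPf xp1) (negPf xp2).
    case: (eqVneq v p1) => [->|_] /=; first by rewrite (negPf p12).
    by case: (v == p2).
  have np p : p \in X -> (v == p) = false by move=> pX; rewrite eq_sym; apply/negbTE; apply: ne.
  rewrite (np p1) // (np p2) // (np x) //=.
  case: (eqVneq v y) => [->|_] /=; first by rewrite (negPf yq1) (negPf yq2).
  case: (eqVneq v q2) => [->|_] /=; first by rewrite ?(eq_sym q2 q1) ?(negPf q12).
  by case: (v == q1).
- by right.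
- by left.
Qed.

Lemma odd_side X s : lists_cut X s -> size s = 3 -> 1 < #|X| -> X != setT -> odd #|X|.
Proof.
move=> [U CE] s3 X2 XT.
have C3 : #|cpairs e X| = 3.
  rewrite -s3 -(card_uniqP U); apply: eq_card => -[p q]; exact: CE.
have [symS irrS cubS _] := side_cubic_3conn G C3 X2 XT.
by have := cubic_even symS irrS cubS; rewrite card_side addn1 /= negbK.
Qed.

Lemma crosses_all X p1 q1 p2 q2 p3 q3 : stmt_z8 -> stmt_t4 -> stmt_f6 -> #|T| %% 6 = 0 ->
  X != set0 -> X != setT ->
  lists_cut X [:: (p1, q1); (p2, q2); (p3, q3)] -> crosses e p1 q1 p2 q2 p3 q3.
Proof.
move=> z8 t4 f6 T6 X0 XT LC; have LY := lists_cutC LC.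
have cX : 0 < #|X| by rewrite card_gt0.
have cY : 0 < #|~: X| by rewrite card_gt0; apply: contra_neq XT => YE; rewrite -[X]setCK YE setC0.
have [X1|X2] := eqVneq #|X| 1; first exact: (crosses_single G LC.2 LC.1 z8 T6 X1).
have [Y1|Y2] := eqVneq #|~: X| 1.
  by apply: crossesC; apply: (crosses_single G LY.2 LY.1 z8 T6 Y1).
have {cX}X2 : 1 < #|X| by rewrite ltn_neqAle eq_sym X2.
have {cY}Y2 : 1 < #|~: X| by rewrite ltn_neqAle eq_sym Y2.
have oX := odd_side LC erefl X2 XT.
have TE := cardsC X.
(* The residues of the two sides add up to 0 mod 6, so residue 1 is residue 5 with the sides
   exchanged. *)
have [X5|[X3|X1]] : #|X| %% 6 = 5 \/ #|X| %% 6 = 3 \/ #|X| %% 6 = 1 by clear - oX; lia.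
- by apply: (crosses_51 z8 t4 LC) => //; clear - TE X5 T6; lia.
- by apply: (crosses_33 f6 LC) => //; clear - TE X3 T6; lia.
apply: crossesC; apply: (crosses_51 z8 t4 LY) => //; rewrite ?setCK //.
by clear - TE X1 T6; lia.
Qed.
End Crosses.

Lemma z8_t4_f6_z9 : stmt_z8 -> stmt_t4 -> stmt_f6 -> stmt_z9.
Proof.
move=> z8 t4 f6 T e G T6 X X0 XT C3 S SC S2.
have [symE _ _ _] := G.
pose S' := [set pq in cpairs e X | edge_of pq \in S].
have SE : S = (@edge_of T) @: S'.
  apply/setP=> A; apply/idP/imsetP => [AS|[pq + ->]]; last by rewrite inE => /andP[].
  have := subsetP SC A AS; rewrite cutE // => /imsetP[pq pqC AE].
  by exists pq => //; rewrite inE pqC -AE.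
have S'C : S' \subset cpairs e X by apply/subsetP=> pq; rewrite inE => /andP[].
have S'2 : #|S'| = 2.
  rewrite -S2 SE card_in_imset // => a b /(subsetP S'C) aC /(subsetP S'C) bC.
  exact: (edge_of_inj aC bC).
have /eqP/cards2P[[p1 q1] [[p2 q2] [n12 S'E]]] := S'2.
have cC : #|cpairs e X| = 3 by rewrite -card_cut.
have /eqP/cards1P[[p3 q3] rE] : #|cpairs e X :\: S'| = 1.
  by rewrite cardsD (setIidPr S'C) cC S'2.
have LC : lists_cut e X [:: (p1, q1); (p2, q2); (p3, q3)].
  have in3 : (p3, q3) \in cpairs e X :\: S' by rewrite rE inE.
  split.
    move: in3; rewrite in_setD S'E !inE negb_or => /andP[/andP[n31 n32] _].
    by rewrite /= !inE negb_or n12 eq_sym n31 eq_sym n32.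
  move=> p q; rewrite -(setD1K (_ : (p3, q3) \in cpairs e X)); last by move: in3; rewrite inE => /andP[].
  have -> : cpairs e X :\ (p3, q3) = S'.
    apply/setP=> z; move/setP/(_ z): rE; rewrite !in_setD1 in_setD in_set1 => zE.
    by rewrite -zE; case: (boolP (z \in S')) => [/(subsetP S'C)->|_] //=; rewrite andNb.
  rewrite [in RHS]inE S'E !inE.
  by do 3!case: (_ == _).
have [F [lF FE]] := crosses_lfactor G LC.2 LC.1 (crosses_all G z8 t4 f6 T6 X0 XT LC).
exists F; split=> // A AC; rewrite FE // SE S'E imsetU1 imset_set1.
by rewrite !inE.
Qed.

(** * The equivalences *)

Lemma cubic_3conn_vertex (T : finType) (e : rel T) : cubic_3conn e -> exists x : T, x \in T.
Proof. by move=> [_ _ _ [T3 _]]; apply/card_gt0P; apply: leq_trans T3. Qed.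

Lemma cubic_path3 (T : finType) (e : rel T) (x y : T) : cubic_3conn e -> e x y ->
  exists z, e y z /\ gpath e [:: x; y; z].
Proof.
move=> [_ irr cub _] exy; have [z [eyz]] := @cubic_nbr _ e y [:: x] cub isT.
rewrite inE => zx; exists z; split=> //.
by rewrite /= !inE negb_or exy eyz (cubic_irr irr exy) (cubic_irr irr eyz) eq_sym zx.
Qed.

(** The centres on [L] are recorded because [z8_z3] reads off from them that the given edge is
    used. *)
Lemma path3_extend (T : finType) (e : rel T) (L : seq T) : symmetric e ->
  gpath e L -> size L = 3 -> has_lfactor (~: [set y in L]) e ->
  exists c, star_fun setT e c /\ {in L, forall v, c v = nth v L 1}.
Proof.
move=> symE; case: L => [|x [|y [|z []]]] // /andP[uL /and3P[exy eyz _]] _ /has_starP[]// c sc.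
have [ct [st ctE]] := star_of_triple symE uL exy eyz.
have [|c' [s' _ tE]] := star_union_ex _ sc st; first by rewrite disjoint_sym disjoints_subset setCK.
exists c'; rewrite setUC setUCr in s'; split=> // v vL.
by rewrite tE ?in_set // ctE.
Qed.

Lemma path3_lfactor (T : finType) (e : rel T) (L : seq T) : symmetric e ->
  gpath e L -> size L = 3 -> has_lfactor (~: [set y in L]) e -> has_lfactor setT e.
Proof.
move=> symE pL sL fac; apply/has_starP => //.
by have [c [sc _]] := path3_extend symE pL sL fac; exists c.
Qed.

Lemma set_seq3 (T : finType) (x y z : T) : [set w in [:: x; y; z]] = [set x; y; z].
Proof. by apply/setP=> w; rewrite !inE orbA. Qed.

Lemma z8_z3 : stmt_z8 -> stmt_z3.
Proof.
move=> z8 T e G T6 A Ae; have [symE _ _ _] := G.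
have [x [y [exy ->]]] := edge_setP _ _ Ae.
have [z [_ pL]] := cubic_path3 G exy.
have [c [sc cL]] := path3_extend symE pL erefl (z8 _ _ G T6 _ pL erefl).
have lF := star_lfactor symE sc; exists (star_rel setT c); split=> //.
have [irr symF] : irreflexive e /\ symmetric (star_rel setT c) by split; [case: G|case: lF].
rewrite edge_set2 // /star_rel /= !in_setT (cubic_irr irr exy) cL ?inE ?eqxx //.
Qed.

Lemma z8_z5 : stmt_z8 -> stmt_z5.
Proof.
move=> z8 T e G T6 x; have [symE irr cub _] := G.
have [y [exy _]] := @cubic_nbr _ e x [::] cub isT.
have [u [w [exu exw /and3P[uy wy uw] _]]] := cubic_nbrs cub exy.
have xy := cubic_irr irr exy; have xu := cubic_irr irr exu; have xw := cubic_irr irr exw.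
have p1 : gpath e [:: u; x; y] by rewrite /= !inE negb_or eq_sym xu uy xy symE exu exy.
have p2 : gpath e [:: u; x; w] by rewrite /= !inE negb_or eq_sym xu uw xw symE exu exw.
exists [:: u; x; y], [:: u; x; w]; split.
- apply/eqP => /setP/(_ [set x; y]); rewrite mem_path_edges ?inE ?eqxx ?orbT //.
  move/esym/existsP => [[a b]]; rewrite !inE /= !xpair_eqE set2_eq => /andP[].
  move=> /orP[]/andP[/eqP-> /eqP->]; rewrite ?eqxx ?(negPf xu) ?(negPf xw) /=.
    by rewrite (eq_sym y u) (negPf uy).
  by rewrite orbF (eq_sym y w) (negPf wy).
- by split=> //; apply: z8.
by split=> //; apply: z8.
Qed.

Lemma z5_z4 : stmt_z5 -> stmt_z4.
Proof. by move=> z5 T e G T6 x; have [L [_ [_ h _]]] := z5 T e G T6 x; exists L. Qed.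

Lemma z4_z1 : stmt_z4 -> stmt_z1.
Proof.
move=> z4 T e G T6; have [symE _ _ _] := G; have [x _] := cubic_3conn_vertex G.
by have [L [pL sL _ fac]] := z4 T e G T6 x; apply: path3_lfactor fac.
Qed.

Lemma z8_z6 : stmt_z8 -> stmt_z6.
Proof.
move=> z8 T e G T6 x y exy; have [symE irr cub _] := G.
have [y' [eyy' py]] := cubic_path3 G exy.
have eyx : e y x by rewrite symE.
have [x' [exx' px]] := cubic_path3 G eyx.
exists x', y'; split=> //.
- by move: px; rewrite /= !inE negb_or => /andP[/andP[/andP[_]]]; rewrite eq_sym.
- by move: py; rewrite /= !inE negb_or => /andP[/andP[/andP[_]]]; rewrite eq_sym.
- by rewrite -set_seq3; apply: z8.
rewrite (_ : [set x'; x; y] = [set w in [:: y; x; x']]); first exact: z8.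
by apply/setP=> w; rewrite !inE; do 3!case: (w == _).
Qed.

Lemma z6_z1 : stmt_z6 -> stmt_z1.
Proof.
move=> z6 T e G T6; have [symE irr cub _] := G; have [x _] := cubic_3conn_vertex G.
have [y [exy _]] := @cubic_nbr _ e x [::] cub isT.
have [x' [y' [[exx' eyy'] _ yx fac _]]] := z6 T e G T6 x y exy.
apply: (path3_lfactor (L := [:: x; y; y'])) => //; last by rewrite set_seq3.
by rewrite /= !inE negb_or exy eyy' (cubic_irr irr exy) (cubic_irr irr eyy') eq_sym yx.
Qed.

Lemma z7_z2 : stmt_z7 -> stmt_z2.
Proof.
move=> z7 T e G T6 A Ae; have [symE irr cub _] := G.
have [x [y [exy AE]]] := edge_setP _ _ Ae.
have [z [exz]] := @cubic_nbr _ e x [:: y] cub isT; rewrite inE => zy.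
have AB : A != [set x; z].
  by rewrite AE set2_eq eqxx (eq_sym y) (negPf zy) (negPf (cubic_irr irr exz)).
have XE : [set A; [set x; z]] \subset edge_set e by rewrite subUset !sub1set Ae edge_set2.
have := z7 T e G T6 _ XE; rewrite cards2 AB => /(_ erefl).
by apply: lfactor_mono => u v _ _ /andP[euv]; rewrite /del_edges euv !inE negb_or => /andP[].
Qed.

Lemma z2_z1 : stmt_z2 -> stmt_z1.
Proof.
move=> z2 T e G T6; have [symE irr cub _] := G; have [x _] := cubic_3conn_vertex G.
have [y [exy _]] := @cubic_nbr _ e x [::] cub isT.
have Ae : [set x; y] \in edge_set e by rewrite edge_set2.
by apply: lfactor_mono (z2 T e G T6 _ Ae) => u v _ _ /andP[].
Qed.

Lemma z3_z1 : stmt_z3 -> stmt_z1.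
Proof.
move=> z3 T e G T6; have [symE irr cub _] := G; have [x _] := cubic_3conn_vertex G.
have [y [exy _]] := @cubic_nbr _ e x [::] cub isT.
have Ae : [set x; y] \in edge_set e by rewrite edge_set2.
by have [F [lF _]] := z3 T e G T6 _ Ae; exists F.
Qed.

Lemma z9_z1 : stmt_z9 -> stmt_z1.
Proof.
move=> z9 T e G T6; have [symE irr cub [T3 _]] := G; have [x _] := cubic_3conn_vertex G.
have x0 : [set x] != set0 by rewrite -card_gt0 cards1.
have xT : [set x] != setT by apply: contraTneq T3 => xE; rewrite -cardsT -xE cards1.
have c3 : #|cut e [set x]| = 3.
  rewrite card_cut // (_ : cpairs e [set x] = [set (x, y) | y in [set y | e x y]]).
    by rewrite card_imset ?cub // => y z [].
  apply/setP=> -[a b]; rewrite !inE /=; apply/idP/imsetP => [/and3P[/eqP-> _ exb]|[y + [-> ->]]].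
    by exists b; rewrite ?inE.
  by rewrite inE eqxx eq_sym => exy; rewrite (cubic_irr irr exy) exy.
have [A Ac] : exists A, A \in cut e [set x] by apply/card_gt0P; rewrite c3.
have S2 : #|cut e [set x] :\ A| = 2 by move: (cardsD1 A (cut e [set x])); rewrite Ac c3 => -[].
by have [F [lF _]] := z9 T e G T6 _ x0 xT c3 _ (subD1set _ _) S2; exists F.
Qed.

Lemma z8_z4 : stmt_z8 -> stmt_z4.
Proof. by move/z8_z5/z5_z4. Qed.

Lemma t2_t1 : stmt_t2 -> stmt_t1.
Proof.
move=> t2 T e G T6 x; have [_ _ cub _] := G.
by have [y [exy _]] := @cubic_nbr _ e x [::] cub isT; exists y; split=> //; apply: t2.
Qed.

Lemma t4_t3 : stmt_t4 -> stmt_t3.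
Proof.
move=> t4 T e G T6 x; have [_ _ cub _] := G.
have [y [exy _]] := @cubic_nbr _ e x [::] cub isT.
by have [W [pW sW nW _ fac]] := t4 T e G T6 x y exy; exists W.
Qed.

Lemma f2_f1 : stmt_f2 -> stmt_f1.
Proof.
move=> f2 T e G T6 x; have [symE _ cub _] := G.
have [y [exy _]] := @cubic_nbr _ e x [::] cub isT.
have Ae : [set x; y] \in edge_set e by rewrite edge_set2.
by apply: lfactor_mono (f2 T e G T6 x _ Ae) => u v _ _ /andP[].
Qed.

Lemma f6_f5 : stmt_f6 -> stmt_f5.
Proof.
move=> f6 T e G T6 x y exy; have [symE irr cub _] := G.
have [z [eyz pL]] := cubic_path3 G exy.
have [Z [pZ sZ [E1 E2] hl fac]] := f6 T e G T6 x y z pL.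
have uL : uniq [:: x; y; z] by case/andP: pL.
have [w [ewx nw ZE]] := f6_shape symE pZ sZ uL E1 E2 hl.
exists [:: w; x; y; z]; split=> //; last first.
  by apply: lfactor_eq fac; apply/setP=> v; rewrite !inE ZE !inE.
by apply/andP; split; [rewrite cons_uniq nw|rewrite /= ewx exy eyz].
Qed.

Lemma f5_f3 : stmt_f5 -> stmt_f3.
Proof.
move=> f5 T e G T6 x; have [_ _ cub _] := G.
have [y [exy _]] := @cubic_nbr _ e x [::] cub isT.
have [Z [pZ sZ nZ fac]] := f5 T e G T6 x y exy; exists Z; split=> //.
by have := set21 x y; rewrite -nZ !inE => /orP[]/eqP; auto.
Qed.

Lemma f3_f4 : stmt_f3 -> stmt_f4.
Proof.
move=> f3 T e G T6 x; have [symE irr cub _] := G.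
have [Z [pZ sZ nZ fac]] := f3 T e G T6 x.
suff [y [exy yZ]] : exists y, e x y /\ [set x; y] \notin path_edges Z by exists y, Z.
case: Z pZ sZ nZ {fac} => [|z0 [|z1 [|z2 [|z3 []]]]] //= /andP[+ _] _.
rewrite !inE !negb_or => /and4P[/and3P[n01 n02 n03] /andP[n12 n13] n23 _] nZ.
(* An inner vertex lies on two edges of [Z]; the third edge at x is the one to exhibit. *)
have [y [exy]] := @cubic_nbr _ e x (if z1 == x then [:: z0; z2] else [:: z1; z3]) cub ltac:(by case: ifP).
move=> yn; exists y; split=> //; apply/negP; rewrite inE => /existsP[[a b]].
rewrite !inE /= !xpair_eqE set2_eq => /andP[m E].
case: nZ yn => xE; subst x; rewrite ?eqxx ?(negPf n12) !inE !negb_or => /andP[y1 y2].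
  case/or3P: m E => /andP[/eqP-> /eqP->];
    rewrite ?eqxx ?(eq_sym z1 z0) ?(negPf n01) ?(negPf n12) ?(negPf n13) ?(negPf y1) ?(negPf y2) ?andbF //.
case/or3P: m E => /andP[/eqP-> /eqP->];
  rewrite ?eqxx ?(eq_sym z2 z0) ?(eq_sym z2 z1) ?(negPf n02) ?(negPf n12) ?(negPf n23) ?(negPf y1) ?(negPf y2) ?andbF //.
Qed.

Lemma f4_f3 : stmt_f4 -> stmt_f3.
Proof.
move=> f4 T e G T6 x; have [y [Z [[_ pZ] sZ nZ _ fac]]] := f4 T e G T6 x.
by exists Z.
Qed.

Theorem theorem3p1 :
  [<-> stmt_z1; stmt_z2; stmt_z3; stmt_z4; stmt_z5; stmt_z6; stmt_z7; stmt_z8;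
       stmt_z9; stmt_t1; stmt_t2; stmt_t3; stmt_t4; stmt_f1; stmt_f2; stmt_f3;
       stmt_f4; stmt_f5; stmt_f6].
Proof.
(* z1 is the hub: most links of the cycle lead back to z1 and out again through z8, t4 or f6. *)
have z18 : stmt_z1 -> stmt_z8 by move/z1_f1/f1_z8.
have z14 : stmt_z1 -> stmt_t4 by move/z18/z8_f2/f2_t4.
have z16 : stmt_z1 -> stmt_f6 by move/z18/z8_f6.
tfae.
- by move/z18/z8_t2/t2_z7/z7_z2.
- by move/z2_z1/z18/z8_z3.
- by move/z3_z1/z18/z8_z4.
- by move/z4_z1/z18/z8_z5.
- by move/z5_z4/z4_z1/z18/z8_z6.
- by move/z6_z1/z18/z8_t2/t2_z7.
- by move/z7_z2/z2_z1/z18.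
- by move/z8_z4/z4_z1 => z1; apply: z8_t4_f6_z9; [exact: z18|exact: z14|exact: z16].
- by move/z9_z1/z18/z8_t2/t2_t1.
- by move/t1_z1/z18/z8_t2.
- by move/t2_z7/z7_z2/z2_z1/z14/t4_t3.
- by move/t3_z1/z14.
- by move/t4_t3/t3_z1/z1_f1.
- by move/f1_z8/z8_f2.
- by move/f2_f1/f1_z8/z8_f6/f6_f5/f5_f3.
- exact: f3_f4.
- by move/f4_f3/f3_z1/z16/f6_f5.
- by move/f5_f3/f3_z1/z16.
- by move/f6_f5/f5_f3/f3_z1.
Qed.
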